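(* Let $(\Omega,\mathcal{A},P)$ be a probability space, $(\mathcal{G}_n:n\geq 0)$ an increasing filtration of sub-$\sigma$-fields of $\mathcal{A}$, and $(X_n:n\geq 1)$ a sequence of integrable real random variables on $(\Omega,\mathcal{A},P)$. Put $Z_n=E(X_{n+1}\mid\mathcal{G}_n)$ for $n\ge 0$ and $\overline{X}_n=\frac1n\sum_{k=1}^nX_k$ for $n\geq 1$. Suppose $\sigma(X_n)\subset\mathcal{G}_n$ for each $n\geq 1$, $(X_n^2)$ is uniformly integrable, and $$E\Bigl\{\bigl(E(Z_{n+1}\mid\mathcal{G}_n)-Z_n\bigr)^2\Bigr\}=o(n^{-3})\quad\text{as }n\to\infty .$$ Let $Z$ be the a.s. and $L_1$ limit of $(Z_n)$ (which exists under these assumptions), and define $$C_n=\sqrt{n}\,\bigl(\overline{X}_n-Z_n\bigr),\qquad D_n=\sqrt{n}\,\bigl(Z_n-Z\bigr).$$ Let $U$ and $V$ be real non negative random variables on $(\Omega,\mathcal{A},P)$ and consider the conditions (all limits as $n\to\infty$): (a) $\frac{1}{\sqrt{n}}\,E\bigl\{\max_{1\leq k\leq n}k\,|Z_{k-1}-Z_k|\bigr\}\longrightarrow 0$; (b) $\frac{1}{n}\sum_{k=1}^n\bigl\{X_k-Z_{k-1}+k(Z_{k-1}-Z_k)\bigr\}^2\longrightarrow U$ in probability; (c) $\sqrt{n}\,E\bigl\{\sup_{k\geq n}|Z_{k-1}-Z_k|\bigr\}\longrightarrow 0$; (d) $n\sum_{k\geq n}(Z_{k-1}-Z_k)^2\longrightarrow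 V$ in probability. Then: (1) if (a) and (b) hold, $C_n\rightarrow\mathcal{N}(0,U)$ stably; (2) if (c) and (d) hold, $D_n\rightarrow\mathcal{N}(0,V)$ stably in strong sense, with respect to $(\mathcal{G}_n)$; (3) in particular, if (a), (b), (c) and (d) all hold, then $(C_n,D_n)\longrightarrow\mathcal{N}(0,U)\times\mathcal{N}(0,V)$ stably.
   Context: A kernel on a metric space $S$ (random probability measure on $S$) is a collection $N=\{N(\omega):\omega\in\Omega\}$ of Borel probability measures on $S$ such that $\omega\mapsto N(\omega)(f)=\int f\,dN(\omega)$ is $\mathcal{A}$-measurable for each bounded Borel $f:S\to\mathbb{R}$. For a sequence $(Y_n)$ of $S$-valued random variables on $(\Omega,\mathcal{A},P)$: - $Y_n\to N$ stably means that $P(Y_n\in\cdot\mid H)\to E(N(\cdot)\mid H)$ weakly for all $H\in\mathcal{A}$ with $P(H)>0$ (where $P(\cdot\mid H)$ and $E(\cdot\mid H)$ are conditional on the event $H$). - $Y_n\to N$ stably in strong sense, with respect to a sequence $(\mathcal{F}_n)$ of sub-$\sigma$-fields of $\mathcal{A}$, means that $E(f(Y_n)\mid\mathcal{F}_n)\to N(f)$ in probability for each bounded continuous $f:S\to\mathbb{R}$. $\mathcal{N}(a,b)$ is the one-dimensional Gaussian law with mean $a$ and variance $b\geq 0$, with $\mathcal{N}(a,0)=\delta_a$. For a real random variable $L\ge 0$, $\mathcal{N}(0,L)$ is the kernel $\omega\mapsto\mathcal{N}(0,L(\omega))$ on $\mathbb{R}$. For kernels $M,N$ on $S$, $M\times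 N$ is the kernel on $S\times S$ given by $(M\times N)(\omega)=M(\omega)\times N(\omega)$ (product measure). Under the assumption $\sup_nEX_n^2<\infty$ and the displayed $o(n^{-3})$ condition, $(Z_n)$ is a uniformly integrable quasi-martingale, so it converges a.s. and in $L_1$ to some real random variable $Z$. *)

(* Defs.v *)
From HB Require Import structures.
From mathcomp Require Import all_boot all_order all_algebra.
From mathcomp Require Import all_classical all_reals all_analysis.
From mathcomp Require Import measurable_realfun.
Set Implicit Arguments.
Unset Strict Implicit.
Unset Printing Implicit Defensive.
Import Order.TTheory GRing.Theory Num.Theory.
Import numFieldNormedType.Exports.
Local Open Scope classical_set_scope.
Local Open Scope ring_scope.

(* A topological space whose measurable sets are its Borel sets. *)
HB.mixin Record isBorel d T & Topological T & Measurable d T := {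
  measurable_borel : @measurable d T = <<s (@open T) >> }.
#[short(type="borelType")]
HB.structure Definition Borel d :=
  { T of Topological T & Measurable d T & isBorel d T }.

Lemma measurable_borelR (R : realType) : @measurable _ R = <<s (@open R) >>.
Proof.
apply/seteqP; split; last first.
  apply: smallest_sub; first exact: sigma_algebra_measurable.
  by move=> A oA; exact: open_measurable.
rewrite [X in X `<=` _](@RGenOpens.measurableE R).
apply: smallest_sub; first exact: smallest_sigma_algebra.
by move=> A [x [y ->]] /=; apply: sub_gen_smallest; exact: interval_open.
Qed.

HB.instance Definition _ (R : realType) :=
  isBorel.Build _ R (measurable_borelR R).

Lemma measurable_borelRR (R : realType) :
  @measurable _ (R * R)%type = <<s (@open (R * R)%type) >>.
Proof.
apply/seteqP; split.
  apply: smallest_sub; first exact: smallest_sigma_algebra.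
  have H (f : R * R -> R) : continuous f ->
      preimage_set_system setT f measurable `<=` <<s (@open (R * R)%type) >>.
    move=> cf; rewrite measurable_borelR -g_sigma_preimageE.
    apply: smallest_sub; first exact: smallest_sigma_algebra.
    move=> _ [B oB <-]; apply: sub_gen_smallest; rewrite setTI.
    by apply: open_comp => // ? _; exact: cf.
  move=> A [|] /H; apply => p.
    exact: (@cvg_fst _ _ (nbhs p.1) (nbhs p.2)).
  exact: (@cvg_snd _ _ (nbhs p.1) (nbhs p.2)).
apply: smallest_sub; first exact: sigma_algebra_measurable.
move=> A oA.
pose box (q : (rat * rat) * (rat * rat)) : set (R * R) :=
  `]ratr q.1.1, ratr q.1.2[%classic `*` `]ratr q.2.1, ratr q.2.2[%classic.
have -> : A = \bigcup_(q in [set q | box q `<=` A]) box q.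
  apply/seteqP; split=> [[x y] Axy|p [q qA pq]]; last exact: qA.
  have : nbhs (x, y) A by exact: oA.
  move=> [[B1 B2] /= [/nbhs_ballP[e1 /= e10 B1e] /nbhs_ballP[e2 /= e20 B2e]]].
  move=> BA.
  have F (z e : R) : 0 < e -> exists q : rat * rat,
      [/\ z - e < ratr q.1, ratr q.1 < z, z < ratr q.2 & ratr q.2 < z + e].
    move=> e0; have [|a] := @rat_in_itvoo R (z - e) z.
      by rewrite ltrBlDr ltrDl.
    rewrite in_itv/= => /andP[? ?].
    have [|b] := @rat_in_itvoo R z (z + e); first by rewrite ltrDl.
    by rewrite in_itv/= => /andP[? ?]; exists (a, b).
  have [a [a1 a2 a3 a4]] := F x e1 e10.
  have [b [b1 b2 b3 b4]] := F y e2 e20.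
  exists (a, b) => /=; last by split; rewrite /= in_itv/= ?a2 ?a3 ?b2 ?b3.
  move=> [u v] [/=]; rewrite !in_itv/= => /andP[u1 u2] /andP[v1 v2]; apply: BA.
  split=> /=; [apply: B1e|apply: B2e]; rewrite /ball/= ltr_distlC.
    by rewrite (lt_trans a1)// (lt_trans u2).
  by rewrite (lt_trans b1)// (lt_trans v2).
rewrite bigcup_mkcond; apply: countable_bigcupT_measurable => [|q].
  exact: countableP.
by case: ifPn => // _; apply: measurableX; exact: measurable_itv.
Qed.

HB.instance Definition _ (R : realType) :=
  isBorel.Build _ (R * R)%type (measurable_borelRR R).
Section gauss.
Context {R : realType}.

(* Gaussian law with mean a and variance b. The second argument of normal_prob
   is the standard deviation, and normal_prob a 0 is uniform on [0, 1], whence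
   the case distinction. *)
Definition gauss_law (a b : R) : set R -> \bar R :=
  if b == 0 then \d_a else normal_prob a (Num.sqrt b).

Variables a b : R.

Let gauss0 : gauss_law a b set0 = 0%E.
Proof. by rewrite /gauss_law; case: ifPn => // _; rewrite measure0. Qed.

Let gauss_ge0 A : (0 <= gauss_law a b A)%E.
Proof. by rewrite /gauss_law; case: ifPn. Qed.

Let gauss_sigma_additive : semi_sigma_additive (gauss_law a b).
Proof.
rewrite /gauss_law; case: ifPn => _; first exact: measure_semi_sigma_additive.
exact: (@measure_semi_sigma_additive _ _ _ (normal_prob a (Num.sqrt b))).
Qed.

HB.instance Definition _ := isMeasure.Build _ R R (gauss_law a b)
  gauss0 gauss_ge0 gauss_sigma_additive.

Let gauss_setT : gauss_law a b setT = 1%E.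
Proof. by rewrite /gauss_law; case: ifPn => _; rewrite probability_setT. Qed.

HB.instance Definition _ :=
  Measure_isProbability.Build _ R R (gauss_law a b) gauss_setT.

End gauss.


Lemma measurable_sqrt (R : realType) : measurable_fun [set: R] (@Num.sqrt R).
Proof. by apply: nondecreasing_measurable => // x y; exact: ler_wsqrtr. Qed.

Lemma ge0_measurable_inv d (T : measurableType d) (R : realType) (f : T -> R) :
  (forall x, 0 <= f x) -> measurable_fun setT f ->
  measurable_fun setT (fun x => (f x)^-1).
Proof.
move=> f0 mf; rewrite (_ : (fun _ => _) = (@powR R)^~ (-1) \o f).
  exact: measurableT_comp (measurable_powR _) mf.
by apply/funext => x /=; rewrite powR_inv1.
Qed.

Lemma measurable_normal_prob_sd d (T : measurableType d) (R : realType)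
    (s : T -> R) (A : set R) : measurable_fun setT s -> measurable A ->
  measurable_fun setT (fun w => normal_prob 0 (s w) A).
Proof.
move=> ms mA.
have mT (f : T -> R) : measurable_fun setT f ->
    measurable_fun [set: T * measurableTypeR R] (fun z => f z.1).
  by move=> mf; exact: (measurableT_comp mf).
have ms2 c : measurable_fun setT (fun w => s w ^+ 2 * c).
  by apply: measurable_funM => //; exact: measurable_funX.
have mx : measurable_fun [set: T * measurableTypeR R] (fun z => z.2 : R).
  exact: measurable_snd.
pose g (z : T * measurableTypeR R) : \bar R :=
  (normal_peak (s z.1) * normal_fun 0 (s z.1) z.2 * \1_A z.2)%:E.
have mg : measurable_fun setT g.
  apply/measurable_EFinP; apply: measurable_funM; last first.
    by apply: (measurableT_comp _ mx); exact: measurable_indic.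
  apply: measurable_funM.
    apply: (mT (fun w => normal_peak (s w))).
    apply: ge0_measurable_inv => [w|]; first exact: sqrtr_ge0.
    apply: (measurableT_comp (@measurable_sqrt R)).
    rewrite [X in measurable_fun _ X](_ : _ = fun w => s w ^+ 2 * (pi *+ 2)).
      exact: ms2.
    by apply/funext => w; rewrite -mulrnAr.
  rewrite /normal_fun; apply: (measurableT_comp (@measurable_expR R)).
  apply: measurable_funM.
    apply: measurableT_comp => //; apply: measurable_funX.
    exact: measurable_funB.
  apply: (mT (fun w => (s w ^+ 2 *+ 2)^-1)).
  apply: ge0_measurable_inv => [w|]; first by rewrite mulrn_wge0 ?sqr_ge0.
  rewrite [X in measurable_fun _ X](_ : _ = fun w => s w ^+ 2 * 2).
    exact: ms2.
  by apply/funext => w; rewrite mulr_natr.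
have -> : (fun w => normal_prob 0 (s w) A) = fun w => if s w == 0 then
    normal_prob (0 : R) 0 A else fubini_F lebesgue_measure g w.
  apply/funext => w; case: ifPn => [/eqP -> //|sw0].
  rewrite /normal_prob /fubini_F [LHS]integral_mkcond.
  apply: eq_integral => x _.
  rewrite patchE /g /= normal_pdfE// indicE.
  by case: ifPn; rewrite ?mulr1 ?mulr0.
apply: measurable_fun_ifT => //.
  by apply: measurable_fun_eqr.
apply: measurable_fun_fubini_tonelli_F => // z.
by rewrite lee_fin !mulr_ge0// ?normal_peak_ge0// normal_fun_ge0.
Qed.

Section gauss_kernel.
Context d (T : measurableType d) (R : realType).
Variable L : {mfun T >-> R}.

Definition gauss_kernel (w : T) : {measure set R -> \bar R} :=
  gauss_law 0 (L w).

Let measurable_gauss_kernel U :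
  measurable U -> measurable_fun setT (gauss_kernel ^~ U).
Proof.
move=> mU.
have -> : gauss_kernel ^~ U = fun w =>
    if L w == 0 then \d_(0 : R) U else normal_prob 0 (Num.sqrt (L w)) U.
  by apply/funext => w; rewrite /gauss_kernel/= /gauss_law; case: ifPn.
apply: measurable_fun_ifT => //.
  exact: measurable_fun_eqr.
apply: measurable_normal_prob_sd => //.
exact: measurableT_comp (@measurable_sqrt R) _.
Qed.

HB.instance Definition _ :=
  isKernel.Build _ _ _ _ R gauss_kernel measurable_gauss_kernel.

Let gauss_kernel_setT w : gauss_kernel w setT = 1%E.
Proof. exact: (probability_setT (gauss_law 0 (L w))). Qed.

HB.instance Definition _ :=
  Kernel_isProbability.Build _ _ _ _ R gauss_kernel gauss_kernel_setT.
End gauss_kernel.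

Section kernel_law.
Context d d' (T : measurableType d) (S : measurableType d') (R : realType).
Variable N : R.-pker T ~> S.

(* The values of N as probability measures, as product measures require. *)
Definition kernel_law (w : T) : set S -> \bar R := N w.
HB.instance Definition _ (w : T) := Measure.on (kernel_law w).
HB.instance Definition _ (w : T) :=
  Measure_isProbability.Build _ _ R (kernel_law w) (prob_kernel w).
End kernel_law.

Section kernel_prod.
Context d d1 d2 (T : measurableType d) (S1 : measurableType d1)
  (S2 : measurableType d2) (R : realType).
Variables (M : R.-pker T ~> S1) (N : R.-pker T ~> S2).

Definition kernel_prod (w : T) : {measure set (S1 * S2) -> \bar R} :=
  (kernel_law M w \x kernel_law N w)%E.

Let N1 (p : T * S1) : {measure set S2 -> \bar R} := N p.1.

Let mN1 U : measurable U -> measurable_fun setT (N1 ^~ U).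
Proof. by move=> mU; exact: (measurableT_comp (measurable_kernel N U mU)). Qed.

HB.instance Definition _ := isKernel.Build _ _ _ _ R N1 mN1.
HB.instance Definition _ :=
  Kernel_isProbability.Build _ _ _ _ R N1 (fun p => prob_kernel p.1).

Let measurable_kernel_prod U :
  measurable U -> measurable_fun setT (kernel_prod ^~ U).
Proof.
move=> mU; rewrite (_ : kernel_prod ^~ U = kproduct M N1 ^~ U).
  exact: measurable_kproduct.
apply/funext => w; apply: eq_integral => x _ /=; rewrite /kernel_law.
by rewrite -(kernel.intker_indicE N1).
Qed.

HB.instance Definition _ :=
  isKernel.Build _ _ _ _ R kernel_prod measurable_kernel_prod.

Let kernel_prod_setT w : kernel_prod w setT = 1%E.
Proof.
rewrite /kernel_prod -setXTT [LHS]product_measure1E//.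
rewrite [X in (X * _)%E](prob_kernel w) [X in (_ * X)%E](prob_kernel w).
by rewrite mule1.
Qed.

HB.instance Definition _ :=
  Kernel_isProbability.Build _ _ _ _ R kernel_prod kernel_prod_setT.
End kernel_prod.

Section kernel_mean.
Context d d' (T : measurableType d) (S : measurableType d') (R : realType).
Variables (P : probability T R) (N : R.-pker T ~> S).
Local Open Scope ereal_scope.

(* E(N(.)) *)
Definition kernel_mean (B : set S) : \bar R := \int[P]_w N w B.

Let kernel_mean0 : kernel_mean set0 = 0.
Proof. by apply: integral0_eq => w _; rewrite measure0. Qed.

Let kernel_mean_ge0 B : 0 <= kernel_mean B.
Proof. exact: integral_ge0. Qed.

Let kernel_mean_sigma_additive : semi_sigma_additive kernel_mean.
Proof.
move=> F mF tF mUF.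
rewrite [X in _ --> X](_ : _ = \sum_(n <oo) kernel_mean (F n)).
  exact: is_cvg_ereal_nneg_natsum.
rewrite /kernel_mean -integral_nneseries//; last first.
  by move=> n; exact: measurable_kernel.
by apply: eq_integral => w _; rewrite -measure_semi_bigcup.
Qed.

HB.instance Definition _ := isMeasure.Build _ S R kernel_mean
  kernel_mean0 kernel_mean_ge0 kernel_mean_sigma_additive.

Let kernel_mean_setT : kernel_mean setT = 1.
Proof.
rewrite /kernel_mean; under eq_integral do rewrite prob_kernel.
by rewrite integral_cst// mul1e; exact: probability_setT.
Qed.

HB.instance Definition _ :=
  Measure_isProbability.Build _ S R kernel_mean kernel_mean_setT.
End kernel_mean.

Section cond_exp.
Context d (T : measurableType d) (R : realType) (P : probability T R).

Definition sub_sigma_field (G : set (set T)) :=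
  sigma_algebra setT G /\ G `<=` measurable.

(* W is a version of E(X | G). *)
Definition is_cond_exp (G : set (set T)) (X W : T -> R) := [/\
  g_sigma_algebra_preimage W `<=` G,
  P.-integrable setT (EFin \o W) &
  forall A, G A -> (\int[P]_(w in A) (W w)%:E = \int[P]_(w in A) (X w)%:E)%E].

Lemma is_cond_exp_exists (G : set (set T)) (X : T -> R) :
  sub_sigma_field G -> P.-integrable setT (EFin \o X) ->
  exists W, is_cond_exp G X W.
Proof.
move=> [sG Gm] iX.
pose T' : measurableType _ := g_sigma_algebraType G.
have mT'E : @measurable _ T' = G by exact: measurable_g_measurableTypeE.
have mid : measurable_fun setT (id : T -> T').
  by move=> _ A; rewrite mT'E setTI => /Gm.
pose phi : {mfun T >-> T'} :=
  HB.pack (id : T -> T') (isMeasurableFun.Build _ _ _ _ _ mid).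
pose mu : probability T' R := distribution P phi.
pose nu0 : {charge set T -> \bar R} := induced_charge iX.
pose nuf : set T' -> \bar R := fun A => nu0 A.
have nuf0 : nuf set0 = 0%E by exact: (charge0 nu0).
have nuff A : measurable A -> nuf A \is a fin_num.
  by rewrite mT'E => /Gm; exact: fin_num_measure.
have nufs : semi_sigma_additive nuf.
  move=> F mF tF mUF; rewrite /nuf; apply: charge_semi_sigma_additive => //.
    by move=> i; apply: Gm; rewrite -mT'E.
  by apply: Gm; rewrite -mT'E.
pose nu : {charge set T' -> \bar R} :=
  HB.pack nuf (isCharge.Build _ T' R nuf nuf0 nuff nufs).
have numu : nu `<< mu.
  apply/null_content_dominatesP => A; rewrite mT'E => GA muA0.
  apply: null_set_integral => //; first exact: Gm.
  exact: measurable_funTS (measurable_int P iX).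
have [f [ffin fint fE]] := charge.Radon_Nikodym0 numu.
have mf : measurable_fun setT f by exact: (measurable_int mu).
pose W (w : T) : R := fine (f w).
have fW : f = EFin \o W by apply/funext => w; rewrite /= fineK.
have iW : P.-integrable setT (EFin \o W).
  apply/integrableP; split.
    by rewrite -fW; exact: (measurableT_comp mf mid).
  have /integrableP[_] := fint.
  rewrite ge0_integral_pushforward//; last exact: measurableT_comp.
  by rewrite fW.
exists W; split => //.
  move=> _ [B mB <-]; rewrite -mT'E.
  have /measurable_EFinP mW : measurable_fun [set: T'] (EFin \o W).
    by rewrite -fW.
  exact: mW.
move=> A GA; have mA : measurable (A : set T') by rewrite mT'E.
rewrite [RHS](fE A mA) fW integral_pushforward//.
- by rewrite -fW.
- by apply: (integrableS measurableT) => //; exact: Gm.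
Qed.
End cond_exp.

Section modes_of_convergence.
Context d (T : measurableType d) (R : realType) (P : probability T R).

Definition uniformly_integrable (I : Type) (F : I -> T -> R) :=
  ereal_sup (range (fun i =>
    \int[P]_(w in [set w | (a < `|F i w|)%R]) `|(F i w)%:E|)%E)
  @[a --> +oo%R] --> 0%E.

(* The sequence may take infinite values; the limit is real. *)
Definition cvg_in_prob (Y : nat -> T -> \bar R) (L : T -> R) :=
  forall e : R, 0 < e ->
    P [set w | (e%:E < `|Y n w - (L w)%:E|)%E] @[n --> \oo] --> 0%E.

(* P(. | H) when P H > 0; mnormalize falls back to P when P H = 0. *)
Definition cond_prob (H : set T) (mH : measurable H) : probability T R :=
  mnormalize (mrestr P mH) P.

End modes_of_convergence.

Section stable_convergence.
Context d d' (T : measurableType d) (S : borelType d') (R : realType).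

Definition weak_cvg (mu : nat -> probability S R) (nu : probability S R) :=
  forall f : S -> R, continuous f -> bounded_fun f ->
    (\int[mu n]_x f x)%R @[n --> \oo] --> (\int[nu]_x f x)%R.

Variable P : probability T R.

Definition stable_cvg (Y : nat -> {RV P >-> S}) (N : R.-pker T ~> S) :=
  forall (H : set T) (mH : measurable H), (0 < P H)%E ->
    weak_cvg (fun n => distribution (cond_prob P mH) (Y n))
             (kernel_mean (cond_prob P mH) N).

(* Versions of E(f(Y_n) | F_n) exist by is_cond_exp_exists, and convergence in
   probability does not depend on their choice. *)
Definition stable_strong_cvg (F : nat -> set (set T)) (Y : nat -> {RV P >-> S})
    (N : R.-pker T ~> S) :=
  forall f : S -> R, continuous f -> bounded_fun f ->
  forall E : nat -> T -> R,
    (forall n, is_cond_exp P (F n) (f \o Y n) (E n)) ->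
    cvg_in_prob P (fun n w => (E n w)%:E) (fun w => \int[N w]_x f x)%R.

End stable_convergence.
Arguments stable_cvg {d d' T S R} P Y N.
Arguments stable_strong_cvg {d d' T S R} P F Y N.

Section statistics.
Context d (T : measurableType d) (R : realType).

Section rv_pair.
Variables X Y : {mfun T >-> R}.
Definition rv_pair (w : T) : R * R := (X w, Y w).
Let measurable_rv_pair : measurable_fun setT rv_pair.
Proof. exact: measurable_fun_pair. Qed.
HB.instance Definition _ := isMeasurableFun.Build _ _ _ _ rv_pair
  measurable_rv_pair.
End rv_pair.

Variables X Z : nat -> {mfun T >-> R}.

Definition sample_mean (n : nat) (w : T) : R :=
  n%:R^-1 * \sum_(1 <= k < n.+1) X k w.

Definition C_stat (n : nat) (w : T) : R :=
  Num.sqrt n%:R * (sample_mean n w - Z n w).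

Let measurable_C_stat n : measurable_fun setT (C_stat n).
Proof.
apply: measurable_funM => //; apply: measurable_funB => //.
by apply: measurable_funM => //; exact: measurable_sum.
Qed.
HB.instance Definition _ n := isMeasurableFun.Build _ _ _ _ (C_stat n)
  (measurable_C_stat n).

Variable Zlim : {mfun T >-> R}.

Definition D_stat (n : nat) (w : T) : R :=
  Num.sqrt n%:R * (Z n w - Zlim w).

Let measurable_D_stat n : measurable_fun setT (D_stat n).
Proof. by apply: measurable_funM => //; exact: measurable_funB. Qed.
HB.instance Definition _ n := isMeasurableFun.Build _ _ _ _ (D_stat n)
  (measurable_D_stat n).

End statistics.

Section conditions.
Context d (T : measurableType d) (R : realType) (P : probability T R).
Variables (X Z : nat -> {RV P >-> R}) (U V : {RV P >-> R}).

Definition cond_a :=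
  (((Num.sqrt n%:R)^-1)%:E *
   'E_P[fun w => \big[Num.max/0%R]_(1 <= k < n.+1)
                   (k%:R * `|Z k.-1 w - Z k w|)%R])%E
  @[n --> \oo] --> 0%E.

Definition cond_b :=
  cvg_in_prob P
    (fun n w => (n%:R^-1 * \sum_(1 <= k < n.+1)
       (X k w - Z k.-1 w + k%:R * (Z k.-1 w - Z k w)) ^+ 2)%:E)
    U.

(* The supremum and the series below are extended-real valued; only n >= 1
   matters, so that k.-1 is a genuine predecessor. *)
Definition cond_c :=
  ((Num.sqrt n%:R)%:E *
   \int[P]_w ereal_sup
     [set (`|Z k.-1 w - Z k w|%R)%:E | k in [set k | (n <= k)%N]])%E
  @[n --> \oo] --> 0%E.

Definition cond_d :=
  cvg_in_prob P
    (fun n w => n%:R%:E * \sum_(n <= k <oo) ((Z k.-1 w - Z k w) ^+ 2)%:E)%E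
    V.

End conditions.
Arguments cond_a {d T R} P Z.
Arguments cond_b {d T R} P X Z U.
Arguments cond_c {d T R} P Z.
Arguments cond_d {d T R} P Z V.

(* Main.v *)
Require Import Defs.
From HB Require Import structures.
From mathcomp Require Import all_boot all_order all_algebra.
From mathcomp Require Import all_classical all_reals all_analysis.
From mathcomp Require Import measurable_realfun ring lra.
Set Implicit Arguments.
Unset Strict Implicit.
Unset Printing Implicit Defensive.
Import Order.TTheory GRing.Theory Num.Theory.
Import numFieldNormedType.Exports.
Local Open Scope classical_set_scope.
Local Open Scope ring_scope.

(** Both statistics are row sums of triangular arrays that are almost
    martingale differences. With $X_k$ and $Z_k$ as in the theorem,
    $$C_n = n^{-1/2} \sum_{k=1}^n \{X_k - Z_{k-1} + k(Z_{k-1} - Z_k)\},$$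
    and $D_n$ is, up to a small error, the sum of $\sqrt n (Z_{k-1} - Z_k)$ over
    $n < k \le N_n$, where $N_n$ is so large that $Z_{N_n}$ may replace the limit
    of $(Z_n)$. The rate $o(n^{-3})$ makes the total conditional drift of a row
    negligible in mean, conditions (a) and (c) make the largest jump negligible
    in mean, and (b) and (d) say that the sum of squares of a row converges in
    probability to $U$ or $V$ ([mean_array_clt], [limit_array_clt]).

    For such an array $y$ with limiting variance $L$, let $M_k$ be
    $e^{Q_k/2} \cos(S_k + \phi)$, where $S_k$ and $Q_k$ are the partial sums of
    the $y_j$ and of the $y_j^2 \wedge 1$, both stopped when $Q$ exceeds a
    constant. Since $e^{x^2/2} \cos(t + x) = \cos t - x \sin t + O(|x|^3)$, its
    expectation is preserved up to the drift and the jumps, even when tested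
    against events of the past of the row. As $Q$ converges to $L$ at the end of
    the row, and as $L$ is approximated by the sums of squares of earlier rows,
    the conditional expectation of $\cos(S + \phi)$ given the beginning of the
    row is close to $e^{-L/2} \cos \phi$ ([clt_array_conditional]). This needs
    rows that start late, as those of $D_n$ do. For rows that start at $0$ and an
    arbitrary event $H$, finitely many terms, and even a slowly growing number
    of them, may be dropped, and $H$ may be replaced by its conditional
    probability given a late member of the filtration, because these
    conditional probabilities form a Cauchy sequence ([clt_array_stable]).

    Multiplying the array by $s$, or concatenating the row of $C_n$ multiplied
    by $s$ with the row of $D_n$ multiplied by $t$, gives all trigonometric
    limits. A continuity theorem of Lévy type, uniform in the conditioning
    events, turns them into limits for bounded continuous functions
    ([levy_continuity], [kernel_pair_cvg]). For the convergence in strong sense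
    of $D_n$ the events may vary with $n$: testing against the event that a
    version of $E(f(D_n) \mid \mathcal{G}_n)$ exceeds an approximation of the
    limit gives convergence in $L^1$ ([cond_exp_cvg_in_prob]). *)

(** * Real sequences, expectations and convergence in probability *)
Section real_sequences.
Variable R : realType.
Implicit Types u v : nat -> R.

(** The dominating sequence may depend on $e$: approximations are fixed first,
    and the limit is taken afterwards. *)
Lemma cvg0_eps u :
  (forall e : R, 0 < e -> exists2 v : nat -> R, v @ \oo --> 0 & \forall n \near \oo, `|u n| <= v n + e) ->
  u @ \oo --> 0.
Proof.
move=> H; apply/cvgrPdist_lt => e e0.
have e20 : 0 < e / 2 by rewrite divr_gt0.
have [v v0 uv] := H _ e20.
move/cvgrPdist_lt : v0 => /(_ _ e20) v0.
near=> n; rewrite sub0r normrN.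
have h1 : `|u n| <= v n + e / 2 by near: n.
have : `|0 - v n| < e / 2 by near: n.
rewrite sub0r normrN => /(le_lt_trans (ler_norm _)) h2.
lra.
Unshelve. all: by end_near. Qed.

Lemma squeeze0 u v : (\forall n \near \oo, `|u n| <= v n) -> v @ \oo --> 0 ->
  u @ \oo --> 0.
Proof.
move=> uv v0; apply: cvg0_eps => e e0; exists v => //.
by apply: filterS uv => n /le_trans; apply; rewrite lerDl ltW.
Qed.

Lemma cvg0D u v : u @ \oo --> 0 -> v @ \oo --> 0 -> (fun n => u n + v n) @ \oo --> 0.
Proof. by move=> u0 v0; rewrite -(addr0 0); exact: cvgD. Qed.

Lemma cvg0Zl (c : R) u : u @ \oo --> 0 -> (fun n => c * u n) @ \oo --> 0.
Proof. by move=> u0; rewrite -(mulr0 c); apply: cvgM => //; exact: cvg_cst. Qed.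

End real_sequences.

Section expectations.
Context d (T : measurableType d) (R : realType) (P : probability T R).
Implicit Types f g : T -> R.

Lemma bounded_integrable f (c : R) : measurable_fun setT f ->
  (forall w, `|f w| <= c) -> P.-integrable setT (EFin \o f).
Proof.
move=> mf fc; apply: (@le_integrable _ _ _ _ _ measurableT _ (cst c%:E)).
- exact/measurable_EFinP.
- move=> w _ /=; rewrite lee_fin (le_trans (fc w))// ler_norm //.
- exact: finite_measure_integrable_cst.
Qed.

Lemma dominated_integrable f g : measurable_fun setT f ->
  (forall w, `|f w| <= g w) -> P.-integrable setT (EFin \o g) ->
  P.-integrable setT (EFin \o f).
Proof.
move=> mf fg ig; apply: (le_integrable measurableT _ _ ig).
- exact/measurable_EFinP.
- move=> w _ /=; rewrite lee_fin (le_trans (fg w))// ler_norm //.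
Qed.

Lemma measurable_of_integrable f : P.-integrable setT (EFin \o f) ->
  measurable_fun setT f.
Proof. by move=> /(measurable_int P)/measurable_EFinP. Qed.

Lemma integrable_boundedM f g (c : R) : measurable_fun setT f ->
  (forall w, `|f w| <= c) -> P.-integrable setT (EFin \o g) ->
  P.-integrable setT (EFin \o (fun w => f w * g w)).
Proof.
move=> mf fc ig.
apply: (@dominated_integrable _ (fun w => c * `|g w|)).
- by apply: measurable_funM => //; exact: measurable_of_integrable.
- by move=> w; rewrite normrM ler_wpM2r.
- have := integrableZl measurableT c (integrable_abse ig).
  by apply: eq_integrable => // w _; rewrite /= EFinM.
Qed.

Lemma integrable_realD f g : P.-integrable setT (EFin \o f) ->
  P.-integrable setT (EFin \o g) -> P.-integrable setT (EFin \o (fun w => f w + g w)).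
Proof.
move=> i1 i2; have := integrableD measurableT i1 i2.
by apply: eq_integrable => // w _.
Qed.

Lemma integrable_realB f g : P.-integrable setT (EFin \o f) ->
  P.-integrable setT (EFin \o g) -> P.-integrable setT (EFin \o (fun w => f w - g w)).
Proof.
move=> i1 i2; have := integrableB measurableT i1 i2.
by apply: eq_integrable => // w _.
Qed.

Lemma integrable_realZ (c : R) f : P.-integrable setT (EFin \o f) ->
  P.-integrable setT (EFin \o (fun w => c * f w)).
Proof.
move=> i1; have := integrableZl measurableT c i1.
by apply: eq_integrable => // w _.
Qed.

Lemma integrable_real_norm f : P.-integrable setT (EFin \o f) ->
  P.-integrable setT (EFin \o (fun w => `|f w|)).
Proof.
by move=> i1; have := integrable_abse i1; apply: eq_integrable.
Qed.

Lemma integrable_real_cst (c : R) : P.-integrable setT (EFin \o (fun=> c)).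
Proof. exact: finite_measure_integrable_cst. Qed.

Lemma integrable_real_sum (I : Type) (r : seq I) (p : pred I) (F : I -> T -> R) :
  (forall i, p i -> P.-integrable setT (EFin \o F i)) ->
  P.-integrable setT (EFin \o (fun w => \sum_(i <- r | p i) F i w)).
Proof.
move=> iF; elim: r => [|i r ih].
  rewrite (_ : (fun _ => _) = fun=> 0); first exact: integrable_real_cst.
  by apply/funext => w; rewrite big_nil.
have -> : (fun w => \sum_(j <- i :: r | p j) F j w) =
    (fun w => (if p i then F i w else 0) + \sum_(j <- r | p j) F j w).
  apply/funext => w; rewrite big_cons.
  by have [?|?] := boolP (p i); rewrite ?add0r.
apply: integrable_realD => //; have [/iF//|_] := boolP (p i).
exact: integrable_real_cst.
Qed.

Lemma Rintegral_sum (I : Type) (r : seq I) (p : pred I) (F : I -> T -> R) :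
  (forall i, p i -> P.-integrable setT (EFin \o F i)) ->
  (\int[P]_w \sum_(i <- r | p i) F i w) = \sum_(i <- r | p i) \int[P]_w F i w.
Proof.
move=> iF; elim: r => [|i r ih].
  rewrite big_nil -[RHS](mul0r (fine (P setT))) -(Rintegral_cst _ measurableT).
  by apply: eq_Rintegral => w _; rewrite big_nil.
rewrite big_cons -ih; case: ifPn => pi; last first.
  by apply: eq_Rintegral => w _; rewrite big_cons (negbTE pi).
rewrite -RintegralD//; [|exact: iF|exact: integrable_real_sum].
by apply: eq_Rintegral => w _; rewrite big_cons pi.
Qed.

Lemma le_Rint f g : P.-integrable setT (EFin \o f) ->
  P.-integrable setT (EFin \o g) -> (forall w, f w <= g w) ->
  \int[P]_w f w <= \int[P]_w g w.
Proof. by move=> *; apply: le_Rintegral. Qed.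

Lemma Rint_cst (c : R) : \int[P]_w c = c.
Proof.
rewrite Rintegral_cst// -[RHS]mulr1; congr (c * _).
by have -> : fine (P setT) = fine 1%E by congr fine; exact: probability_setT.
Qed.

Lemma Rint_norm_le f g : P.-integrable setT (EFin \o f) ->
  P.-integrable setT (EFin \o g) -> (forall w, `|f w| <= g w) ->
  `|\int[P]_w f w| <= \int[P]_w g w.
Proof.
move=> i1 i2 fg; apply: (le_trans (le_normr_Rintegral _ i1)) => //.
by apply: le_Rint => //; exact: integrable_real_norm.
Qed.

Lemma Rint_norm_cst f (c : R) : measurable_fun setT f -> (forall w, `|f w| <= c) ->
  `|\int[P]_w f w| <= c.
Proof.
move=> mf fc; rewrite -[leRHS]Rint_cst; apply: Rint_norm_le => //.
  exact: bounded_integrable fc.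
exact: integrable_real_cst.
Qed.

Lemma norm_indic_le1 (A : set T) w : `|\1_A w| <= 1 :> R.
Proof. by rewrite indicE; case: (_ \in _); rewrite /= ?normr1 ?normr0. Qed.

Lemma integrable_real_indic (A : set T) : measurable A ->
  P.-integrable setT (EFin \o (\1_A : T -> R)).
Proof.
move=> mA; apply: (@bounded_integrable _ 1); first exact: measurable_indic.
by move=> w; exact: norm_indic_le1.
Qed.

Lemma Rint_indic (A : set T) : measurable A -> \int[P]_w \1_A w = fine (P A).
Proof. by move=> mA; rewrite /Rintegral integral_indic// setIT. Qed.

Lemma Rint_mul_indic (A : set T) f : measurable A ->
  \int[P]_(w in A) f w = \int[P]_w (\1_A w * f w).
Proof.
move=> mA; rewrite Rintegral_mkcond; apply: eq_Rintegral => w _.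
by rewrite patchE indicE; case: ifPn; rewrite ?mul1r ?mul0r.
Qed.

Lemma Rint_EFin f : P.-integrable setT (EFin \o f) ->
  (\int[P]_w f w)%:E = (\int[P]_w (f w)%:E)%E.
Proof. by move=> i; rewrite fineK//; exact: integrable_fin_num. Qed.

Lemma Rint_dominated_cvg (f_ : nat -> T -> R) f g :
  (forall n, measurable_fun setT (f_ n)) -> measurable_fun setT f ->
  (forall w, f_ ^~ w @ \oo --> f w) ->
  P.-integrable setT (EFin \o g) -> (forall n w, `|f_ n w| <= g w) ->
  (\int[P]_w f_ n w) @[n --> \oo] --> \int[P]_w f w.
Proof.
move=> mf_ mf ff ig fg.
have H : P.-integrable setT (EFin \o f).
  apply: (@dominated_integrable _ g) => // w.
  apply: (ler_cvg_to (cvg_norm (ff w)) (cvg_cst (g w))).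
  by apply: nearW => n; exact: fg.
apply: fine_cvg; rewrite fineK; last exact: integrable_fin_num.
apply: (@dominated_cvg _ _ _ P setT measurableT (fun n w => (f_ n w)%:E)
   (EFin \o f) (EFin \o g)) => //=.
- by move=> n; exact/measurable_EFinP.
- by move=> w _; apply: cvg_EFin; [exact: nearW | exact: ff].
- by move=> n w _; rewrite lee_fin.
Qed.

End expectations.

Section truncated_distance.
Context d (T : measurableType d) (R : realType) (P : probability T R).
Implicit Types f g h : T -> R.

(** The Ky Fan type distance metrizing convergence in probability. *)
Definition pdist f g : R := \int[P]_w Num.min `|f w - g w| 1.

Lemma min1_normD (a b : R) : Num.min `|a + b| 1 <= Num.min `|a| 1 + Num.min `|b| 1.
Proof.
have := ler_normD a b; have := normr_ge0 a; have := normr_ge0 b.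
by rewrite /Num.min; do 3 case: ifPn; rewrite -?leNgt; lra.
Qed.

Lemma norm_min1 (a : R) : `|Num.min `|a| 1| <= 1.
Proof.
by rewrite ger0_norm ?ge_min ?lexx ?orbT// le_min normr_ge0 ler01.
Qed.

Lemma measurable_min1 f : measurable_fun setT f ->
  measurable_fun setT (fun w => Num.min `|f w| 1).
Proof.
by move=> mf; apply: measurable_minr => //; exact: measurableT_comp.
Qed.

Lemma integrable_min1 f : measurable_fun setT f ->
  P.-integrable setT (EFin \o (fun w => Num.min `|f w| 1)).
Proof.
move=> mf; apply: (@bounded_integrable _ _ _ _ _ 1); first exact: measurable_min1.
by move=> w; exact: norm_min1.
Qed.

Lemma pdist_ge0 f g : 0 <= pdist f g.
Proof. by apply: Rintegral_ge0 => w _; rewrite le_min normr_ge0 ler01. Qed.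

Lemma pdist_triangle f g h : measurable_fun setT f -> measurable_fun setT g ->
  measurable_fun setT h -> pdist f h <= pdist f g + pdist g h.
Proof.
move=> mf mg mh; rewrite /pdist -RintegralD//; last 2 first.
- by apply: integrable_min1; exact: measurable_funB.
- by apply: integrable_min1; exact: measurable_funB.
apply: le_Rint => //.
- by apply: integrable_min1; exact: measurable_funB.
- by apply: integrable_realD; apply: integrable_min1; exact: measurable_funB.
- move=> w; rewrite (_ : f w - h w = (f w - g w) + (g w - h w)); last lra.
  exact: min1_normD.
Qed.

Lemma pdist_le f g h : measurable_fun setT f -> measurable_fun setT g ->
  P.-integrable setT (EFin \o h) -> (forall w, `|f w - g w| <= h w) ->
  pdist f g <= \int[P]_w h w.
Proof.
move=> mf mg ih fgh; apply: le_Rint => //.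
  by apply: integrable_min1; exact: measurable_funB.
by move=> w; rewrite ge_min fgh.
Qed.

(** An infinite value is at distance $1$ from every real number. *)
Definition tdist (y : \bar R) (a : R) : R := fine (Order.min `|y - a%:E| 1%:E)%E.

Lemma tdist_ge0 y a : 0 <= tdist y a.
Proof. by rewrite fine_ge0// le_min abse_ge0 lee_fin ler01. Qed.

Lemma tdist_le1 y a : tdist y a <= 1.
Proof.
have h : (Order.min `|y - a%:E| 1%:E <= 1%:E)%E by rewrite ge_min lexx orbT.
rewrite -lee_fin /tdist fineK// ge0_fin_numE; first exact: le_lt_trans h (ltry _).
by rewrite le_min abse_ge0 lee_fin ler01.
Qed.

Lemma tdist_EFin (y a : R) : tdist y%:E a = Num.min `|y - a| 1.
Proof. by rewrite /tdist /= -EFin_min. Qed.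

Lemma tdist_le (y : \bar R) (a e : R) : (`|y - a%:E| <= e%:E)%E -> tdist y a <= e.
Proof.
case: y => [y||] //=; rewrite ?lee_fin// => h.
by rewrite tdist_EFin ge_min h.
Qed.

Lemma measurable_tdist (Y : T -> \bar R) f : measurable_fun setT Y ->
  measurable_fun setT f -> measurable_fun setT (fun w => tdist (Y w) (f w)).
Proof.
move=> mY mf; apply: measurableT_comp => //; apply: measurable_mine => //.
apply: measurableT_comp => //; apply: emeasurable_funB => //.
exact/measurable_EFinP.
Qed.

Lemma cvg_in_prob_tdist (Y : nat -> T -> \bar R) f :
  (forall n, measurable_fun setT (Y n)) -> measurable_fun setT f ->
  cvg_in_prob P Y f -> \int[P]_w tdist (Y n w) (f w) @[n --> \oo] --> 0.
Proof.
move=> mY mf H; apply: cvg0_eps => e e0.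
exists (fun n => fine (P [set w | (e%:E < `|Y n w - (f w)%:E|)%E])).
  apply: fine_cvg; exact: H.
apply: nearW => n; rewrite ger0_norm; last first.
  by apply: Rintegral_ge0 => w _; exact: tdist_ge0.
have mA : measurable [set w | (e%:E < `|Y n w - (f w)%:E|)%E].
  rewrite -[X in measurable X]setTI.
  apply: emeasurable_fun_o_infty => //.
  apply: measurableT_comp => //; apply: emeasurable_funB => //.
  exact/measurable_EFinP.
have ia := integrable_real_indic P mA.
have ie := integrable_real_cst P e.
set A := [set w | _] in mA ia *.
apply: (@le_trans _ _ (\int[P]_w (\1_A w + e))); last first.
  by rewrite RintegralD// Rint_cst Rint_indic.
apply: le_Rint.
- apply: (@bounded_integrable _ _ _ _ _ 1); first exact: measurable_tdist.
  by move=> w; rewrite ger0_norm ?tdist_ge0 ?tdist_le1.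
- exact: integrable_realD.
move=> w; rewrite indicE; have [_|] := boolP (w \in A).
  by rewrite (le_trans (tdist_le1 _ _))// lerDl ltW.
by rewrite notin_setE/= => /negP; rewrite -leNgt add0r => h; exact: tdist_le.
Qed.

Lemma cvg_in_prob_pdist (Y : nat -> T -> R) f :
  (forall n, measurable_fun setT (Y n)) -> measurable_fun setT f ->
  cvg_in_prob P (fun n w => (Y n w)%:E) f -> pdist (Y n) f @[n --> \oo] --> 0.
Proof.
move=> mY mf H.
have := cvg_in_prob_tdist (fun n => proj2 (measurable_EFinP setT (Y n)) (mY n)) mf H.
apply: cvg_trans; apply: near_eq_cvg; apply: nearW => n.
by apply: eq_Rintegral => w _; rewrite tdist_EFin.
Qed.

Lemma pdist_cvg_in_prob (Y : nat -> T -> R) f :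
  (forall n, measurable_fun setT (Y n)) -> measurable_fun setT f ->
  pdist (Y n) f @[n --> \oo] --> 0 ->
  cvg_in_prob P (fun n w => (Y n w)%:E) f.
Proof.
move=> mY mf H e e0.
set A := fun n => [set w | (e%:E < `|(Y n w)%:E - (f w)%:E|)%E].
have mA n : measurable (A n).
  rewrite -[X in measurable X]setTI.
  apply: emeasurable_fun_o_infty => //.
  apply: measurableT_comp => //; apply: emeasurable_funB => //;
  exact/measurable_EFinP.
rewrite (_ : (fun n => P _) = fun n => (fine (P (A n)))%:E); last first.
  by apply/funext => n; rewrite fineK// fin_num_measure.
apply: cvg_EFin; first exact: nearW.
have m0 : 0 < Num.min e 1 by rewrite lt_min e0 ltr01.
apply: (@squeeze0 _ _ (fun n => (Num.min e 1)^-1 * pdist (Y n) f)); last exact: cvg0Zl.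
apply: nearW => n; rewrite /= ger0_norm ?fine_ge0// -Rint_indic//.
rewrite ler_pdivlMl// -RintegralZl//; last first.
  exact: integrable_real_indic.
apply: le_Rint.
- apply: integrable_realZ.
  exact: integrable_real_indic.
- by apply: integrable_min1; exact: measurable_funB.
move=> w; rewrite indicE; have [|_] := boolP (w \in _); last first.
  by rewrite mulr0 le_min normr_ge0 ler01.
rewrite inE/= mulr1 => h; have {}h : e < `|Y n w - f w| by [].
rewrite le_min; apply/andP; split.
  by rewrite ge_min (ltW h).
by rewrite ge_min lexx orbT.
Qed.

End truncated_distance.

(** * Conditional expectations *)

(** Halving the range of the function at each step replaces the approximation
    of a measurable function by simple functions. *)
Lemma bounded_functional_eq0 d (S : measurableType d) (R : realType)
    (Phi : (S -> R) -> R) (C : R) :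
  (forall (f : S -> R) A (a c : R), measurable_fun setT f -> (forall x, `|f x| <= c) -> measurable A ->
     Phi (fun x => f x + a * \1_A x) = Phi f + a * Phi (\1_A)) ->
  (forall (f : S -> R) (c : R), measurable_fun setT f -> (forall x, `|f x| <= c) -> `|Phi f| <= C * c) ->
  (forall A, measurable A -> Phi (\1_A) = 0) ->
  forall (f : S -> R) (c : R), measurable_fun setT f -> (forall x, `|f x| <= c) -> Phi f = 0.
Proof.
move=> Padd Pbd Pind.
have dyadic n (c : R) (f : S -> R) : 0 <= c -> measurable_fun setT f -> (forall x, 0 <= f x <= c) ->
    `|Phi f| <= C * c * 2^-1 ^+ n.
  elim: n c f => [|n IH] c f c0 mf fc.
    rewrite expr0 mulr1; apply: Pbd => // x.
    by have /andP[h1 h2] := fc x; rewrite ger0_norm.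
  set A := f @^-1` `[c / 2, +oo[%classic.
  have mA : measurable A by rewrite -[A]setTI; apply: mf => //; exact: measurable_itv.
  pose f' x := f x - c / 2 * \1_A x.
  have mf' : measurable_fun setT f'.
    by apply: measurable_funB => //; apply: measurable_funM => //; exact: measurable_indic.
  have f'c x : 0 <= f' x <= c / 2.
    rewrite /f' indicE; have /andP[h1 h2] := fc x.
    have [|] := boolP (x \in A).
      by rewrite inE /A/= in_itv/= andbT => h; apply/andP; split; rewrite /=; lra.
    rewrite notin_setE /A/= in_itv/= andbT => /negP; rewrite -ltNge => h.
    by apply/andP; split; rewrite /=; lra.
  have -> : f = fun x => f' x + c / 2 * \1_A x.
    by apply/funext => x; rewrite /f' subrK.
  rewrite (Padd _ _ _ (c / 2))//; last first.
    by move=> x; have /andP[h1 h2] := f'c x; rewrite ger0_norm.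
  rewrite Pind// mulr0 addr0 (le_trans (IH (c / 2) f' _ mf' f'c)) ?divr_ge0//.
  by rewrite exprS !mulrA.
move=> f c mf fc.
have c0 : 0 <= c by rewrite (le_trans _ (fc point)).
have <- : Phi (fun x => f x + c * \1_setT x) = Phi f.
  by rewrite (Padd _ _ _ c)// Pind// mulr0 addr0.
have mf1 : measurable_fun setT (fun x => f x + c * \1_setT x).
  by apply: measurable_funD => //; apply: measurable_funM => //; exact: measurable_indic.
have f1c x : 0 <= f x + c * \1_setT x <= c + c.
  by rewrite indicT mulr1; have := fc x; rewrite ler_norml => /andP[? ?]; apply/andP; split; lra.
apply/eqP; rewrite -normr_le0.
have h : (2^-1 : R) ^+ n @[n --> \oo] --> 0.
  by apply: cvg_expr; rewrite ger0_norm// invf_lt1// ltr1n.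
apply: (ler_cvg_to (cvg_cst _) (cvg0Zl (C * (c + c)) h)).
by apply: nearW => n; apply: dyadic => //; rewrite addr_ge0.
Qed.

Section measurability_for_a_sub_sigma_field.
Context d (T : measurableType d) (R : realType).
Implicit Types (G : set (set T)) (f : T -> R).

Definition gmeasurable G f :=
  measurable_fun [set: g_sigma_algebraType G] (f : g_sigma_algebraType G -> R).

Lemma measurable_gE G : sub_sigma_field G ->
  @measurable _ (g_sigma_algebraType G) = G.
Proof. by move=> [sG _]; exact: measurable_g_measurableTypeE. Qed.

Lemma gmeasurable_measurable G f : sub_sigma_field G -> gmeasurable G f ->
  measurable_fun setT f.
Proof.
move=> hG mf _ B mB; apply: hG.2; rewrite -(measurable_gE hG).
exact: mf.
Qed.

Lemma gmeasurable_mono G G' f : sub_sigma_field G -> sub_sigma_field G' ->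
  G `<=` G' -> gmeasurable G f -> gmeasurable G' f.
Proof.
move=> hG hG' GG' mf _ B mB; rewrite (measurable_gE hG'); apply: GG'.
by rewrite -(measurable_gE hG); exact: mf.
Qed.

Lemma gmeasurableP G f : sub_sigma_field G ->
  g_sigma_algebra_preimage f `<=` G -> gmeasurable G f.
Proof.
move=> hG fG _ B mB; rewrite (measurable_gE hG); apply: fG.
by exists B.
Qed.

Lemma gmeasurable_set G f (B : set R) : sub_sigma_field G -> gmeasurable G f ->
  measurable B -> G (f @^-1` B).
Proof.
move=> hG mf mB; rewrite -(measurable_gE hG) -[X in measurable X]setTI.
exact: mf.
Qed.

Lemma gmeasurable_indic G (A : set T) : sub_sigma_field G -> G A ->
  gmeasurable G (\1_A : T -> R).
Proof.
move=> hG GA; apply: (@measurable_indic _ (g_sigma_algebraType G)).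
by rewrite measurable_gE.
Qed.

End measurability_for_a_sub_sigma_field.

Section conditional_expectation.
Context d (T : measurableType d) (R : realType) (P : probability T R).
Implicit Types (G : set (set T)) (X W : T -> R).

Lemma cond_exp_gmeasurable G X W : sub_sigma_field G ->
  is_cond_exp P G X W -> gmeasurable G W.
Proof. by move=> hG [WG _ _]; exact: gmeasurableP. Qed.

Lemma cond_exp_integrable G X W : is_cond_exp P G X W ->
  P.-integrable setT (EFin \o W).
Proof. by case. Qed.

Lemma cond_exp_indic G X W A : sub_sigma_field G ->
  P.-integrable setT (EFin \o X) -> is_cond_exp P G X W -> G A ->
  \int[P]_w (\1_A w * (X w - W w)) = 0.
Proof.
move=> hG iX [_ iW XW] GA; have mA : measurable A by exact: hG.2.
rewrite -Rint_mul_indic// RintegralB//; last 2 first.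
- exact: integrableS iX.
- exact: integrableS iW.
by rewrite /Rintegral -XW// subrr.
Qed.

Lemma orthogonal_indic_bounded G (D : T -> R) (c : R) z : sub_sigma_field G ->
  P.-integrable setT (EFin \o D) ->
  (forall A, G A -> \int[P]_w (\1_A w * D w) = 0) ->
  gmeasurable G z -> (forall w, `|z w| <= c) ->
  \int[P]_w (z w * D w) = 0.
Proof.
move=> hG iD D0 mz zc.
have izD z' c' : gmeasurable G z' -> (forall w, `|z' w| <= c') ->
    P.-integrable setT (EFin \o (fun w => z' w * D w)).
  by move=> mz' zc'; apply: integrable_boundedM zc' iD; exact: gmeasurable_measurable mz'.
apply: (@bounded_functional_eq0 _ (g_sigma_algebraType G) R
  (fun z => \int[P]_w (z w * D w)) (\int[P]_w `|D w|) _ _ _ z c mz zc).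
- move=> f A a cf mf fc mA.
  have GA : G A by rewrite -(measurable_gE hG).
  have i1 := izD _ _ mf fc.
  have i2 := izD _ _ (gmeasurable_indic hG GA) (norm_indic_le1 R A).
  rewrite -RintegralZl// -RintegralD//; last exact: integrable_realZ.
  by apply: eq_Rintegral => w _; ring.
- move=> f cf mf fc; rewrite mulrC -RintegralZl//; last exact: integrable_real_norm.
  apply: Rint_norm_le; first exact: (izD _ cf).
    by apply: integrable_realZ; exact: integrable_real_norm.
  by move=> w; rewrite normrM ler_wpM2r.
- by move=> A mA; apply: D0; rewrite -(measurable_gE hG).
Qed.

Lemma cond_exp_bounded G X W (c : R) z : sub_sigma_field G ->
  P.-integrable setT (EFin \o X) -> is_cond_exp P G X W ->
  gmeasurable G z -> (forall w, `|z w| <= c) ->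
  \int[P]_w (z w * W w) = \int[P]_w (z w * X w).
Proof.
move=> hG iX XW mz zc.
have iW := cond_exp_integrable XW.
have mzT := gmeasurable_measurable hG mz.
have := orthogonal_indic_bounded hG (integrable_realB iX iW)
  (fun A GA => cond_exp_indic hG iX XW GA) mz zc.
rewrite (_ : \int[P]_w _ = \int[P]_w (z w * X w - z w * W w)); last first.
  by apply: eq_Rintegral => w _; rewrite mulrBr.
rewrite RintegralB//; last 2 first.
- exact: (@integrable_boundedM _ _ _ _ _ _ c).
- exact: (@integrable_boundedM _ _ _ _ _ _ c).
by move/eqP; rewrite subr_eq0 => /eqP ->.
Qed.

Definition excess (b : R) X w : R := Num.max (`|X w| - b) 0.

Lemma measurable_excess b X : measurable_fun setT X ->
  measurable_fun setT (excess b X).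
Proof.
move=> mX; apply: measurable_maxr => //; apply: measurable_funB => //.
exact: measurableT_comp.
Qed.

Lemma excess_ge0 b X w : 0 <= excess b X w.
Proof. by rewrite le_max lexx orbT. Qed.

Lemma excess_le b X w : 0 <= b -> excess b X w <= `|X w|.
Proof. by move=> b0; rewrite ge_max normr_ge0 andbT gerBl. Qed.

Lemma integrable_excess b X : 0 <= b -> P.-integrable setT (EFin \o X) ->
  P.-integrable setT (EFin \o excess b X).
Proof.
move=> b0 iX; apply: (@dominated_integrable _ _ _ _ _ (fun w => `|X w|)).
- by apply: measurable_excess; exact: measurable_of_integrable iX.
- by move=> w; rewrite ger0_norm ?excess_ge0// excess_le.
- exact: integrable_real_norm.
Qed.

(** Conditional Jensen inequality for the convex function $(|x| - b)^+$: on the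
    event $W > b$, and on the event $W < -b$, it is affine in $W$. *)
Lemma cond_exp_excess G X W (b : R) : sub_sigma_field G -> 0 <= b ->
  P.-integrable setT (EFin \o X) -> is_cond_exp P G X W ->
  \int[P]_w excess b W w <= \int[P]_w excess b X w.
Proof.
move=> hG b0 iX XW; have iW := cond_exp_integrable XW.
have mW := cond_exp_gmeasurable hG XW.
pose sg w : R := \1_(W @^-1` `]b, +oo[%classic) w - \1_(W @^-1` `]-oo, - b[%classic) w.
have msg : gmeasurable G sg.
  by apply: measurable_funB; apply: gmeasurable_indic => //;
    apply: gmeasurable_set => //; exact: measurable_itv.
have sgE w : [/\ b < W w & sg w = 1] \/ [/\ W w < - b & sg w = -1] \/
             [/\ `|W w| <= b & sg w = 0].
  rewrite /sg !indicE.
  have [|] := boolP (w \in W @^-1` `]b, +oo[%classic);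
  have [|] := boolP (w \in W @^-1` `]-oo, - b[%classic); rewrite ?notin_setE ?inE/= !in_itv/= ?andbT.
  - by move=> ? ?; exfalso; lra.
  - by move=> _ ?; left; rewrite subr0.
  - by move=> ? _; right; left; rewrite sub0r.
  - move=> /negP; rewrite -leNgt => ? /negP; rewrite -leNgt => ?.
    by right; right; rewrite subr0 ler_norml; split => //; apply/andP; split.
have sg1 w : `|sg w| <= 1.
  by case: (sgE w) => [|[|]] [_ ->]; rewrite ?normrN ?normr1 ?normr0.
have isg (Y : T -> R) : P.-integrable setT (EFin \o Y) ->
    P.-integrable setT (EFin \o (fun w => sg w * Y w)).
  move=> iY; apply: (@integrable_boundedM _ _ _ _ _ _ 1) => //.
  exact: gmeasurable_measurable msg.
have isgb : P.-integrable setT (EFin \o (fun w => b * `|sg w|)).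
  apply: integrable_realZ; apply: integrable_real_norm.
  apply: (@bounded_integrable _ _ _ _ _ 1) => //.
  exact: gmeasurable_measurable msg.
have -> : \int[P]_w excess b W w = \int[P]_w (sg w * X w - b * `|sg w|).
  rewrite RintegralB//; last exact: isg.
  rewrite -(cond_exp_bounded hG iX XW msg sg1) -RintegralB//; last exact: isg.
  apply: eq_Rintegral => w _; rewrite /excess /Num.max.
  case: (sgE w) => [|[|]] [h ->].
  - rewrite normr1 mul1r mulr1 gtr0_norm; last lra.
    by case: ifPn => //; rewrite subr_lt0; lra.
  - rewrite normrN normr1 mulr1 ltr0_norm; last lra.
    by case: ifPn => //; rewrite ?subr_lt0; lra.
  - rewrite normr0 mulr0 mul0r subr0.
    by case: ifPn => //; rewrite -leNgt subr_ge0 => h'; apply/eqP; rewrite subr_eq0 eq_le h h'.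
apply: le_Rint.
- by apply: integrable_realB => //; exact: isg.
- exact: integrable_excess.
move=> w; rewrite /excess le_max.
have := ler_norm (X w); have := ler_norm (- X w); rewrite normrN => h1 h2.
case: (sgE w) => [|[|]] [h ->]; rewrite ?normrN ?normr1 ?normr0.
- by apply/orP; left; lra.
- by apply/orP; left; lra.
- by apply/orP; right; lra.
Qed.

(** By the conditional Jensen inequality a version of a conditional probability
    is almost surely at most $1$ in absolute value, so that truncating it gives
    another version, bounded everywhere. *)
Lemma bounded_cond_prob_exists G (H : set T) : sub_sigma_field G -> measurable H ->
  exists h : T -> R, [/\ gmeasurable G h, forall w, `|h w| <= 1 &
    forall (c : R) z, gmeasurable G z -> (forall w, `|z w| <= c) ->
      \int[P]_w (z w * h w) = \int[P]_w (z w * \1_H w)].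
Proof.
move=> hG mH.
have iH := integrable_real_indic P mH.
have [h0 XW] := is_cond_exp_exists hG iH.
have mh0 := cond_exp_gmeasurable hG XW.
have ih0 := cond_exp_integrable XW.
pose h w := Num.max (-1) (Num.min (h0 w) 1).
have mh : gmeasurable G h.
  by apply: measurable_maxr => //; exact: measurable_minr.
have h1 w : `|h w| <= 1.
  rewrite /h ler_norml !ge_max !le_max lexx/= ge_min lexx orbT andbT.
  by rewrite lerNl; lra.
have hh0 w : `|h w - h0 w| <= excess 1 h0 w.
  rewrite /h /excess; have := ler_norm (h0 w); have := ler_norm (- h0 w).
  rewrite normrN /Num.max /Num.min => a1 a2.
  have [h0gt|h0le] := ltP (h0 w) 1; last first.
    rewrite ifT; last lra.
    rewrite ler0_norm; last lra.
    by case: ifPn; rewrite -?leNgt; lra.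
  have [h0gt'|h0le'] := ltP (-1) (h0 w).
    by rewrite subrr normr0; case: ifPn; rewrite -?leNgt; lra.
  rewrite ger0_norm; last lra.
  by case: ifPn; rewrite -?leNgt; lra.
exists h; split => // c z mz zc.
have c0 : 0 <= c by rewrite (le_trans _ (zc point)).
rewrite -(cond_exp_bounded hG iH XW mz zc).
have mzT := gmeasurable_measurable hG mz.
have mhT := gmeasurable_measurable hG mh.
have ih : P.-integrable setT (EFin \o h) by exact: (@bounded_integrable _ _ _ _ _ 1).
apply/eqP; rewrite -subr_eq0 -RintegralB//; last 2 first.
- exact: (@integrable_boundedM _ _ _ _ _ _ c).
- exact: (@integrable_boundedM _ _ _ _ _ _ c).
rewrite -normr_le0.
apply: (@le_trans _ _ (\int[P]_w (c * excess 1 h0 w))).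
  apply: Rint_norm_le.
  - by apply: integrable_realB; exact: (@integrable_boundedM _ _ _ _ _ _ c).
  - by apply: integrable_realZ; exact: integrable_excess.
  - by move=> w; rewrite -mulrBr normrM ler_pM.
rewrite RintegralZl//; last exact: integrable_excess.
rewrite mulr_ge0_le0// (le_trans (cond_exp_excess hG ler01 iH XW))//.
rewrite -[leRHS](Rint_cst P); apply: le_Rint.
- exact: integrable_excess.
- exact: integrable_real_cst.
by move=> w; rewrite ge_max lexx andbT subr_le0 norm_indic_le1.
Qed.

(** Pythagoras: along a filtration the squared norms of the conditional
    probabilities of a fixed event increase, so that they converge, and the
    squared norm of an increment is the increment of the squared norms. *)
Lemma cond_prob_cauchy (G : nat -> set (set T)) (H : set T) (h : nat -> T -> R) :
  (forall n, sub_sigma_field (G n)) ->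
  (forall m n, (m <= n)%N -> G m `<=` G n) ->
  measurable H ->
  (forall n, gmeasurable (G n) (h n)) -> (forall n w, `|h n w| <= 1) ->
  (forall n (c : R) z, gmeasurable (G n) z -> (forall w, `|z w| <= c) ->
      \int[P]_w (z w * h n w) = \int[P]_w (z w * \1_H w)) ->
  forall p N : nat -> nat, (forall n, (p n <= N n)%N) ->
    (forall k, \forall n \near \oo, (k <= p n)%N) ->
  \int[P]_w `|h (N n) w - h (p n) w| @[n --> \oo] --> 0.
Proof.
move=> hG Gmono mH mh h1 hE p N pN poo.
have mhT n := gmeasurable_measurable (hG n) (mh n).
pose q n := \int[P]_w (h n w ^+ 2).
have ihh m n : P.-integrable setT (EFin \o (fun w => h m w * h n w)).
  apply: (@bounded_integrable _ _ _ _ _ 1); first exact: measurable_funM.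
  by move=> w; rewrite normrM mulr_ile1.
have pyth m n : (m <= n)%N -> \int[P]_w ((h n w - h m w) ^+ 2) = q n - q m.
  move=> mn.
  have e1 : \int[P]_w (h m w * h n w) = q m.
    rewrite (hE n 1 (h m))//; last exact: gmeasurable_mono (Gmono _ _ mn) (mh m).
    rewrite -(hE m 1 (h m))//; apply: eq_Rintegral => w _; by rewrite expr2.
  have -> : \int[P]_w ((h n w - h m w) ^+ 2) =
      \int[P]_w ((h n w * h n w + h m w * h m w) - 2 * (h m w * h n w)).
    by apply: eq_Rintegral => w _; ring.
  rewrite RintegralB//; last 2 first.
  - exact: integrable_realD.
  - exact: integrable_realZ.
  rewrite RintegralD// RintegralZl// e1.
  have -> : \int[P]_w (h n w * h n w) = q n by apply: eq_Rintegral => w _; rewrite expr2.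
  have -> : \int[P]_w (h m w * h m w) = q m by apply: eq_Rintegral => w _; rewrite expr2.
  by ring.
have cq : cvgn q.
  apply: nondecreasing_is_cvgn.
    apply/nondecreasing_seqP => n; rewrite -subr_ge0 -pyth//.
    by apply: Rintegral_ge0 => w _; exact: sqr_ge0.
  exists 1 => _ [n _ <-]; rewrite -(Rint_cst P 1); apply: le_Rint.
  - by have := ihh n n; apply: eq_integrable => // w _; rewrite /= expr2.
  - exact: integrable_real_cst.
  - by move=> w; rewrite -real_normK ?num_real// expr_le1.
have qcauchy (e : R) : 0 < e -> exists k, forall m n, (k <= m)%N -> (m <= n)%N -> q n - q m <= e.
  move=> e0; have e20 : 0 < e / 2 by rewrite divr_gt0.
  have /cvgrPdist_lt/(_ _ e20)[k _ kq] := cq.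
  exists k => m n km mn; have := kq m km; have := kq n (leq_trans km mn).
  rewrite /= !ltr_norml => /andP[? ?] /andP[? ?]; lra.
apply: cvg0_eps => e e0.
have e20 : 0 < e / 2 by rewrite divr_gt0.
have [k kq] := qcauchy ((e / 2) ^+ 2) (exprn_gt0 2 e20).
exists (fun=> 0); first exact: cvg_cst.
apply: filterS (poo k) => n kp; rewrite add0r ger0_norm; last first.
  by apply: Rintegral_ge0.
have id : P.-integrable setT (EFin \o (fun w => (h (N n) w - h (p n) w) ^+ 2)).
  apply: (@bounded_integrable _ _ _ _ _ 4).
    by apply: measurable_funX; exact: measurable_funB.
  move=> w; rewrite normrX (_ : 4 = (1 + 1) ^+ 2)//; last by ring.
  rewrite lerXn2r ?nnegrE ?addr_ge0// (le_trans (ler_normB _ _))//.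
  exact: lerD.
apply: (@le_trans _ _ (\int[P]_w (e / 2 + (e / 2)^-1 * (h (N n) w - h (p n) w) ^+ 2))).
  apply: le_Rint.
  - apply: integrable_real_norm; apply: integrable_realB;
    exact: (@bounded_integrable _ _ _ _ _ 1).
  - apply: integrable_realD; first exact: integrable_real_cst.
    exact: integrable_realZ.
  - move=> w; rewrite -(ler_pM2l e20) mulrDr mulVKf ?gt_eqF//.
    set x := _ - _; rewrite -[x ^+ 2]real_normK ?num_real//.
    have := normr_ge0 x; set a := `|x| => a0.
    by have := sqr_ge0 (a - e / 2); nra.
rewrite RintegralD//; last 2 first.
- exact: integrable_real_cst.
- exact: integrable_realZ.
rewrite Rint_cst RintegralZl// pyth//.
rewrite [leRHS](_ : e = e / 2 + e / 2); last lra.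
rewrite lerD2l ler_pdivrMl//; have := kq _ _ kp (pN n); lra.
Qed.

End conditional_expectation.

(** * The stopped exponential of a path *)
Section trigonometric_estimate.
Variable R : realType.
Implicit Types x t : R.

Lemma sin_mean_value x : 0 <= x -> exists2 c, 0 <= c <= x & sin x = cos c * x.
Proof.
move=> x0; have [|c] := @MVT_segment R sin cos 0 x x0 (fun z _ => is_derive_sin z).
  by apply: continuous_subspaceT; exact: continuous_sin.
by rewrite in_itv/= sin0 !subr0 => cx e; exists c.
Qed.

Lemma norm_sin_le x : `|sin x| <= `|x|.
Proof.
wlog x0 : x / 0 <= x.
  move=> H; have [/H//|x0] := leP 0 x.
  by rewrite -normrN -sinN -[leRHS]normrN; apply: H; rewrite oppr_ge0 ltW.
have [c _ ->] := sin_mean_value x0.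
by rewrite normrM ler_piMl// cos_max.
Qed.

Lemma one_sub_cosE x : 1 - cos x = 2 * sin (x / 2) ^+ 2.
Proof.
rewrite [in cos x](_ : x = (x / 2) *+ 2); last by rewrite -mulr_natr divfK// pnatr_eq0.
by rewrite cos_mulr2n cos2sin2; ring.
Qed.

Lemma one_sub_cos_le x : 1 - cos x <= x ^+ 2 / 2.
Proof.
rewrite one_sub_cosE; have := norm_sin_le (x / 2).
rewrite -(ler_pXn2r (ltn0Sn 1)) ?nnegrE// !real_normK ?num_real// exprMn exprVn.
by rewrite (_ : (2 : R) ^+ 2 = 4); [lra|ring].
Qed.

Lemma norm_sub_sin_le x : `|x - sin x| <= `|x| ^+ 3 / 2.
Proof.
wlog x0 : x / 0 <= x.
  move=> H; have [/H//|x0] := leP 0 x.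
  have := H (- x); rewrite oppr_ge0 ltW// => /(_ isT).
  by rewrite sinN -opprD !normrN.
have [c /andP[c0 cx] e] := sin_mean_value x0.
rewrite e (_ : x - cos c * x = (1 - cos c) * x); last by ring.
rewrite normrM [`|x|]ger0_norm// ger0_norm ?subr_ge0 ?cos_le1// exprSr mulrAC.
rewrite ler_wpM2r//; apply: (le_trans (one_sub_cos_le c)).
by rewrite ler_wpM2r ?invr_ge0// lerXn2r ?nnegrE.
Qed.

Lemma cos_taylor2 x : `|cos x - (1 - x ^+ 2 / 2)| <= x ^+ 4 / 8.
Proof.
set h := x / 2; have xh : x = 2 * h by rewrite mulrC divfK// pnatr_eq0.
have -> : cos x - (1 - x ^+ 2 / 2) = 2 * ((h - sin h) * (h + sin h)).
  rewrite (_ : cos x = 1 - (1 - cos x)); last by ring.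
  by rewrite one_sub_cosE -/h xh; field.
have h1 := norm_sub_sin_le h; have h2 := norm_sin_le h.
have h3 : `|h + sin h| <= 2 * `|h| by rewrite (le_trans (ler_normD _ _))//; lra.
have h4 : `|(h - sin h) * (h + sin h)| <= (`|h| ^+ 3 / 2) * (2 * `|h|).
  by rewrite normrM ler_pM.
rewrite normrM ger0_norm//.
have -> : x ^+ 4 / 8 = 2 * ((`|h| ^+ 3 / 2) * (2 * `|h|)).
  rewrite [RHS](_ : _ = 2 * (`|h| ^+ 2) ^+ 2); last by field.
  by rewrite real_normK ?num_real// xh; field.
by rewrite ler_pM2l.
Qed.

Lemma expR_taylor1 t : 0 <= t <= 1 / 2 -> 0 <= expR t - 1 - t <= 2 * t ^+ 2.
Proof.
move=> /andP[t0 t1]; have a := expR_ge1Dx t; have b := expR_ge1Dx (- t).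
have : expR t * expR (- t) = 1 by rewrite -expRD subrr expR0.
have e0 := expR_gt0 t; move=> e1; apply/andP; split; first lra.
by nra.
Qed.

Definition psi x : R := Num.min (x ^+ 2) 1.

Lemma psi_ge0 x : 0 <= psi x.
Proof. by rewrite le_min sqr_ge0 ler01. Qed.

Lemma psi_le1 x : psi x <= 1.
Proof. by rewrite ge_min lexx orbT. Qed.

Lemma sqr_normE x : x ^+ 2 = `|x| ^+ 2.
Proof. by rewrite real_normK// num_real. Qed.

Lemma psi_small x : `|x| <= 1 -> psi x = x ^+ 2.
Proof.
move=> x1; apply/min_idPl; rewrite sqr_normE expr_le1//.
Qed.

Lemma psi_large x : 1 < `|x| -> psi x = 1.
Proof.
by move=> x1; apply/min_idPr; rewrite sqr_normE expr_ge1// ltW.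
Qed.

(** The factor $e^{x^2/2}$ cancels the second order term of the cosine; capping
    the exponent keeps the bound linear in $x$ for large jumps. *)
Lemma exp_cos_increment t x :
  `|expR (psi x / 2) * cos (t + x) - cos t + x * sin t| <= 4 * (psi x * `|x|).
Proof.
have [x1|x1] := leP `|x| 1; last first.
  rewrite psi_large// !mul1r.
  have eh : expR 2^-1 <= 2 :> R.
    have := @expR_taylor1 (1 / 2); rewrite mul1r; lra.
  have e0 := expR_gt0 (2^-1 : R).
  apply: (@le_trans _ _ (2 * 1 + 1 + `|x| * 1)); last lra.
  rewrite (le_trans (ler_normD _ _))// lerD//; last first.
    by rewrite normrM ler_pM// sin_max.
  rewrite (le_trans (ler_normB _ _))// lerD ?cos_max// normrM ler_pM ?cos_max//.
  by rewrite gtr0_norm.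
rewrite psi_small//; set a := x ^+ 2 / 2.
have a0 : 0 <= a by rewrite /a divr_ge0 ?sqr_ge0.
have xa : `|x| ^+ 2 = 2 * a by rewrite /a -sqr_normE; field.
have x0 := normr_ge0 x.
have a1 : a <= 1 / 2 by have : `|x| ^+ 2 <= 1 by [rewrite expr_le1]; lra.
have a01 : 0 <= a <= 1 / 2 by rewrite a0.
have /andP[s0 s1] := expR_taylor1 a01.
have r1 : `|cos x - (1 - a)| <= a ^+ 2 / 2.
  by have := cos_taylor2 x; rewrite /a; congr (_ <= _); field.
have q1 : `|sin x - x| <= a * `|x|.
  rewrite distrC (le_trans (norm_sub_sin_le x))// exprS xa.
  by rewrite (_ : `|x| * (2 * a) / 2 = a * `|x|)//; field.
have A : `|expR a * cos x - 1| <= 4 * a ^+ 2.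
  set s := expR a - 1 - a in s0 s1; set r := cos x - (1 - a) in r1.
  have -> : expR a * cos x - 1 = - a ^+ 2 + (s * cos x + r * (1 + a)).
    by rewrite /s /r; ring.
  have n1 : `|s * cos x| <= 2 * a ^+ 2.
    by rewrite normrM -[leRHS]mulr1 ler_pM// ?cos_max// ger0_norm.
  have n2 : `|r * (1 + a)| <= a ^+ 2 / 2 * 2.
    by rewrite normrM ler_pM// ger0_norm; lra.
  have a20 := sqr_ge0 a.
  have := ler_normD (- a ^+ 2) (s * cos x + r * (1 + a)).
  have := ler_normD (s * cos x) (r * (1 + a)).
  rewrite normrN (ger0_norm a20); lra.
have B : `|expR a * sin x - x| <= 3 * (a * `|x|).
  have -> : expR a * sin x - x = (expR a - 1) * sin x + (sin x - x) by ring.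
  have n1 : `|(expR a - 1) * sin x| <= 2 * (a * `|x|).
    rewrite normrM mulrA ler_pM ?norm_sin_le// ger0_norm; last lra.
    by have : 2 * a ^+ 2 <= a by [rewrite expr2; nra]; lra.
  have := ler_normD ((expR a - 1) * sin x) (sin x - x); lra.
have -> : expR a * cos (t + x) - cos t + x * sin t =
    (expR a * cos x - 1) * cos t - (expR a * sin x - x) * sin t.
  by rewrite cosD; ring.
have -> : 4 * (x ^+ 2 * `|x|) = 8 * (a * `|x|) by rewrite /a; field.
have n1 : `|(expR a * cos x - 1) * cos t| <= 4 * a ^+ 2.
  by rewrite normrM -[leRHS]mulr1 ler_pM ?cos_max.
have n2 : `|(expR a * sin x - x) * sin t| <= 3 * (a * `|x|).
  by rewrite normrM -[leRHS]mulr1 ler_pM ?sin_max.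
have n3 : a ^+ 2 <= a * `|x|.
  rewrite expr2 ler_wpM2l//.
  have : `|x| ^+ 2 <= `|x| by rewrite expr2 ler_piMl.
  by have := normr_ge0 x; lra.
have := ler_normB ((expR a * cos x - 1) * cos t) ((expR a * sin x - x) * sin t).
have : 0 <= a * `|x| by rewrite mulr_ge0.
lra.
Qed.

End trigonometric_estimate.

(** The exponential martingale along a path $y$, stopped once the accumulated
    quadratic variation exceeds $C$. *)
Section stopped_exponential.
Variables (R : realType) (C phi : R) (m : nat) (y : nat -> R).
Hypothesis C0 : 0 <= C.

Definition qvar k := \sum_(m <= j < k) psi (y j).
Definition alive k : R := (qvar k <= C)%R%:R.
Definition stopped_qvar k := \sum_(m <= j < k) alive j * psi (y j).
Definition stopped_sum k := \sum_(m <= j < k) alive j * y j.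
Definition stopped_exp k := expR (stopped_qvar k / 2) * cos (stopped_sum k + phi).

Lemma alive_ge0 k : 0 <= alive k.
Proof. by rewrite ler0n. Qed.

Lemma alive_le1 k : alive k <= 1.
Proof. by rewrite lern1 leq_b1. Qed.

Lemma stopped_qvarS k : (m <= k)%N ->
  stopped_qvar k.+1 = stopped_qvar k + alive k * psi (y k).
Proof. by move=> mk; rewrite /stopped_qvar big_nat_recr. Qed.

Lemma stopped_sumS k : (m <= k)%N ->
  stopped_sum k.+1 = stopped_sum k + alive k * y k.
Proof. by move=> mk; rewrite /stopped_sum big_nat_recr. Qed.

Lemma stopped_qvar_le_qvar k : stopped_qvar k <= qvar k.
Proof. by apply: ler_sum => j _; rewrite ler_piMl ?alive_le1 ?psi_ge0. Qed.

Lemma stopped_qvar_le k : stopped_qvar k <= C + 1.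
Proof.
have [mk|km] := leqP m k; last by rewrite /stopped_qvar big_geq ?addr_ge0// ltnW.
elim: k mk => [|k IH].
  by rewrite leqn0 => /eqP m0; rewrite /stopped_qvar big_geq// addr_ge0.
rewrite leq_eqVlt => /predU1P[<-|mk]; first by rewrite /stopped_qvar big_geq// addr_ge0.
rewrite stopped_qvarS// /alive; have [qC|_] := leP (qvar k) C.
  by rewrite mul1r lerD ?psi_le1// (le_trans (stopped_qvar_le_qvar k)).
by rewrite mul0r addr0 IH.
Qed.

Lemma qvar_mono j k : (m <= j)%N -> (j <= k)%N -> qvar j <= qvar k.
Proof.
move=> mj jk; rewrite /qvar (big_cat_nat mj jk)/= lerDl.
by apply: sumr_ge0 => i _; exact: psi_ge0.
Qed.

Lemma alive_all N : qvar N <= C ->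
  stopped_qvar N = qvar N /\ stopped_sum N = \sum_(m <= j < N) y j.
Proof.
move=> qN; have al j : (m <= j < N)%N -> alive j = 1.
  move=> /andP[mj jN]; rewrite /alive (le_trans (qvar_mono mj (ltnW jN)))//.
by split; rewrite /stopped_qvar /stopped_sum /qvar !big_nat; apply: eq_bigr => j /al ->;
  rewrite mul1r.
Qed.

Lemma stopped_exp_norm k : `|stopped_exp k| <= expR ((C + 1) / 2).
Proof.
rewrite normrM -[leRHS]mulr1 ler_pM ?cos_max// ger0_norm ?expR_ge0//.
by rewrite ler_expR ler_wpM2r ?invr_ge0// stopped_qvar_le.
Qed.

Lemma stopped_exp_step k : (m <= k)%N ->
  `|stopped_exp k.+1 - stopped_exp k +
    alive k * expR (stopped_qvar k / 2) * sin (stopped_sum k + phi) * y k|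
  <= expR ((C + 1) / 2) * (4 * (alive k * psi (y k) * `|y k|)).
Proof.
move=> mk; rewrite /stopped_exp stopped_qvarS// stopped_sumS// /alive.
have [qC|_] := leP (qvar k) C; last first.
  by rewrite !mul0r !addr0 subrr normr0 mulr0 mulr0.
rewrite !mul1r mulrDl expRD.
set E := expR (stopped_qvar k / 2).
rewrite (_ : _ + _ = E * (expR (psi (y k) / 2) * cos (stopped_sum k + phi + y k) -
     cos (stopped_sum k + phi) + y k * sin (stopped_sum k + phi))); last first.
  by rewrite (addrAC _ (y k)); ring.
rewrite normrM ler_pM ?exp_cos_increment// ger0_norm ?expR_ge0//.
by rewrite ler_expR ler_wpM2r ?invr_ge0// stopped_qvar_le.
Qed.

(** The errors of third order add up to at most $b$ times the stopped quadratic
    variation, which never exceeds $C + 1$. *)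
Lemma stopped_exp_expansion N b : (m <= N)%N ->
  (forall k, (m <= k < N)%N -> `|y k| <= b) -> 0 <= b ->
  `|stopped_exp N - cos phi +
    \sum_(m <= k < N) alive k * expR (stopped_qvar k / 2) * sin (stopped_sum k + phi) * y k|
  <= expR ((C + 1) / 2) * (4 * (C + 1) * b).
Proof.
move=> mN yb b0.
have -> : cos phi = stopped_exp m.
  by rewrite /stopped_exp /stopped_qvar /stopped_sum !big_geq// mul0r expR0 mul1r add0r.
rewrite -(telescope_sumr _ mN) -big_split/=.
apply: (le_trans (ler_norm_sum _ _ _)).
apply: (@le_trans _ _ (\sum_(m <= k < N) expR ((C + 1) / 2) * (4 * (alive k * psi (y k) * b)))).
  rewrite !big_nat; apply: ler_sum => k kN; have /andP[mk _] := kN.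
  apply: (le_trans (stopped_exp_step mk)).
  by rewrite ler_pM2l ?expR_gt0// ler_pM2l// ler_wpM2l ?yb// mulr_ge0 ?alive_ge0 ?psi_ge0.
rewrite -mulr_sumr ler_pM2l ?expR_gt0// -mulr_sumr -mulrA ler_pM2l// -mulr_suml.
by rewrite ler_wpM2r// stopped_qvar_le.
Qed.

(** As long as the quadratic variation is at most $C$ nothing has been stopped,
    and the exponential factor compensates $e^{-L/2}$ up to the distance of the
    quadratic variation and $L$. If they are close although the path has been
    stopped, then $L$ exceeds $C - 1$. *)
Lemma stopped_exp_target N (L : R) : 0 <= L ->
  `|expR (- L / 2) * stopped_exp N - cos (\sum_(m <= j < N) y j + phi)|
  <= (expR ((C + 1) / 2) + 2) * Num.min `|qvar N - L| 1 + 3 * (C - 1 < L)%R%:R.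
Proof.
move=> L0.
have e0 := expR_gt0 ((C + 1) / 2).
have triv (E c c' : R) : 0 <= E -> `|c| <= 1 -> `|c'| <= 1 -> `|E * c - c'| <= E + 1.
  move=> E0 c1 c2; rewrite (le_trans (ler_normB _ _))// lerD// normrM ger0_norm//.
  by rewrite ler_piMr.
have ME : expR (- L / 2) * stopped_exp N =
    expR ((stopped_qvar N - L) / 2) * cos (stopped_sum N + phi).
  by rewrite /stopped_exp mulrA -expRD; congr (expR _ * _); ring.
have ind0 : 0 <= 3 * (C - 1 < L)%R%:R :> R by rewrite mulr_ge0.
have [D1|D1] := leP 1 `|qvar N - L|.
  rewrite ?mulr1 ME.
  apply: (@le_trans _ _ (expR ((C + 1) / 2) + 1)); last lra.
  apply: le_trans (triv _ _ _ (expR_ge0 _) (cos_max _) (cos_max _)) _.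
  rewrite lerD2r ler_expR ler_wpM2r ?invr_ge0//.
  have := stopped_qvar_le N; lra.
have [qC|qC] := leP (qvar N) C.
  have [qE sE] := alive_all qC.
  rewrite ME qE sE -{2}[cos _]mul1r -mulrBl.
  set D := `|_| in D1 *; set c := cos _.
  have D0 : 0 <= D by exact: normr_ge0.
  apply: (@le_trans _ _ (D * 1)); last first.
    have : 0 <= (expR ((C + 1) / 2) + 1) * D by rewrite mulr_ge0// addr_ge0// ltW.
    by have := ind0; lra.
  rewrite normrM ler_pM// ?cos_max//.
  have hD : - D <= qvar N - L <= D by rewrite -ler_norml.
  have /andP[hD1 hD2] := hD.
  have lo := expR_ge1Dx ((qvar N - L) / 2).
  have hi := expR_ge1Dx (- ((qvar N - L) / 2)).
  have p0 := expR_gt0 ((qvar N - L) / 2).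
  have pe : expR ((qvar N - L) / 2) * expR (- ((qvar N - L) / 2)) = 1.
    by rewrite -expRD subrr expR0.
  rewrite ler_norml; apply/andP; split; first lra.
  move: p0 pe hi; set E := expR ((qvar N - L) / 2); set E' := expR (- ((qvar N - L) / 2)) => p0 pe hi.
  have h1 : E * (1 - D / 2) <= 1.
    by rewrite -[leRHS]pe ler_pM2l//; lra.
  have h2 : 1 <= (1 + D) * (1 - D / 2) by nra.
  have h3 : 0 < 1 - D / 2 by lra.
  have : E <= 1 + D by rewrite -(ler_pM2r h3); lra.
  lra.
have -> : (C - 1 < L)%R%:R = 1 :> R.
  rewrite (_ : (C - 1 < L) = true)//.
  by move: D1; rewrite ltr_norml => /andP[_ D1]; apply/idP; lra.
apply: (@le_trans _ _ 3); last first.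
  by rewrite mulr1 lerDr mulr_ge0// addr_ge0// ltW.
rewrite ME; apply: le_trans (triv _ _ _ (expR_ge0 _) (cos_max _) (cos_max _)) _.
have : expR ((stopped_qvar N - L) / 2) <= expR (1 / 2).
  rewrite ler_expR ler_wpM2r ?invr_ge0//.
  by have := stopped_qvar_le_qvar N; move: D1; rewrite ltr_norml => /andP[_ D1]; lra.
have := @expR_taylor1 R (1 / 2); lra.
Qed.

End stopped_exponential.

(** * A central limit theorem for arrays with small drift *)
Lemma measurable_sum_nat d (T : measurableType d) (R : realType) (a b : nat)
    (f : nat -> T -> R) :
  (forall k, (a <= k < b)%N -> measurable_fun setT (f k)) ->
  measurable_fun setT (fun w => \sum_(a <= k < b) f k w).
Proof.
move=> mf; rewrite (_ : (fun _ => _) = fun w =>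
    \sum_(a <= k < b) (if (a <= k < b)%N then f k else cst 0) w).
  by apply: measurable_sum => k; case: ifPn => [/mf//|_].
by apply/funext => w; rewrite big_nat [RHS]big_nat; apply: eq_bigr => k ->.
Qed.

Lemma measurable_cos (R : realType) : measurable_fun setT (@cos R).
Proof. by apply: continuous_measurable_fun; exact: continuous_cos. Qed.

Lemma measurable_sin (R : realType) : measurable_fun setT (@sin R).
Proof. by apply: continuous_measurable_fun; exact: continuous_sin. Qed.

Section quasi_martingale_arrays.
Context d (T : measurableType d) (R : realType) (P : probability T R).
Variable G : nat -> set (set T).
Hypothesis hG : forall n, sub_sigma_field (G n).
Hypothesis Gmono : forall m n, (m <= n)%N -> G m `<=` G n.

(** The rows $y_{n,k}$, $m_n \le k < N_n$, are almost martingale differences: the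
    drift is measured by tests against bounded variables of the past, which
    spares the conditional expectations, and only its sum over a row has to
    vanish. The sums of squares converge in probability to $L$. *)
Record clt_array (m N : nat -> nat) (y : nat -> nat -> T -> R) (L : T -> R) : Prop := {
  clt_le : forall n, (m n <= N n)%N;
  clt_meas : forall n k, (m n <= k < N n)%N -> gmeasurable (G k.+1) (y n k);
  clt_int : forall n k, (m n <= k < N n)%N -> P.-integrable setT (EFin \o y n k);
  clt_drift : exists2 u : nat -> nat -> R,
    (forall n k z, (m n <= k < N n)%N -> gmeasurable (G k) z ->
       (forall w, `|z w| <= 1) -> `|\int[P]_w (z w * y n k w)| <= u n k) &
    \sum_(m n <= k < N n) u n k @[n --> \oo] --> 0;
  clt_jump : exists B : nat -> T -> R, [/\ forall n, P.-integrable setT (EFin \o B n),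
    forall n w, 0 <= B n w,
    forall n k w, (m n <= k < N n)%N -> `|y n k w| <= B n w &
    \int[P]_w B n w @[n --> \oo] --> 0];
  clt_limit_meas : measurable_fun setT L;
  clt_limit_ge0 : forall w, 0 <= L w;
  clt_qvar : pdist P (fun w => \sum_(m n <= k < N n) y n k w ^+ 2) L @[n --> \oo] --> 0
}.

Section one_row.
Variables (m N : nat) (y : nat -> T -> R).
Hypothesis mN : (m <= N)%N.
Hypothesis my : forall k, (m <= k < N)%N -> gmeasurable (G k.+1) (y k).

Let Q k w := qvar m (y ^~ w) k.

Lemma gmeasurable_psi F (f : T -> R) : gmeasurable F f ->
  gmeasurable F (fun w => psi (f w)).
Proof. by move=> mf; apply: measurable_minr => //; exact: measurable_funX. Qed.

Lemma gmeasurable_past k j : (m <= j)%N -> (j < k)%N -> (k <= N)%N -> gmeasurable (G k) (y j).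
Proof.
move=> mj jk kN; apply: (gmeasurable_mono (hG j.+1)) => //; first exact: Gmono.
by apply: my; rewrite mj (leq_trans jk).
Qed.

Lemma gmeasurable_qvar k : (k <= N)%N -> gmeasurable (G k) (Q k).
Proof.
move=> kN; apply: measurable_sum_nat => j /andP[mj jk].
by apply: gmeasurable_psi; exact: gmeasurable_past.
Qed.

Lemma gmeasurable_alive C k : (k <= N)%N ->
  gmeasurable (G k) (fun w => alive C m (y ^~ w) k).
Proof.
move=> kN; rewrite (_ : (fun _ => _) = \1_(Q k @^-1` `]-oo, C]%classic)).
  apply: gmeasurable_indic => //; apply: gmeasurable_set => //.
  exact: gmeasurable_qvar.
apply/funext => w; rewrite indicE /alive; congr ((nat_of_bool _)%:R).
by apply/idP/idP; rewrite inE/= in_itv.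
Qed.

Lemma gmeasurable_stopped_qvar C k : (k <= N)%N ->
  gmeasurable (G k) (fun w => stopped_qvar C m (y ^~ w) k).
Proof.
move=> kN; apply: measurable_sum_nat => j /andP[mj jk].
apply: measurable_funM.
  apply: (gmeasurable_mono (hG j)) => //; first exact: Gmono (ltnW jk).
  by apply: gmeasurable_alive; exact: leq_trans (ltnW jk) kN.
by apply: gmeasurable_psi; exact: gmeasurable_past.
Qed.

Lemma gmeasurable_stopped_sum C k : (k <= N)%N ->
  gmeasurable (G k) (fun w => stopped_sum C m (y ^~ w) k).
Proof.
move=> kN; apply: measurable_sum_nat => j /andP[mj jk].
apply: measurable_funM; last exact: gmeasurable_past.
apply: (gmeasurable_mono (hG j)) => //; first exact: Gmono (ltnW jk).
by apply: gmeasurable_alive; exact: leq_trans (ltnW jk) kN.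
Qed.

Lemma gmeasurable_stopped_exp C phi k : (k <= N)%N ->
  gmeasurable (G k) (fun w => stopped_exp C phi m (y ^~ w) k).
Proof.
move=> kN; apply: measurable_funM.
  apply: measurableT_comp => //; apply: measurable_funM => //.
  exact: gmeasurable_stopped_qvar.
apply: (measurableT_comp (@measurable_cos R)); apply: measurable_funD => //.
exact: gmeasurable_stopped_sum.
Qed.

(** Each increment of the stopped exponential is a bounded predictable multiple
    of $y_k$, up to the third order error, so that the expectation is preserved
    up to the drift and the jumps. *)
Lemma stopped_exp_expectation (C phi : R) (eta B : T -> R) (u : nat -> R) : 0 <= C ->
  gmeasurable (G m) eta -> (forall w, `|eta w| <= 1) ->
  (forall k, (m <= k < N)%N -> P.-integrable setT (EFin \o y k)) ->
  (forall k z, (m <= k < N)%N -> gmeasurable (G k) z ->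
     (forall w, `|z w| <= 1) -> `|\int[P]_w (z w * y k w)| <= u k) ->
  P.-integrable setT (EFin \o B) -> (forall w, 0 <= B w) ->
  (forall k w, (m <= k < N)%N -> `|y k w| <= B w) ->
  `|\int[P]_w (eta w * stopped_exp C phi m (y ^~ w) N) - \int[P]_w (eta w * cos phi)|
    <= expR ((C + 1) / 2) * (\sum_(m <= k < N) u k + 4 * (C + 1) * \int[P]_w B w).
Proof.
move=> C0 meta eta1 iy yu iB B0 yB.
set E := expR ((C + 1) / 2); have E0 : 0 < E by exact: expR_gt0.
have metaT := gmeasurable_measurable (hG m) meta.
pose M w := stopped_exp C phi m (y ^~ w) N.
have mM : measurable_fun setT M.
  by apply: (gmeasurable_measurable (hG N)); exact: gmeasurable_stopped_exp.
pose z k w := - (eta w * (alive C m (y ^~ w) k *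
  (expR (stopped_qvar C m (y ^~ w) k / 2) / E) *
  sin (stopped_sum C m (y ^~ w) k + phi))).
have mz k : (m <= k < N)%N -> gmeasurable (G k) (z k).
  move=> /andP[mk kN]; apply: measurableT_comp => //; apply: measurable_funM.
    exact: (gmeasurable_mono (hG m)) (Gmono mk) meta.
  apply: measurable_funM.
    apply: measurable_funM; first exact: gmeasurable_alive (ltnW kN).
    apply: measurable_funM => //; apply: measurableT_comp => //.
    by apply: measurable_funM => //; exact: gmeasurable_stopped_qvar (ltnW kN).
  apply: (measurableT_comp (@measurable_sin R)); apply: measurable_funD => //.
  exact: gmeasurable_stopped_sum (ltnW kN).
have z1 k w : `|z k w| <= 1.
  rewrite normrN normrM mulr_ile1// normrM mulr_ile1 ?sin_max// normrM mulr_ile1//.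
    by rewrite ger0_norm ?alive_ge0 ?alive_le1.
  rewrite ger0_norm; last by rewrite divr_ge0 ?expR_ge0.
  rewrite ler_pdivrMr// mul1r.
  by rewrite ler_expR ler_wpM2r ?invr_ge0// stopped_qvar_le.
have izy k : (m <= k < N)%N -> P.-integrable setT (EFin \o (fun w => z k w * y k w)).
  move=> kN; apply: (@integrable_boundedM _ _ _ _ _ _ 1) => //; last exact: iy.
  exact: gmeasurable_measurable (hG k) (mz k kN).
pose Sz w := \sum_(m <= k < N) (if (m <= k < N)%N then z k w * y k w else 0).
have iSz : P.-integrable setT (EFin \o Sz).
  apply: integrable_real_sum => k _; have [/izy//|_] := boolP (_ <= _ < _)%N.
  exact: integrable_real_cst.
have SzE w : Sz w = \sum_(m <= k < N) z k w * y k w.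
  by rewrite /Sz big_nat [RHS]big_nat; apply: eq_bigr => k ->.
have intSz : `|\int[P]_w Sz w| <= \sum_(m <= k < N) u k.
  rewrite Rintegral_sum; last first.
    move=> k _; have [/izy//|_] := boolP (_ <= _ < _)%N; exact: integrable_real_cst.
  apply: (le_trans (ler_norm_sum _ _ _)); rewrite big_nat [leRHS]big_nat.
  by apply: ler_sum => k kN; rewrite kN; apply: yu => //; exact: mz.
have ieM : P.-integrable setT (EFin \o (fun w => eta w * M w)).
  apply: (@bounded_integrable _ _ _ _ _ E); first exact: measurable_funM.
  by move=> w; rewrite normrM -[leRHS]mul1r ler_pM ?stopped_exp_norm.
have iec : P.-integrable setT (EFin \o (fun w => eta w * cos phi)).
  apply: (@bounded_integrable _ _ _ _ _ 1); first exact: measurable_funM.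
  by move=> w; rewrite normrM mulr_ile1// cos_max.
have pw w : `|eta w * M w - eta w * cos phi - E * Sz w| <= E * (4 * (C + 1) * B w).
  have h := @stopped_exp_expansion R C phi m (y ^~ w) C0 N (B w) mN (fun k => yB k w) (B0 w).
  apply: le_trans h; set X := (X in _ <= `|X|).
  rewrite (_ : _ - _ - _ = eta w * X); first by rewrite normrM ler_piMl.
  rewrite /X SzE mulrDr mulrBr mulr_sumr; congr (_ + _).
  rewrite mulr_sumr -sumrN; apply: eq_bigr => k _.
  by rewrite /z; field; rewrite gt_eqF.
rewrite -RintegralB//.
have -> : \int[P]_w (eta w * M w - eta w * cos phi) =
   \int[P]_w (eta w * M w - eta w * cos phi - E * Sz w) + E * \int[P]_w Sz w.
  rewrite -RintegralZl// -RintegralD//; last 2 first.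
  - by apply: integrable_realB; [exact: integrable_realB|exact: integrable_realZ].
  - exact: integrable_realZ.
  by apply: eq_Rintegral => w _; rewrite subrK.
rewrite (le_trans (ler_normD _ _))// mulrDr addrC lerD//.
  by rewrite normrM gtr0_norm// ler_pM2l.
have iEB : P.-integrable setT (EFin \o (fun w => E * (4 * (C + 1) * B w))).
  by do 2 apply: integrable_realZ.
apply: (le_trans (Rint_norm_le _ iEB pw)).
  by apply: integrable_realB; [exact: integrable_realB|exact: integrable_realZ].
by rewrite !RintegralZl//; exact: integrable_realZ.
Qed.

End one_row.

Lemma exp_half_lipschitz (a b : R) : 0 <= a -> 0 <= b ->
  `|expR (- a / 2) - expR (- b / 2)| <= Num.min `|a - b| 1.
Proof.
wlog ab : a b / a <= b.
  by move=> H a0 b0; have [/H->//|/ltW/H] := leP a b; rewrite distrC (distrC a) => ->.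
move=> a0 b0.
have hb : expR (- b / 2) <= expR (- a / 2) by rewrite ler_expR; lra.
have ha : expR (- a / 2) <= 1 by rewrite expR_le1; lra.
have pb := expR_gt0 (- b / 2); have pa := expR_gt0 (- a / 2).
rewrite le_min ger0_norm ?subr_ge0//; apply/andP; split; last lra.
rewrite ler0_norm ?subr_le0//.
have := expR_ge1Dx (- (b - a) / 2).
have -> : expR (- b / 2) = expR (- a / 2) * expR (- (b - a) / 2).
  by rewrite -expRD; congr expR; field.
by move: ha pa; set e := expR (- a / 2); set e' := expR _ => *; nra.
Qed.

Lemma tail_indic_cvg0 (L : T -> R) : measurable_fun setT L ->
  \int[P]_w \1_[set w | n%:R < L w] w @[n --> \oo] --> (0 : R).
Proof.
move=> mL; rewrite -[X in _ --> X](Rint_cst P 0).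
have mA n : measurable [set w | n%:R < L w].
  rewrite (_ : [set w | _] = L @^-1` `]n%:R, +oo[%classic); last first.
    by apply/seteqP; split => w /=; rewrite in_itv/= andbT.
  by rewrite -[X in measurable X]setTI; apply: mL => //; exact: measurable_itv.
apply: (@Rint_dominated_cvg _ _ _ _ _ (fun=> 0) (fun=> 1)) => //.
- by move=> n; exact: measurable_indic.
- move=> w; apply: cvg_near_cst; near=> n.
  rewrite indicE memNset//=; apply/negP; rewrite -leNgt.
  by near: n; exact: nbhs_infty_ger.
- exact: integrable_real_cst.
- by move=> n w; exact: norm_indic_le1.
Unshelve. all: by end_near. Qed.

(** The conditional central limit theorem for starting times tending to
    infinity: the limit $e^{-L/2}$ is approximated in mean by a variable of some
    earlier row, hence known at the starting time of all late rows. *)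
Theorem clt_array_conditional m N y L : clt_array m N y L ->
  (forall k, \forall n \near \oo, (k <= m n)%N) ->
  forall (eta : nat -> T -> R) (phi : R),
    (forall n, gmeasurable (G (m n)) (eta n)) -> (forall n w, `|eta n w| <= 1) ->
  \int[P]_w (eta n w * (cos (\sum_(m n <= k < N n) y n k w + phi) -
                        expR (- L w / 2) * cos phi)) @[n --> \oo] --> 0.
Proof.
move=> [mN my iy [u yu u0] [B [iB B0 yB EB]] mL L0 qv] moo eta phi meta eta1.
pose Q n w := qvar (m n) (y n ^~ w) (N n).
have gQ n : gmeasurable (G (N n)) (Q n).
  exact: (gmeasurable_qvar (my n) (leqnn _)).
have mQ n : measurable_fun setT (Q n) by exact: gmeasurable_measurable (gQ n).
have myT n k : (m n <= k < N n)%N -> measurable_fun setT (y n k).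
  by move=> kN; exact: gmeasurable_measurable (hG _) (my n k kN).
have Q0 n w : 0 <= Q n w by apply: sumr_ge0 => k _; exact: psi_ge0.
have metaT n := gmeasurable_measurable (hG _) (meta n).
have mS2 n : measurable_fun setT (fun w => \sum_(m n <= k < N n) y n k w ^+ 2).
  by apply: measurable_sum_nat => k kN; apply: measurable_funX; exact: myT.
pose S n w := \sum_(m n <= k < N n) y n k w.
have mS n : measurable_fun setT (S n).
  by apply: measurable_sum_nat => k kN; exact: myT.
have qQ : pdist P (Q n) L @[n --> \oo] --> 0.
  apply: (@squeeze0 _ _ _ _ (cvg0D qv EB)).
  apply: nearW => n; rewrite ger0_norm ?pdist_ge0// -RintegralD//; last first.
    by apply: integrable_min1; exact: measurable_funB.
  apply: le_Rint.
  - by apply: integrable_min1; exact: measurable_funB.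
  - apply: integrable_realD => //; apply: integrable_min1; exact: measurable_funB.
  move=> w; have [B1|B1] := leP (B n w) 1; last first.
    rewrite ge_min; apply/orP; right; apply: (le_trans (ltW B1)).
    by rewrite lerDr le_min normr_ge0 ler01.
  rewrite (_ : Q n w = \sum_(m n <= k < N n) y n k w ^+ 2) ?lerDl//.
  rewrite /Q /qvar !big_nat; apply: eq_bigr => k kN; rewrite psi_small//.
  exact: le_trans (yB _ _ _ kN) B1.
have mEL : measurable_fun setT (fun w => expR (- L w / 2)).
  by apply: measurableT_comp => //; apply: measurable_funM => //; exact: measurableT_comp.
have EL1 w : `|expR (- L w / 2)| <= 1.
  by rewrite ger0_norm ?expR_ge0// expR_le1; have := L0 w; lra.
have mEQ n : measurable_fun setT (fun w => expR (- Q n w / 2)).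
  by apply: measurableT_comp => //; apply: measurable_funM => //; exact: measurableT_comp.
have EQ1 n w : `|expR (- Q n w / 2)| <= 1.
  by rewrite ger0_norm ?expR_ge0// expR_le1; have := Q0 n w; lra.
apply: cvg0_eps => e e0.
have [C' tailC] : exists C' : nat, 3 * \int[P]_w \1_[set w | C'%:R < L w] w <= e / 2.
  have /cvgrPdist_lt/(_ (e / 6)) := tail_indic_cvg0 mL.
  move=> /(_ (divr_gt0 e0 (ltr0n _ 6))) [k _ /(_ k (leqnn k))] /=.
  rewrite sub0r normrN => /(le_lt_trans (ler_norm _)) h; exists k; lra.
pose C : R := C'%:R + 1; have C0 : 0 <= C by rewrite addr_ge0.
set E := expR ((C + 1) / 2); have E0 : 0 < E by exact: expR_gt0.
have [p pQ] : exists p, (E + 1) * pdist P (Q p) L <= e / 2.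
  have /cvgrPdist_lt/(_ ((e / 2) / (E + 1))) := qQ.
  have E1 : 0 < E + 1 by rewrite addr_gt0.
  move=> /(_ (divr_gt0 (divr_gt0 e0 (ltr0n _ 2)) E1)) [k _ /(_ k (leqnn k))] /=.
  rewrite sub0r normrN => /(le_lt_trans (ler_norm _)) h; exists k.
  by move: h; rewrite ltr_pdivlMr// mulrC => /ltW.
exists (fun n => (E + 2) * pdist P (Q n) L +
   E * (\sum_(m n <= k < N n) u n k + 4 * (C + 1) * \int[P]_w B n w)).
  apply: cvg0D; first exact: cvg0Zl.
  by apply: cvg0Zl; apply: cvg0D => //; exact: cvg0Zl.
apply: filterS (moo (N p)) => n Npn.
pose M w := stopped_exp C phi (m n) (y n ^~ w) (N n).
have mM : measurable_fun setT M.
  apply: (gmeasurable_measurable (hG (N n))).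
  exact: (gmeasurable_stopped_exp (my n) _ _ (leqnn _)).
have M1 w : `|M w| <= E by exact: stopped_exp_norm.
pose v w := expR (- Q p w / 2).
have gv : gmeasurable (G (m n)) v.
  apply: measurableT_comp => //; apply: measurable_funM => //.
  apply: measurableT_comp => //.
  exact: (gmeasurable_mono (hG (N p))) (Gmono Npn) (gQ p).
have mv : measurable_fun setT v by exact: mEQ.
have v1 w : `|v w| <= 1 by exact: EQ1.
pose F w := cos (S n w + phi).
have mF : measurable_fun setT F.
  by apply: (measurableT_comp (@measurable_cos R)); exact: measurable_funD.
have mA : measurable [set w | C'%:R < L w].
  rewrite (_ : [set w | _] = L @^-1` `]C'%:R, +oo[%classic); last first.
    by apply/seteqP; split => w /=; rewrite in_itv/= andbT.
  by rewrite -[X in measurable X]setTI; apply: mL => //; exact: measurable_itv.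
(* The stopped exponential replaces the cosine in d1, the approximation v of
   the limit, known at the start of the row, replaces exp (- L / 2) in d2, and
   the expectation of the stopped exponential is preserved from d3 to d4. *)
pose d1 w := eta n w * (F w - expR (- L w / 2) * M w).
pose d2 w := eta n w * ((expR (- L w / 2) - v w) * (M w - cos phi)).
pose d3 w := (eta n w * v w) * M w.
pose d4 w := (eta n w * v w) * cos phi.
have cphi : `|cos phi| <= 1 by exact: cos_max.
have i1 : P.-integrable setT (EFin \o d1).
  apply: (@bounded_integrable _ _ _ _ _ (1 * (1 + 1 * E))).
    apply: measurable_funM => //; apply: measurable_funB => //; exact: measurable_funM.
  move=> w; rewrite normrM ler_pM// (le_trans (ler_normB _ _))// lerD ?cos_max//.
  by rewrite normrM ler_pM.
have i2 : P.-integrable setT (EFin \o d2).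
  apply: (@bounded_integrable _ _ _ _ _ (1 * ((1 + 1) * (E + 1)))).
    apply: measurable_funM => //; apply: measurable_funM; exact: measurable_funB.
  move=> w; rewrite normrM ler_pM// normrM ler_pM//.
    by rewrite (le_trans (ler_normB _ _))// lerD.
  by rewrite (le_trans (ler_normB _ _))// lerD.
have i3 : P.-integrable setT (EFin \o d3).
  apply: (@bounded_integrable _ _ _ _ _ (1 * 1 * E)).
    by do 2 apply: measurable_funM => //.
  by move=> w; rewrite normrM ler_pM// normrM ler_pM.
have i4 : P.-integrable setT (EFin \o d4).
  apply: (@bounded_integrable _ _ _ _ _ (1 * 1 * 1)).
    by do 2 apply: measurable_funM => //.
  by move=> w; rewrite normrM ler_pM// normrM ler_pM.
have -> : \int[P]_w (eta n w * (F w - expR (- L w / 2) * cos phi)) =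
    \int[P]_w d1 w + \int[P]_w d2 w + (\int[P]_w d3 w - \int[P]_w d4 w).
  rewrite -RintegralD// -RintegralB// -RintegralD//; last 2 first.
  - exact: integrable_realD.
  - exact: integrable_realB.
  by apply: eq_Rintegral => w _; rewrite /d1 /d2 /d3 /d4; ring.
have b1 : `|\int[P]_w d1 w| <= (E + 2) * pdist P (Q n) L + e / 2.
  apply: (@le_trans _ _ (\int[P]_w ((E + 2) * Num.min `|Q n w - L w| 1 +
       3 * \1_[set w | C'%:R < L w] w))).
    apply: Rint_norm_le => //.
    - apply: integrable_realD; apply: integrable_realZ.
        by apply: integrable_min1; exact: measurable_funB.
      exact: integrable_real_indic.
    move=> w; rewrite normrM; apply: (@le_trans _ _ (1 * `|F w - expR (- L w / 2) * M w|)).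
      by rewrite ler_wpM2r.
    rewrite mul1r distrC (le_trans (stopped_exp_target _ _ _ C0 _ (L0 w)))//.
    rewrite lerD2l ler_pM2l// indicE mem_setE /= (_ : C - 1 = C'%:R)//.
    by rewrite /C; ring.
  rewrite RintegralD//; last 2 first.
  - by apply: integrable_realZ; apply: integrable_min1; exact: measurable_funB.
  - by apply: integrable_realZ; exact: integrable_real_indic.
  rewrite !RintegralZl//; last 2 first.
  - exact: integrable_real_indic.
  - by apply: integrable_min1; exact: measurable_funB.
  by rewrite lerD2l.
have b2 : `|\int[P]_w d2 w| <= e / 2.
  apply: le_trans pQ; rewrite -RintegralZl//; last first.
    by apply: integrable_min1; exact: measurable_funB.
  apply: Rint_norm_le => //.
    by apply: integrable_realZ; apply: integrable_min1; exact: measurable_funB.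
  move=> w; rewrite normrM -[leRHS]mul1r ler_pM// normrM mulrC ler_pM//.
    by rewrite (le_trans (ler_normB _ _))// lerD.
  by rewrite distrC exp_half_lipschitz.
have b3 : `|\int[P]_w d3 w - \int[P]_w d4 w| <=
    E * (\sum_(m n <= k < N n) u n k + 4 * (C + 1) * \int[P]_w B n w).
  have gev : gmeasurable (G (m n)) (fun w => eta n w * v w).
    by apply: measurable_funM => //; exact: meta.
  have ev1 w : `|eta n w * v w| <= 1 by rewrite normrM mulr_ile1.
  exact: (stopped_exp_expectation (mN n) (my n) phi C0 gev ev1 (iy n) (yu n)
    (iB n) (B0 n) (fun k w => yB n k w)).
rewrite (le_trans (ler_normD _ _))//.
have := ler_normD (\int[P]_w d1 w) (\int[P]_w d2 w); lra.
Qed.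

End quasi_martingale_arrays.

(** * Rows that start at the origin of time *)
Lemma norm_cosB_le (R : realType) (a b : R) : `|cos a - cos b| <= `|a - b|.
Proof.
suff H (p q : R) : `|cos (p + q) - cos (p - q)| <= `|2 * q|.
  have := H ((a + b) / 2) ((a - b) / 2).
  rewrite (_ : (a + b) / 2 + (a - b) / 2 = a); last by field.
  rewrite (_ : (a + b) / 2 - (a - b) / 2 = b); last by field.
  by rewrite (_ : 2 * ((a - b) / 2) = a - b)//; field.
have -> : cos (p + q) - cos (p - q) = - 2 * (sin p * sin q).
  by rewrite cosB cosD; ring.
rewrite !normrM normrN ler_pM2l ?normr_gt0 ?pnatr_eq0//.
by rewrite -[leRHS]mul1r ler_pM ?sin_max ?norm_sin_le.
Qed.

(** The index is the largest $j \le \min(n, N_n)$ such that $j^2 a_n \le 1$. *)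
Lemma slow_index_exists (R : realType) (a : nat -> R) (N : nat -> nat) :
  (forall n, 0 <= a n) -> a @ \oo --> 0 ->
  (forall k, \forall n \near \oo, (k <= N n)%N) ->
  exists p : nat -> nat, [/\ forall n, (p n <= N n)%N,
    forall k, \forall n \near \oo, (k <= p n)%N &
    (p n)%:R * a n @[n --> \oo] --> 0].
Proof.
move=> a0 acvg Noo.
pose ok n (j : 'I_n.+1) := (j <= N n)%N && (j%:R ^+ 2 * a n <= 1).
pose p n : nat := \max_(j < n.+1 | ok n j) j.
have pok n : (p n <= N n)%N /\ (p n)%:R ^+ 2 * a n <= 1.
  have ok0 : ok n ord0 by rewrite /ok leq0n/= expr0n mul0r ler01.
  have cok : (0 < #|ok n|)%N by apply/card_gt0P; exists ord0.
  have [j /andP[jN j2] e] := eq_bigmax_cond (fun j => nat_of_ord j) cok.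
  by have -> : p n = j by exact: e.
have poo k : \forall n \near \oo, (k <= p n)%N.
  have k0 : 0 < (k%:R ^+ 2 + 1)^-1 :> R by rewrite invr_gt0 ltr_wpDl ?sqr_ge0.
  have hc : \forall n \near \oo, `|0 - a n| < (k%:R ^+ 2 + 1)^-1.
    by move/cvgrPdist_lt : acvg; exact.
  near=> n.
  have kn : (k <= n)%N by near: n; exact: nbhs_infty_ge.
  have kk : (k < n.+1)%N by [].
  rewrite /p (@leq_bigmax_cond _ (ok n) (fun j => nat_of_ord j) (Ordinal kk))//.
  apply/andP; split => /=; first by near: n; exact: Noo.
  have : `|0 - a n| < (k%:R ^+ 2 + 1)^-1 by near: n.
  rewrite sub0r normrN ger0_norm// => /ltW h.
  apply: (@le_trans _ _ ((k%:R ^+ 2 + 1) * a n)).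
    by rewrite ler_wpM2r// lerDl.
  by rewrite mulrC -ler_pdivlMr ?div1r// ltr_wpDl ?sqr_ge0.
exists p; split => //; first by move=> n; exact: (pok n).1.
apply: cvg0_eps => e e0; exists (fun=> 0); first exact: cvg_cst.
apply: filterS (poo (Num.truncn e^-1).+1) => n kp.
have pe : e^-1 <= (p n)%:R.
  apply: le_trans (ltW (truncnS_gt e^-1)) _; by rewrite ler_nat.
have p0 : 0 < (p n)%:R :> R by rewrite (lt_le_trans _ pe)// invr_gt0.
rewrite add0r ger0_norm ?mulr_ge0//.
have := (pok n).2; rewrite expr2 -mulrA => h.
rewrite -(ler_pM2l p0) (le_trans h)//.
by rewrite -ler_pdivrMr// div1r.
Unshelve. all: by end_near. Qed.

Section stable.
Context d (T : measurableType d) (R : realType) (P : probability T R).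
Variable G : nat -> set (set T).
Hypothesis hG : forall n, sub_sigma_field (G n).
Hypothesis Gmono : forall m n, (m <= n)%N -> G m `<=` G n.

Lemma sum_nat_const_le (p N : nat) (f : nat -> R) b : (p <= N)%N ->
  (forall k, (0 <= k < N)%N -> f k <= b) -> \sum_(0 <= k < p) f k <= p%:R * b.
Proof.
move=> pN fb.
have -> : p%:R * b = \sum_(0 <= k < p) b by rewrite sumr_const_nat subn0 mulr_natl.
by rewrite big_nat [leRHS]big_nat; apply: ler_sum => k /andP[_ kp];
  apply: fb; rewrite leq0n (leq_trans kp).
Qed.

(** Dropping $p_n$ terms changes the sum of squares by at most $p_n B_n^2$. *)
Lemma clt_array_drop N y L (p : nat -> nat) (B : nat -> T -> R) :
  clt_array P G (fun=> 0%N) N y L ->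
  (forall n, P.-integrable setT (EFin \o B n)) ->
  (forall n w, 0 <= B n w) ->
  (forall n k w, (0 <= k < N n)%N -> `|y n k w| <= B n w) ->
  \int[P]_w B n w @[n --> \oo] --> 0 ->
  (forall n, (p n <= N n)%N) ->
  (p n)%:R * \int[P]_w B n w @[n --> \oo] --> 0 ->
  clt_array P G p N y L.
Proof.
move=> [_ my iy [u yu u0] _ mL L0 qv] iB B0 yB EB pN pB.
have wk n k : (p n <= k < N n)%N -> (0 <= k < N n)%N by move=> /andP[].
have ug0 n k : (0 <= k < N n)%N -> 0 <= u n k.
  move=> kN; apply: le_trans (normr_ge0 _) (yu n k (cst 0) kN _ _).
    exact: measurable_cst.
  by move=> w; rewrite normr0.
have my' n k : (0 <= k < N n)%N -> measurable_fun setT (y n k).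
  by move=> kN; exact: gmeasurable_measurable (hG _) (my n k kN).
have mS n q r : (r <= N n)%N ->
    measurable_fun setT (fun w => \sum_(q <= k < r) y n k w ^+ 2).
  move=> rN; apply: measurable_sum_nat => k /andP[_ kr]; apply: measurable_funX.
  by apply: my'; rewrite leq0n (leq_trans kr).
split => //.
- by move=> n k /wk; exact: my.
- by move=> n k /wk; exact: iy.
- exists u; first by move=> n k z /wk kN; exact: yu.
  apply: squeeze0 u0; apply: nearW => n; rewrite ger0_norm; last first.
    by rewrite big_nat sumr_ge0// => k /wk; exact: ug0.
  rewrite [leRHS](big_cat_nat (leq0n (p n)) (pN n))/= lerDr big_nat sumr_ge0//.
  by move=> k /andP[_ kp]; apply: ug0; rewrite leq0n (leq_trans kp).
- by exists B; split => // n k w /wk; exact: yB.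
apply: (@squeeze0 _ _ _ _ (cvg0D pB qv)); apply: nearW => n.
rewrite ger0_norm ?pdist_ge0//.
have tri := pdist_triangle P (mS n (p n) (N n) (leqnn _)) (mS n 0%N (N n) (leqnn _)) mL.
apply: (le_trans tri).
rewrite lerD2r -RintegralZl//; apply: le_Rint.
- by apply: integrable_min1; apply: measurable_funB; exact: mS.
- exact: integrable_realZ.
move=> w; rewrite [X in _ - X](big_cat_nat (leq0n (p n)) (pN n))/=.
rewrite opprD addrCA subrr addr0 normrN ger0_norm; last first.
  by apply: sumr_ge0 => k _; exact: sqr_ge0.
have [p0|p0] := posnP (p n); first by rewrite p0 big_geq// mul0r ge_min lexx.
have [B1|B1] := leP (B n w) 1; last first.
  rewrite ge_min; apply/orP; right; apply: (le_trans (ltW B1)).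
  by rewrite ler_peMl// ler1n.
rewrite ge_min; apply/orP; left; apply: (sum_nat_const_le (pN n)) => k kN.
rewrite sqr_normE (le_trans _ (yB n k w kN))// expr2 ler_piMl//.
exact: le_trans (yB n k w kN) B1.
Qed.

(** Stable convergence: the rows may be started at a slowly growing index, and
    by then the conditional probability of the event has settled. *)
Theorem clt_array_stable N y L (H : set T) (phi : R) :
  clt_array P G (fun=> 0%N) N y L ->
  (forall k, \forall n \near \oo, (k <= N n)%N) -> measurable H ->
  \int[P]_w (\1_H w * (cos (\sum_(0 <= k < N n) y n k w + phi) -
                        expR (- L w / 2) * cos phi)) @[n --> \oo] --> 0.
Proof.
move=> arr Noo mH.
have [_ my iy _ [B [iB B0 yB EB]] mL L0 qv] := arr.
have [p [pN poo pB]] := slow_index_exists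
  (fun n => Rintegral_ge0 P (fun w _ => B0 n w)) EB Noo.
have arrp := clt_array_drop arr iB B0 yB EB pN pB.
have /choice[h hP] := fun n => bounded_cond_prob_exists P (hG n) mH.
have gh n : gmeasurable (G n) (h n) by have [] := hP n.
have h1 n w : `|h n w| <= 1 by have [] := hP n.
have hE n : forall (c : R) z, gmeasurable (G n) z -> (forall w, `|z w| <= c) ->
    \int[P]_w (z w * h n w) = \int[P]_w (z w * \1_H w) by have [] := hP n.
have mh n : measurable_fun setT (h n) by exact: gmeasurable_measurable (gh n).
have cauchy := cond_prob_cauchy hG Gmono mH gh h1 hE pN poo.
have lim := clt_array_conditional hG Gmono arrp poo phi (fun n => gh (p n)) (fun n => h1 (p n)).
have my' n k : (0 <= k < N n)%N -> measurable_fun setT (y n k).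
  by move=> kN; exact: gmeasurable_measurable (hG _) (my n k kN).
pose S n w := \sum_(0 <= k < N n) y n k w.
pose S' n w := \sum_(p n <= k < N n) y n k w.
pose c n (w : T) : R := cos (S n w + phi).
pose c' n (w : T) : R := cos (S' n w + phi).
have mc n : measurable_fun setT (c n).
  apply: (measurableT_comp (@measurable_cos R)); apply: measurable_funD => //.
  by apply: measurable_sum_nat => k kN; exact: my'.
have gc' n : gmeasurable (G (N n)) (c' n).
  apply: (measurableT_comp (@measurable_cos R)); apply: measurable_funD => //.
  apply: measurable_sum_nat => k /andP[_ kN].
  by apply: (gmeasurable_mono (hG k.+1)) => //; [exact: Gmono|apply: my].
have mc' n : measurable_fun setT (c' n) by exact: gmeasurable_measurable (gc' n).
have mH1 : measurable_fun setT (\1_H : T -> R) by exact: measurable_indic.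
pose EL w := expR (- L w / 2).
have mEL : measurable_fun setT EL.
  by apply: measurableT_comp => //; apply: measurable_funM => //; exact: measurableT_comp.
have EL1 w : `|EL w| <= 1.
  by rewrite ger0_norm ?expR_ge0// expR_le1; have := L0 w; lra.
have mS2 n : gmeasurable (G (N n)) (fun w => \sum_(0 <= k < N n) y n k w ^+ 2).
  apply: measurable_sum_nat => k /andP[_ kN]; apply: measurable_funX.
  by apply: (gmeasurable_mono (hG k.+1)) => //; [exact: Gmono|apply: my].
pose e1 n := (p n)%:R * \int[P]_w B n w.
pose e2 n := \int[P]_w `|h (N n) w - h (p n) w|.
pose e3 n := \int[P]_w (h (p n) w * (c' n w - EL w * cos phi)).
have cphi : `|cos phi| <= 1 by exact: cos_max.
have icc' n : P.-integrable setT (EFin \o (fun w => \1_H w * (c n w - c' n w))).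
  apply: (@bounded_integrable _ _ _ _ _ (1 * (1 + 1))).
    by apply: measurable_funM => //; exact: measurable_funB.
  move=> w; rewrite normrM ler_pM ?norm_indic_le1//.
  by rewrite (le_trans (ler_normB _ _))// lerD// cos_max.
have b1 n : `|\int[P]_w (\1_H w * (c n w - c' n w))| <= e1 n.
  rewrite /e1 -RintegralZl//; apply: Rint_norm_le => //; first exact: integrable_realZ.
  move=> w; rewrite normrM -[leRHS]mul1r ler_pM ?norm_indic_le1//.
  apply: (le_trans (norm_cosB_le _ _)).
  rewrite /S (big_cat_nat (leq0n (p n)) (pN n))/=.
  rewrite [X in `|X|](_ : _ = \sum_(0 <= k < p n) y n k w); last by rewrite /S'; ring.
  rewrite (le_trans (ler_norm_sum _ _ _))//.
  by apply: (sum_nat_const_le (pN n)) => k kN; exact: yB.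
have ihc n (f : T -> R) : measurable_fun setT f -> (forall w, `|f w| <= 1) ->
    P.-integrable setT (EFin \o (fun w => f w * c' n w)).
  move=> mf f1; apply: (@bounded_integrable _ _ _ _ _ 1); first exact: measurable_funM.
  by move=> w; rewrite normrM mulr_ile1// cos_max.
have id n : P.-integrable setT (EFin \o (fun w => (h (N n) w - h (p n) w) * c' n w)).
  apply: (@bounded_integrable _ _ _ _ _ ((1 + 1) * 1)).
    by apply: measurable_funM => //; exact: measurable_funB.
  move=> w; rewrite normrM ler_pM ?cos_max//.
  by rewrite (le_trans (ler_normB _ _))// lerD.
have b2 n : `|\int[P]_w ((h (N n) w - h (p n) w) * c' n w)| <= e2 n.
  apply: Rint_norm_le => //.
    by apply: integrable_real_norm; apply: integrable_realB;
      exact: (@bounded_integrable _ _ _ _ _ 1).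
  by move=> w; rewrite normrM ler_piMr// cos_max.
have i3 n : P.-integrable setT (EFin \o (fun w => h (p n) w * (c' n w - EL w * cos phi))).
  apply: (@bounded_integrable _ _ _ _ _ (1 * (1 + 1 * 1))).
    by apply: measurable_funM => //; apply: measurable_funB => //; exact: measurable_funM.
  move=> w; rewrite normrM ler_pM//.
  by rewrite (le_trans (ler_normB _ _))// lerD ?cos_max// normrM ler_pM.
have i4 n : P.-integrable setT (EFin \o (fun w => (h (p n) w - \1_H w) * (EL w * cos phi))).
  apply: (@bounded_integrable _ _ _ _ _ ((1 + 1) * (1 * 1))).
    by apply: measurable_funM => //; [exact: measurable_funB|exact: measurable_funM].
  move=> w; rewrite normrM ler_pM//; last by rewrite normrM ler_pM.
  by rewrite (le_trans (ler_normB _ _))// lerD// norm_indic_le1.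
(* The factor EL is close to a variable v known at a fixed time, against which
   the conditional probability h (p n) integrates like the indicator of H. *)
have b4 : \int[P]_w ((h (p n) w - \1_H w) * (EL w * cos phi)) @[n --> \oo] --> 0.
  apply: cvg0_eps => e e0.
  have e20 : 0 < e / 2 by rewrite divr_gt0.
  have /cvgrPdist_lt/(_ _ e20)[q _ /(_ q (leqnn q))] := qv.
  rewrite sub0r normrN => /(le_lt_trans (ler_norm _)) /ltW hq.
  exists (fun=> 0); first exact: cvg_cst.
  apply: filterS (poo (N q)) => n qn; rewrite add0r.
  pose v w := expR (- (\sum_(0 <= k < N q) y q k w ^+ 2) / 2).
  have gv : gmeasurable (G (p n)) v.
    apply: measurableT_comp => //; apply: measurable_funM => //.
    apply: measurableT_comp => //.
    exact: (gmeasurable_mono (hG (N q))) (Gmono qn) (mS2 q).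
  have mv : measurable_fun setT v by exact: gmeasurable_measurable (gv).
  have v1 w : `|v w| <= 1.
    rewrite ger0_norm ?expR_ge0// expR_le1 mulNr oppr_le0 divr_ge0//.
    by apply: sumr_ge0 => k _; exact: sqr_ge0.
  have gz : gmeasurable (G (p n)) (fun w => v w * cos phi) by exact: measurable_funM.
  have z1 w : `|v w * cos phi| <= 1 by rewrite normrM mulr_ile1.
  have iz (f : T -> R) : measurable_fun setT f -> (forall w, `|f w| <= 1) ->
      P.-integrable setT (EFin \o (fun w => v w * cos phi * f w)).
    move=> mf f1; apply: (@bounded_integrable _ _ _ _ _ (1 * 1)).
      by apply: measurable_funM => //; exact: measurable_funM.
    by move=> w; rewrite normrM ler_pM.
  have <- : \int[P]_w ((h (p n) w - \1_H w) * ((EL w - v w) * cos phi)) =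
     \int[P]_w ((h (p n) w - \1_H w) * (EL w * cos phi)).
    rewrite -[RHS]subr0.
    rewrite -[X in _ = _ - X](subrr (\int[P]_w (v w * cos phi * h (p n) w))).
    rewrite [X in _ = _ - (_ - X)](hE _ _ _ gz z1) -RintegralB//; last 2 first.
    - exact: iz.
    - by apply: iz => // w; exact: norm_indic_le1.
    rewrite -RintegralB//; first by apply: eq_Rintegral => w _; ring.
    by apply: integrable_realB; apply: iz => // w; exact: norm_indic_le1.
  apply: (@le_trans _ _ (2 * pdist P (fun w => \sum_(0 <= k < N q) y q k w ^+ 2) L)); last first.
    by rewrite [leRHS](_ : e = 2 * (e / 2)); [rewrite ler_pM2l|field].
  have mSq : measurable_fun setT (fun w => \sum_(0 <= k < N q) y q k w ^+ 2).
    exact: gmeasurable_measurable (mS2 q).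
  rewrite -RintegralZl//; last by apply: integrable_min1; exact: measurable_funB.
  have hb w : `|h (p n) w - \1_H w| <= 2.
    rewrite (le_trans (ler_normB _ _))//; have := h1 (p n) w.
    by have := @norm_indic_le1 _ T R H w; lra.
  apply: Rint_norm_le.
  - apply: (@bounded_integrable _ _ _ _ _ (2 * ((1 + 1) * 1))).
      by apply: measurable_funM; [exact: measurable_funB|
        apply: measurable_funM => //; exact: measurable_funB].
    move=> w; rewrite normrM ler_pM// normrM ler_pM//.
    by rewrite (le_trans (ler_normB _ _))// lerD.
  - by apply: integrable_realZ; apply: integrable_min1; exact: measurable_funB.
  - move=> w; rewrite normrM ler_pM// normrM -[leRHS]mulr1 ler_pM// distrC.
    by apply: exp_half_lipschitz => //; apply: sumr_ge0 => k _; exact: sqr_ge0.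
have e3cvg : e3 @ \oo --> 0 by exact: lim.
have e4cvg : `|e3 n| @[n --> \oo] --> 0 by apply/norm_cvg0P.
have e5cvg : `|\int[P]_w ((h (p n) w - \1_H w) * (EL w * cos phi))| @[n --> \oo] --> 0.
  by apply/norm_cvg0P.
apply: (squeeze0 _ (cvg0D (cvg0D pB cauchy) (cvg0D e4cvg e5cvg))).
apply: nearW => n.
have -> : \int[P]_w (\1_H w * (c n w - EL w * cos phi)) =
   (\int[P]_w (\1_H w * (c n w - c' n w)) +
    \int[P]_w ((h (N n) w - h (p n) w) * c' n w)) +
   (e3 n + \int[P]_w ((h (p n) w - \1_H w) * (EL w * cos phi))).
  rewrite /e3 -!RintegralD//; last 2 first.
  - exact: integrable_realD.
  - exact: integrable_realD.
  rewrite -[RHS]addr0.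
  (* The variable c' n is known at time N n, when h (N n) may replace the indicator. *)
  rewrite -[X in _ = _ + X](subrr (\int[P]_w (c' n w * h (N n) w))).
  have c'1 w : `|c' n w| <= 1 by exact: cos_max.
  rewrite [X in _ = _ + (X - _)](hE _ _ _ (gc' n) c'1).
  have j1 : P.-integrable setT (EFin \o (fun w => c' n w * \1_H w)).
    apply: (@bounded_integrable _ _ _ _ _ 1); first exact: measurable_funM.
    by move=> w; rewrite normrM mulr_ile1// norm_indic_le1.
  have j2 : P.-integrable setT (EFin \o (fun w => c' n w * h (N n) w)).
    apply: (@bounded_integrable _ _ _ _ _ 1); first exact: measurable_funM.
    by move=> w; rewrite normrM mulr_ile1.
  rewrite -RintegralB// -RintegralD//; last 2 first.
  - by apply: integrable_realD; exact: integrable_realD.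
  - exact: integrable_realB.
  by apply: eq_Rintegral => w _; ring.
by rewrite (le_trans (ler_normD _ _))// lerD// (le_trans (ler_normD _ _))// lerD.
Qed.

End stable.

(** * Integrals against Gaussian laws *)
Section gaussian_integrals.
Variable R : realType.
Local Notation lebesgue := (@lebesgue_measure R).

Lemma Rintegral_normal_prob (m s : R) (f : R -> R) :
  (normal_prob m s).-integrable setT (EFin \o f) ->
  \int[normal_prob m s]_x f x = \int[lebesgue]_x (f x * normal_pdf m s x).
Proof.
move=> intf; rewrite /Rintegral; congr fine.
have dom := normal_prob_dominates m s.
rewrite -(Radon_Nikodym_change_of_variables dom measurableT intf).
have mf := measurable_int _ intf.
have mpdf : measurable_fun setT (fun x => (normal_pdf m s x)%:E).
  by apply/measurable_EFinP; exact: measurable_normal_pdf.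
have mg : measurable_fun [set: R] (fun x : R => (f x * normal_pdf m s x)%:E).
  apply/measurable_EFinP; apply: measurable_funM; last exact: measurable_normal_pdf.
  by have /measurable_EFinP := mf.
have iRN := @Radon_Nikodym_integrable _ _ _ (charge_of_finite_measure (normal_prob m s)) lebesgue dom.
apply: ae_eq_integral => //=.
  by apply: emeasurable_funM => //; exact: (measurable_int lebesgue iRN).
have ae : ae_eq lebesgue setT
    (Radon_Nikodym (charge_of_finite_measure (normal_prob m s)) lebesgue)
    (fun x => (normal_pdf m s x)%:E).
  apply: integral_ae_eq => //.
  by move=> E _ mE; rewrite -Radon_Nikodym_integral.
apply: filterS ae => x /= h _; by rewrite h// EFinM.
Qed.

Variables (s phi : R).
Hypothesis s0 : 0 < s.

Let p x := normal_pdf 0 s x.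
Let h t x := cos (t * x + phi) * expR (t ^+ 2 * (s ^+ 2 / 2)) * p x.
Let h' t x := (s ^+ 2 * t * cos (t * x + phi) - x * sin (t * x + phi)) *
  expR (t ^+ 2 * (s ^+ 2 / 2)) * p x.
Let k t x := s ^+ 2 * sin (t * x + phi) * expR (t ^+ 2 * (s ^+ 2 / 2)) * p x.

Instance is_derive_pdf x : is_derive x (1 : R) p (- x / s ^+ 2 * p x).
Proof.
rewrite /p normal_pdfE ?gt_eqF// /normal_fun.
by apply: is_derive_eq; rewrite /GRing.scale/=; field; rewrite gt_eqF.
Qed.

Let dh t x : is_derive t (1 : R) (h ^~ x) (h' t x).
Proof.
rewrite /h /h'.
by apply: is_derive_eq; rewrite /GRing.scale/=; field.
Qed.

Let dk t x : is_derive x (1 : R) (k t) (h' t x).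
Proof.
rewrite /k /h'.
by apply: is_derive_eq; rewrite /GRing.scale/=; field; rewrite gt_eqF.
Qed.

Let continuous_h t : continuous (h t).
Proof.
move=> x; apply: differentiable_continuous; apply/derivable1_diffP.
exact: ex_derive.
Qed.

Let continuous_h' t : continuous (h' t).
Proof.
move=> x; apply: differentiable_continuous; apply/derivable1_diffP.
exact: ex_derive.
Qed.

Let continuous_k t : continuous (k t).
Proof.
move=> x; apply: differentiable_continuous; apply/derivable1_diffP.
exact: ex_derive.
Qed.

Let p_ge0 x : 0 <= p x.
Proof. exact: normal_pdf_ge0. Qed.

Let p_even x : p (- x) = p x.
Proof. by rewrite /p !normal_pdfE ?gt_eqF// /normal_fun !subr0 sqrrN. Qed.

Section truncated.
Variables (A K : R).
Hypotheses (A0 : 0 < A) (K0 : 0 < K).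

Let F t := \int[lebesgue]_(x in `[- K, K]) h t x.

Let expA (t : R) : - A < t < A -> expR (t ^+ 2 * (s ^+ 2 / 2)) <= expR (A ^+ 2 * (s ^+ 2 / 2)).
Proof.
move=> /andP[t1 t2]; rewrite ler_expR ler_wpM2r ?divr_ge0 ?sqr_ge0//.
have tA : `|t| <= A by rewrite ltW// ltr_norml t1.
by rewrite (sqr_normE t) !expr2 ler_pM.
Qed.

Let KK : - K < K.
Proof. by rewrite -subr_gt0 opprK addr_gt0. Qed.

Let h'_bound (t x : R) : - A < t < A -> x \in `[- K, K] ->
  `|h' t x| <= (s ^+ 2 * A + K) * expR (A ^+ 2 * (s ^+ 2 / 2)) * normal_peak s.
Proof.
move=> tA; rewrite in_itv/= -ler_norml => xK.
rewrite /h' normrM normrM ler_pM ?mulr_ge0//.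
- rewrite ler_pM//; last by rewrite ger0_norm ?expR_ge0// expA.
  rewrite (le_trans (ler_normB _ _))// lerD//.
    rewrite normrM -[leRHS]mulr1 ler_pM ?cos_max// normrM.
    rewrite ger0_norm ?sqr_ge0// ler_wpM2l ?sqr_ge0//.
    by apply: ltW; rewrite ltr_norml.
  by rewrite normrM -[leRHS]mulr1 ler_pM ?sin_max.
- by rewrite ger0_norm// /p normal_pdf_ub// gt_eqF.
Qed.

Let integrable_itv (f : R -> R) : continuous f ->
  lebesgue.-integrable `[- K, K] (EFin \o f).
Proof.
move=> cf; apply: continuous_compact_integrable; first exact: segment_compact.
exact: continuous_subspaceT.
Qed.

Let integral_h' t : \int[lebesgue]_(x in `[- K, K]) h' t x = k t K - k t (- K).
Proof.
rewrite /Rintegral (@continuous_FTC2 _ (h' t) (k t))//.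
- exact: continuous_subspaceT.
- split.
  + by move=> x _; exact: ex_derive.
  + by apply: cvg_at_right_filter; exact: continuous_k.
  + by apply: cvg_at_left_filter; exact: continuous_k.
- by move=> x _; rewrite derive1E; exact: derive_val.
Qed.

Let derivF (t : R) : - A < t < A -> is_derive t (1 : R) F (k t K - k t (- K)).
Proof.
move=> tA.
have It : `]- A, A[%classic t by rewrite /= in_itv.
pose g (_ : R) := (s ^+ 2 * A + K) * expR (A ^+ 2 * (s ^+ 2 / 2)) * normal_peak s.
have d1E u x : partial1of2 h u x = h' u x.
  by rewrite partial1of2E; exact: derive_val.
have g0 y : 0 <= g y.
  apply: mulr_ge0; last exact: normal_peak_ge0.
  apply: mulr_ge0; last exact: expR_ge0.
  by apply: addr_ge0; [apply: mulr_ge0; [exact: sqr_ge0|exact: ltW]|exact: ltW].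
have ig : lebesgue.-integrable `[- K, K] (EFin \o g).
  by apply: integrable_itv; exact: cst_continuous.
have gub u x : `]- A, A[%classic u -> `[- K, K]%classic x -> `|partial1of2 h u x| <= g x.
  by rewrite /= in_itv/= => uA xK; rewrite d1E; exact: h'_bound.
have ih u : `]- A, A[%classic u -> lebesgue.-integrable `[- K, K] (EFin \o h u).
  by move=> _; exact: integrable_itv.
have dh1 u x : `]- A, A[%classic u -> `[- K, K]%classic x -> derivable (h ^~ x) u 1.
  by move=> _ _; exact: ex_derive.
have mB : measurable (`[- K, K]%classic : set (measurableTypeR R)) by exact: measurable_itv.
have dF := derivable_under_integral mB It ih dh1 g0 ig gub.
have eF := differentiation_under_integral mB It ih dh1 g0 ig gub.
have FE : 'D_1 F t = k t K - k t (- K).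
  rewrite -integral_h' -derive1E [LHS]eF; apply: eq_Rintegral => x _.
  exact: d1E.
by rewrite -FE; apply/derivableP.
Qed.

Lemma truncated_gaussian_cos (t : R) : 0 <= t < A ->
  `|\int[lebesgue]_(x in `[- K, K]) h t x - \int[lebesgue]_(x in `[- K, K]) h 0 x|
  <= 2 * s ^+ 2 * expR (A ^+ 2 * (s ^+ 2 / 2)) * p K * t.
Proof.
move=> /andP[t0 tA].
have itA u : u \in `[0, t] -> - A < u < A.
  rewrite in_itv/= => /andP[u0 ut]; rewrite (le_lt_trans ut)// andbT.
  by rewrite (lt_le_trans _ u0)// oppr_lt0.
have [||u ut e] := @MVT_segment R F (fun u => k u K - k u (- K)) 0 t t0.
- move=> u ut; apply: derivF; apply: itA.
  by move: ut; rewrite !in_itv/= => /andP[/ltW -> /ltW ->].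
- apply: derivable_within_continuous => u ut.
  by have := derivF (itA _ ut); case.
rewrite [X in `|X|]e subr0 normrM [`|t|]ger0_norm// ler_wpM2r//.
have kb x : `|x| = K -> `|k u x| <= s ^+ 2 * expR (A ^+ 2 * (s ^+ 2 / 2)) * p K.
  move=> xK; have -> : p K = p x.
    by rewrite -xK; have [x0|x0] := leP 0 x; [rewrite ger0_norm|rewrite ltr0_norm// p_even].
  rewrite /k normrM normrM normrM [`|p x|]ger0_norm// ler_wpM2r// ler_pM//.
    by rewrite ger0_norm ?sqr_ge0// ler_piMr ?sqr_ge0// sin_max.
  by rewrite ger0_norm ?expR_ge0// expA// itA.
have k1 := kb K (gtr0_norm K0).
have k2 := kb (- K); rewrite normrN gtr0_norm// in k2; have {}k2 := k2 erefl.
rewrite (le_trans (ler_normB _ _))//.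
rewrite (_ : 2 * _ * _ * _ = s ^+ 2 * expR (A ^+ 2 * (s ^+ 2 / 2)) * p K +
  s ^+ 2 * expR (A ^+ 2 * (s ^+ 2 / 2)) * p K); last by ring.
exact: lerD.
Qed.

End truncated.

(** The characteristic function: $h(t,x) = \cos(tx+\phi) e^{t^2s^2/2} p(x)$
    satisfies $\partial_t h = \partial_x k$, so that the integral of $h(t, \cdot)$
    over $[-K, K]$ depends on $t$ only through boundary terms. *)
Lemma normal_cos_ge0 (t : R) : 0 <= t ->
  expR (t ^+ 2 * (s ^+ 2 / 2)) * \int[normal_prob 0 s]_x cos (t * x + phi) = cos phi.
Proof.
move=> t0; pose c u := expR (u ^+ 2 * (s ^+ 2 / 2)).
pose B (n : nat) : set R := `[- n.+1%:R, n.+1%:R]%classic.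
have mB n : measurable (B n) by exact: measurable_itv.
pose f n u x := \1_(B n) x * (cos (u * x + phi) * c u).
have mcos u : measurable_fun [set: R] (fun x : R => cos (u * x + phi) * c u).
  apply: measurable_funM => //; apply: (measurableT_comp (@measurable_cos R)).
  by apply: measurable_funD => //; exact: measurable_funM.
have mf n u : measurable_fun [set: R] (f n u).
  by apply: measurable_funM; [exact: measurable_indic|exact: mcos].
have cos_le u x : `|cos (u * x + phi) * c u| <= c u.
  by rewrite normrM [`|c u|]ger0_norm ?expR_ge0// ler_piMl ?expR_ge0 ?cos_max.
have f_le n u x : `|f n u x| <= c u.
  by rewrite normrM -[leRHS]mul1r ler_pM ?norm_indic_le1.
have fE n u : \int[normal_prob 0 s]_x f n u x = \int[lebesgue]_(x in B n) h u x.
  rewrite Rintegral_normal_prob; last first.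
    exact: (@bounded_integrable _ (measurableTypeR R) R (normal_prob 0 s) _ _ (mf n u) (f_le n u)).
  rewrite [RHS]Rintegral_mkcond; apply: eq_Rintegral => x _.
  rewrite patchE /f indicE /h; case: ifPn => _; last by rewrite !mul0r.
  by rewrite mul1r.
have lim u : \int[normal_prob 0 s]_x f n u x @[n --> \oo] -->
    \int[normal_prob 0 s]_x (cos (u * x + phi) * c u).
  apply: (@Rint_dominated_cvg _ (measurableTypeR R) R (normal_prob 0 s)
    (fun n => f n u) _ (fun=> c u) (fun n => mf n u) (mcos u)) => //.
  - move=> x; apply: cvg_near_cst; near=> n.
    rewrite /f indicE mem_set ?mul1r// /B/= in_itv/= -ler_norml.
    apply: (@le_trans _ _ n%:R); last by rewrite ler_nat.
    by near: n; exact: nbhs_infty_ger.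
  - exact: integrable_real_cst.
have bd n : `|\int[normal_prob 0 s]_x f n t x - \int[normal_prob 0 s]_x f n 0 x| <=
    2 * s ^+ 2 * expR ((t + 1) ^+ 2 * (s ^+ 2 / 2)) * (normal_peak s * (2 * s ^+ 2) * n.+1%:R^-1) * t.
  have t1 : 0 <= t < t + 1 by apply/andP; split => //; lra.
  rewrite !fE.
  have n0 : 0 < n.+1%:R :> R by [].
  apply: le_trans (truncated_gaussian_cos (_ : 0 < t + 1) n0 t1) _.
    by lra.
  have c0 : 0 <= 2 * s ^+ 2 * expR ((t + 1) ^+ 2 * (s ^+ 2 / 2)).
    by rewrite mulr_ge0 ?expR_ge0// mulr_ge0 ?sqr_ge0.
  rewrite ler_wpM2r// (ler_wpM2l c0)//.
  rewrite /p normal_pdfE ?gt_eqF// /normal_fun subr0 -mulrA ler_wpM2l ?normal_peak_ge0//.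
  have s20 : 0 < s ^+ 2 by rewrite exprn_gt0.
  set v := n.+1%:R in n0 *.
  have v1 : 1 <= v by rewrite /v ler1n.
  have -> : - v ^+ 2 / (s ^+ 2 *+ 2) = - (v ^+ 2 / (2 * s ^+ 2)) by rewrite -mulr_natl mulNr.
  set z := v ^+ 2 / (2 * s ^+ 2).
  have z0 : 0 < z by rewrite divr_gt0 ?exprn_gt0 ?mulr_gt0.
  apply: (@le_trans _ _ z^-1).
    have e1 := expR_ge1Dx z.
    rewrite expRN lef_pV2 ?posrE ?expR_gt0//; lra.
  have c1 : 0 <= 2 * s ^+ 2 by rewrite mulr_ge0 ?sqr_ge0.
  rewrite /z invf_div (ler_wpM2l c1)//.
  by rewrite lef_pV2 ?posrE ?exprn_gt0// expr2 ler_peMl// ltW.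
have diff0 : \int[normal_prob 0 s]_x f n t x - \int[normal_prob 0 s]_x f n 0 x @[n --> \oo] --> 0.
  apply: (@squeeze0 _ _ (fun n => 2 * s ^+ 2 * expR ((t + 1) ^+ 2 * (s ^+ 2 / 2)) *
      (normal_peak s * (2 * s ^+ 2)) * t * harmonic n)).
    apply: nearW => n; apply: (le_trans (bd n)); rewrite le_eqVlt; apply/orP; left; apply/eqP.
    by rewrite /= /harmonic; set v := _^-1; ring.
  by apply: cvg0Zl; exact: cvg_harmonic.
have e : \int[normal_prob 0 s]_x (cos (t * x + phi) * c t) =
    \int[normal_prob 0 s]_x (cos (0 * x + phi) * c 0).
  apply/eqP; rewrite -subr_eq0; apply/eqP.
  by apply: (@cvg_unique _ (@Rhausdorff R)) diff0; exact: cvgB.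
have ic : (normal_prob 0 s).-integrable setT (EFin \o (fun x => cos (t * x + phi))).
  apply: (@bounded_integrable _ (measurableTypeR R) R (normal_prob 0 s) _ 1) => [|x]; last exact: cos_max.
  apply: (measurableT_comp (@measurable_cos R)).
  by apply: measurable_funD => //; exact: measurable_funM.
rewrite mulrC -RintegralZr// [LHS]e.
rewrite -[RHS](Rint_cst (normal_prob 0 s)); apply: eq_Rintegral => x _.
by rewrite mul0r add0r /c expr0n mul0r expR0 mulr1.
Unshelve. all: by end_near. Qed.

End gaussian_integrals.

Lemma normal_cos (R : realType) (s phi t : R) : 0 < s ->
  \int[normal_prob 0 s]_x cos (t * x + phi) = expR (- (t ^+ 2 * (s ^+ 2 / 2))) * cos phi.
Proof.
move=> s0; have [t0|t0] := leP 0 t.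
  rewrite -(normal_cos_ge0 phi s0 t0) mulrA -expRD addrC subrr expR0 mul1r //.
have t0' : 0 <= - t by rewrite oppr_ge0 ltW.
rewrite -(cosN phi) -(normal_cos_ge0 (- phi) s0 t0') sqrrN mulrA -expRD addrC subrr expR0 mul1r.
by apply: eq_Rintegral => x _; rewrite mulNr -opprD cosN.
Qed.

(** The function $((x-m)^2 - s^2) p(x)$ is the derivative of $-s^2 (x-m) p(x)$, so
    that its integral over an interval centred at $m$ is not positive. *)
Lemma normal_spread (R : realType) (m s r : R) : 0 < s -> 0 < r ->
  \int[normal_prob m s]_x Num.min ((x - m) ^+ 2 / r ^+ 2) 1 <= s ^+ 2 / r ^+ 2.
Proof.
move=> s0 r0; have r20 : 0 < r ^+ 2 by rewrite exprn_gt0.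
have s20 : 0 < s ^+ 2 by rewrite exprn_gt0.
pose p x := normal_pdf m s x.
have dp x : is_derive x (1 : R) p (- (x - m) / s ^+ 2 * p x).
  rewrite /p normal_pdfE ?gt_eqF// /normal_fun.
  by apply: is_derive_eq; rewrite /GRing.scale/=; field; rewrite gt_eqF.
have p0 x : 0 <= p x by exact: normal_pdf_ge0.
pose q x := (x - m) ^+ 2 * p x - s ^+ 2 * p x.
pose F x := - (s ^+ 2) * ((x - m) * p x).
have dF x : is_derive x (1 : R) F (q x).
  by rewrite /F /q; apply: is_derive_eq; rewrite /GRing.scale/=; field; rewrite gt_eqF.
have cont (g : R -> R) : (forall x, derivable g x 1) -> continuous g.
  by move=> dg x; apply: differentiable_continuous; apply/derivable1_diffP.
have cF : continuous F by apply: cont => x; exact: ex_derive.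
have cp : continuous p by apply: cont => x; exact: ex_derive.
have cx2p : continuous (fun x => (x - m) ^+ 2 * p x) by apply: cont => x; exact: ex_derive.
have cq : continuous q by apply: cont => x; exact: ex_derive.
pose B (n : nat) : set R := `[m - n.+1%:R, m + n.+1%:R]%classic.
have mB n : measurable (B n) by exact: measurable_itv.
have mB' n : measurable (B n : set (measurableTypeR R)) by exact: measurable_itv.
have iB (g : R -> R) n : continuous g -> (@lebesgue_measure R).-integrable (B n) (EFin \o g).
  move=> cg; apply: continuous_compact_integrable; first exact: segment_compact.
  exact: continuous_subspaceT.
have mBn n : m - n.+1%:R < m + n.+1%:R by rewrite ltrD2l -subr_gt0 opprK addr_gt0.
have intq n : \int[@lebesgue_measure R]_(x in B n) q x <= 0.
  rewrite /Rintegral (@continuous_FTC2 _ q F)//=.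
  - have -> : F (m + n.+1%:R) - F (m - n.+1%:R) =
        - (s ^+ 2 * n.+1%:R * (p (m + n.+1%:R) + p (m - n.+1%:R))).
      by rewrite /F; ring.
    by rewrite oppr_le0 mulr_ge0 ?addr_ge0// mulr_ge0// ltW.
  - exact: continuous_subspaceT.
  - split.
    + by move=> x _; exact: ex_derive.
    + by apply: cvg_at_right_filter; exact: cF.
    + by apply: cvg_at_left_filter; exact: cF.
  - by move=> x _; rewrite derive1E; exact: derive_val.
have mmin : measurable_fun [set: R] (fun x : R => Num.min ((x - m) ^+ 2 / r ^+ 2) 1).
  apply: measurable_minr => //; apply: measurable_funM => //.
  by apply: measurable_funX; exact: measurable_funB.
have min01 x : `|Num.min ((x - m) ^+ 2 / r ^+ 2) 1| <= 1.
  by rewrite ger0_norm ?ge_min ?lexx ?orbT// le_min ler01 divr_ge0 ?sqr_ge0.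
pose f n x := \1_(B n) x * Num.min ((x - m) ^+ 2 / r ^+ 2) 1.
have mf n : measurable_fun [set: R] (f n).
  by apply: measurable_funM => //; exact: measurable_indic.
have f1 n x : `|f n x| <= 1 by rewrite normrM mulr_ile1// norm_indic_le1.
have lim : \int[normal_prob m s]_x f n x @[n --> \oo] -->
    \int[normal_prob m s]_x Num.min ((x - m) ^+ 2 / r ^+ 2) 1.
  apply: (@Rint_dominated_cvg _ (measurableTypeR R) R (normal_prob m s)
    f _ (fun=> 1) mf mmin) => //.
  - move=> x; apply: cvg_near_cst; near=> n.
    rewrite /f indicE mem_set ?mul1r// /B/= in_itv/= -ler_distl.
    apply: (@le_trans _ _ n%:R); last by rewrite ler_nat.
    by near: n; exact: nbhs_infty_ger.
  - exact: integrable_real_cst.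
apply: (ler_cvg_to lim (cvg_cst _)); apply: nearW => n.
rewrite Rintegral_normal_prob; last first.
  exact: (@bounded_integrable _ (measurableTypeR R) R (normal_prob m s) _ _ (mf n) (f1 n)).
have -> : \int[@lebesgue_measure R]_x (f n x * normal_pdf m s x) =
    \int[@lebesgue_measure R]_(x in B n) (Num.min ((x - m) ^+ 2 / r ^+ 2) 1 * p x).
  rewrite [RHS]Rintegral_mkcond; apply: eq_Rintegral => x _.
  by rewrite patchE /f indicE; case: ifPn => _; rewrite ?mul1r ?mul0r.
have imin : (@lebesgue_measure R).-integrable (B n) (EFin \o (fun x : R => Num.min ((x - m) ^+ 2 / r ^+ 2) 1 * p x)).
  have mg : measurable_fun [set: R] (fun x : R => (Num.min ((x - m) ^+ 2 / r ^+ 2) 1 * p x)%:E).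
    apply/measurable_EFinP; apply: measurable_funM => //.
    exact: measurable_normal_pdf.
  apply: le_integrable (iB p n cp) => //.
  - have mg' : measurable_fun [set: measurableTypeR R]
      (fun x : R => (Num.min ((x - m) ^+ 2 / r ^+ 2) 1 * p x)%:E) by exact: mg.
    exact: measurable_funTS mg'.
  - by move=> x _; rewrite /= lee_fin normrM ler_piMl.
apply: (@le_trans _ _ (\int[@lebesgue_measure R]_(x in B n) ((r ^+ 2)^-1 * (q x + s ^+ 2 * p x)))).
  apply: le_Rintegral => //.
    apply: iB; apply: cont => x; exact: ex_derive.
  move=> x _; rewrite /q subrK mulrA ler_wpM2r// mulrC.
  by rewrite ge_min lexx.
have isp : (@lebesgue_measure R).-integrable (B n) (EFin \o (fun x => s ^+ 2 * p x)).
  by apply: iB; apply: cont => x; exact: ex_derive.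
rewrite RintegralZl//; last by apply: iB; apply: cont => x; exact: ex_derive.
rewrite mulrC ler_wpM2r ?invr_ge0 ?sqr_ge0// RintegralD//; last exact: iB.
rewrite RintegralZl//; last exact: iB.
rewrite -[leRHS]add0r lerD// -[leRHS]mulr1 ler_wpM2l ?sqr_ge0//.
have := @Rint_norm_cst _ _ _ (normal_prob m s) (\1_(B n)) 1 
  (measurable_indic (mB' n)) (@norm_indic_le1 _ (measurableTypeR R) R (B n)).
rewrite Rintegral_normal_prob; last exact: integrable_real_indic.
move=> /(le_trans (ler_norm _)); congr (_ <= _).
rewrite [RHS]Rintegral_mkcond; apply: eq_Rintegral => x _.
by rewrite patchE indicE; case: ifPn => _; rewrite ?mul1r ?mul0r.
Unshelve. all: by end_near. Qed.

Section transfer.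
Context d1 d2 (T1 : measurableType d1) (T2 : measurableType d2) (R : realType).

Lemma Rintegral_distribution (P : probability T1 R) (X : {RV P >-> T2}) (f : T2 -> R)
    (c : R) : measurable_fun setT f -> (forall x, `|f x| <= c) ->
  \int[distribution P X]_x f x = \int[P]_w f (X w).
Proof.
move=> mf fc; rewrite /Rintegral integral_distribution//.
  exact/measurable_EFinP.
by apply: (@bounded_integrable _ _ _ _ (f \o X) c) => // [|w]; [exact: measurableT_comp mf (measurable_funPT X)|exact: fc].
Qed.

(** The same law may live on two copies of one measurable space. *)
Lemma Rintegral_transfer (P : probability T1 R) (Q : probability T2 R) (phi : T1 -> T2)
    (f : T2 -> R) (c : R) : measurable_fun setT phi ->
  (forall A, measurable A -> Q A = P (phi @^-1` A)) ->
  measurable_fun setT f -> (forall x, `|f x| <= c) ->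
  \int[Q]_x f x = \int[P]_w f (phi w).
Proof.
move=> mphi QP mf fc.
pose X : {RV P >-> T2} := HB.pack_for {mfun T1 >-> T2} phi (isMeasurableFun.Build _ _ _ _ phi mphi).
rewrite -(Rintegral_distribution X mf fc) /Rintegral; congr fine.
by apply: eq_measure_integral => A mA _; exact: QP.
Qed.

Lemma bounded_integrable_prod (P : probability T1 R) (Q : probability T2 R)
    (F : T1 -> T2 -> R) (c : R) :
  measurable_fun setT (fun z : T1 * T2 => F z.1 z.2) -> (forall x y, `|F x y| <= c) ->
  (P \x Q)%E.-integrable setT (EFin \o (fun z : T1 * T2 => F z.1 z.2)).
Proof.
move=> mF Fc; apply: (@bounded_integrable _ _ R (P \x Q)%E _ c) => //.
Qed.

Section fubini.
Variables (P : probability T1 R) (Q : probability T2 R) (F : T1 -> T2 -> R) (c : R).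
Hypothesis mF : measurable_fun setT (fun z : T1 * T2 => F z.1 z.2).
Hypothesis Fc : forall x y, `|F x y| <= c.

Let iFx x : Q.-integrable setT (EFin \o F x).
Proof.
apply: (@bounded_integrable _ _ _ _ _ c) => //.
exact: (measurableT_comp mF (pair1_measurable x)).
Qed.

Let iFy y : P.-integrable setT (EFin \o F ^~ y).
Proof.
apply: (@bounded_integrable _ _ _ _ _ c) => //.
exact: (measurableT_comp mF (pair2_measurable y)).
Qed.

Lemma measurable_Rintegral_snd : measurable_fun setT (fun x => \int[Q]_y F x y).
Proof.
apply/measurable_EFinP; rewrite (_ : EFin \o _ = fun x => \int[Q]_y (F x y)%:E)%E.
  exact: (measurable_fubini_F (bounded_integrable_prod (\d_(point : T1)) Q mF Fc)).
by apply/funext => x; rewrite /= Rint_EFin.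
Qed.

Lemma Rintegral_Fubini :
  \int[P]_x \int[Q]_y F x y = \int[Q]_y \int[P]_x F x y.
Proof.
rewrite /Rintegral; congr fine.
have := Fubini (bounded_integrable_prod P Q mF Fc) => /= h.
rewrite (eq_integral (fun x => \int[Q]_y (F x y)%:E)%E); last first.
  by move=> x _; rewrite -Rint_EFin.
rewrite [RHS](eq_integral (fun y => \int[P]_x (F x y)%:E)%E)//.
by move=> y _; rewrite -Rint_EFin.
Qed.

End fubini.

End transfer.

Lemma continuous_measurable_borel d (S : borelType d) (R : realType) (f : S -> R) :
  continuous f -> measurable_fun setT f.
Proof.
move=> cf; apply: (@measurability _ _ S R setT f (@open R) (measurable_borelR R)) => _ [B oB <-].
rewrite setTI measurable_borel; apply: sub_gen_smallest.
by apply: open_comp => // x _; exact: cf.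
Qed.

Section gauss_law_integrals.
Variable R : realType.
Local Notation lebesgue := (@lebesgue_measure R).

Lemma Rintegral_gauss_law_normal (a b : R) (f : R -> R) (c : R) : 0 < b ->
  measurable_fun setT f -> (forall x, `|f x| <= c) ->
  \int[gauss_law a b]_x f x = \int[normal_prob a (Num.sqrt b)]_x f x.
Proof.
move=> b0 mf fc.
apply: (@Rintegral_transfer _ _ (measurableTypeR R) R R
  (normal_prob a (Num.sqrt b)) (gauss_law a b) id f c) => //.
move=> A mA; change (gauss_law a b A = normal_prob a (Num.sqrt b) A).
by rewrite /gauss_law gt_eqF.
Qed.

Lemma Rintegral_gauss_law (a b : R) (f : R -> R) (c : R) : 0 < b ->
  measurable_fun setT f -> (forall x, `|f x| <= c) ->
  \int[gauss_law a b]_x f x = \int[lebesgue]_x (f x * normal_pdf a (Num.sqrt b) x).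
Proof.
move=> b0 mf fc; rewrite (Rintegral_gauss_law_normal _ b0 mf fc).
rewrite Rintegral_normal_prob//.
exact: (@bounded_integrable _ (measurableTypeR R) R (normal_prob a (Num.sqrt b)) f c mf fc).
Qed.

Lemma Rintegral_gauss_law0 (a : R) (f : R -> R) (c : R) :
  measurable_fun setT f -> (forall x, `|f x| <= c) ->
  \int[gauss_law a 0]_x f x = f a.
Proof.
move=> mf fc.
rewrite (_ : \int[_]_x f x = \int[\d_a]_x f x); last first.
  by rewrite /Rintegral; congr fine; apply: eq_measure_integral => A mA _;
    rewrite /= /gauss_law eqxx.
rewrite /Rintegral integral_dirac//; last by apply/measurable_EFinP.
by rewrite diracT mul1e.
Qed.

Lemma measurable_affine_cos (t phi : R) : measurable_fun [set: R] (fun x : R => cos (t * x + phi)).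
Proof.
by apply: (measurableT_comp (@measurable_cos R)); exact: measurable_funD.
Qed.

Lemma gauss_law_cos (b t phi : R) : 0 <= b ->
  \int[gauss_law 0 b]_x cos (t * x + phi) = expR (- (t ^+ 2 * b) / 2) * cos phi.
Proof.
rewrite le_eqVlt => /predU1P[<-|b0].
  rewrite (@Rintegral_gauss_law0 _ _ 1); last 2 first.
  - exact: measurable_affine_cos.
  - by move=> x; exact: cos_max.
  by rewrite !mulr0 oppr0 mul0r expR0 mul1r add0r.
rewrite (@Rintegral_gauss_law_normal _ _ _ 1 b0); last 2 first.
- exact: measurable_affine_cos.
- by move=> x; exact: cos_max.
rewrite normal_cos ?sqrtr_gt0// sqr_sqrtr ?ltW//.
by congr (expR _ * _); field.
Qed.

Lemma gauss_law_spread (m b r : R) : 0 < b -> 0 < r ->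
  \int[gauss_law m b]_x Num.min ((x - m) ^+ 2 / r ^+ 2) 1 <= b / r ^+ 2.
Proof.
move=> b0 r0; rewrite (@Rintegral_gauss_law_normal _ _ _ 1 b0); last 2 first.
- apply: measurable_minr => //; apply: measurable_funM => //.
  by apply: measurable_funX; exact: measurable_funB.
- by move=> x; rewrite ger0_norm ?ge_min ?lexx ?orbT// le_min ler01 divr_ge0 ?sqr_ge0.
by rewrite -[in leRHS](sqr_sqrtr (ltW b0)) normal_spread// sqrtr_gt0.
Qed.

(** Mollification by a Gaussian law with density is an average against a fixed
    Gaussian law of values of the mollifier. *)
Lemma gauss_law_change (x b : R) (g : R -> R) (K c : R) : 0 < b ->
  measurable_fun setT g -> (forall y, `|g y| <= c) -> (forall y, K < `|y| -> g y = 0) ->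
  \int[gauss_law x b]_y g y =
  \int[gauss_law 0 1]_y (g y / normal_pdf 0 1 y * normal_pdf x (Num.sqrt b) y).
Proof.
move=> b0 mg gc gK.
have s0 : Num.sqrt b != 0 by rewrite gt_eqF// sqrtr_gt0.
have pdf_gt0 y : 0 < normal_pdf 0 1 y :> R.
  by rewrite normal_pdfE ?oner_eq0// mulr_gt0 ?expR_gt0// normal_peak_gt0 ?oner_eq0.
have c0 : 0 <= c by rewrite (le_trans _ (gc 0)).
have mpdf s (z : R) : measurable_fun [set: R] (fun y => normal_pdf z s y).
  exact: measurable_normal_pdf.
have mh : measurable_fun setT (fun y => g y / normal_pdf 0 1 y * normal_pdf x (Num.sqrt b) y).
  apply: measurable_funM => //; apply: measurable_funM => //.
  apply: ge0_measurable_inv => [y|]; first exact: normal_pdf_ge0.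
  exact: mpdf.
have hc y : `|g y / normal_pdf 0 1 y * normal_pdf x (Num.sqrt b) y| <=
    c / normal_pdf 0 1 K * normal_peak (Num.sqrt b).
  rewrite normrM ler_pM//; last first.
    by rewrite ger0_norm ?normal_pdf_ge0// normal_pdf_ub.
  have [yK|yK] := ltP K `|y|.
    by rewrite gK// mul0r normr0 divr_ge0// ltW.
  rewrite normrM ler_pM// gtr0_norm ?invr_gt0// lef_pV2 ?posrE//.
  rewrite !normal_pdfE ?oner_eq0// ler_wpM2l ?normal_peak_ge0//.
  rewrite /normal_fun !subr0 ler_expR ler_wpM2r ?invr_ge0 ?mulrn_wge0 ?sqr_ge0//.
  rewrite lerN2 (sqr_normE y) lerXn2r ?nnegrE// (le_trans _ yK)//.
apply: etrans (Rintegral_gauss_law x b0 mg gc) _.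
apply: etrans _ (esym (Rintegral_gauss_law 0 ltr01 mh hc)).
by apply: eq_Rintegral => y _; rewrite sqrtr1; field; rewrite gt_eqF.
Qed.

End gauss_law_integrals.

(** * A continuity theorem of Lévy type *)
Lemma uniform_continuity_box (R : realType) (f : R * R -> R) (K e : R) :
  continuous f -> 0 < e ->
  exists2 r, 0 < r & forall x y : R * R, `|x.1| <= K -> `|x.2| <= K ->
    `|x.1 - y.1| < r -> `|x.2 - y.2| < r -> `|f x - f y| < e.
Proof.
move=> cf e0; have e20 : 0 < e / 2 by rewrite divr_gt0.
have cK : compact (`[- K, K]%classic `*` `[- K, K]%classic : set (R * R)).
  by apply: compact_setX; exact: segment_compact.
pose U (r : R) (x : R * R) :=
  forall y : R * R, `|x.1 - y.1| < r -> `|x.2 - y.2| < r -> `|f x - f y| < e.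
have cov : \forall r \near (0 : R)^'+, `[- K, K]%classic `*` `[- K, K]%classic `<=` U r.
  have /compact_near_coveringP := cK; apply=> x _.
  have /cvgrPdist_lt/(_ _ e20)/nbhs_ballP[s /= s0 hs] := cf x.
  have s20 : 0 < s / 2 by rewrite divr_gt0.
  exists (ball x (s / 2), [set r | r < s / 2]).
    by split => /=; [exact: nbhsx_ballx|exact: nbhs_right_lt].
  move=> [x' r] /= [[xx1 xx2] rs] y y1 y2.
  have bx : ball x s x'.
    by split; rewrite /ball/= (lt_trans xx1, lt_trans xx2)//; lra.
  have by' : ball x s y.
    split; rewrite /ball/=.
      rewrite (_ : x.1 - y.1 = (x.1 - x'.1) + (x'.1 - y.1)); last by ring.
      by rewrite (le_lt_trans (ler_normD _ _))//; move: xx1; rewrite /ball/=; lra.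
    rewrite (_ : x.2 - y.2 = (x.2 - x'.2) + (x'.2 - y.2)); last by ring.
    by rewrite (le_lt_trans (ler_normD _ _))//; move: xx2; rewrite /ball/=; lra.
  have h1 := hs _ bx; have h2 := hs _ by'.
  rewrite (_ : f x' - f y = (f x - f y) - (f x - f x')); last by ring.
  by rewrite (le_lt_trans (ler_normB _ _))//; move: h1 h2; lra.
near (0 : R)^'+ => r; exists r; first by near: r; exact: nbhs_right_gt.
move=> x y x1 x2; have hr : `[- K, K]%classic `*` `[- K, K]%classic `<=` U r by near: r.
by apply: hr; split; rewrite /= in_itv/= -ler_norml.
Unshelve. all: by end_near. Qed.

Section levy.
Variable R : realType.
Variables (p : nat -> R) (nu nu' : nat -> probability (R * R)%type R).
Hypothesis p01 : forall n, 0 <= p n <= 1.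
Implicit Types f g : R * R -> R.

(** The weight $p_n$ stands for the probability of a conditioning event; weighting
    the difference of the conditional laws by it allows for events whose
    probability vanishes in the limit. *)
Definition gap n f : R := p n * (\int[nu n]_x f x - \int[nu' n]_x f x).

Definition negligible_gap f := [/\ measurable_fun setT f,
  exists c, forall x, `|f x| <= c & gap ^~ f @ \oo --> 0].

Lemma gap_norm_le n f c : measurable_fun setT f -> (forall x, `|f x| <= c) ->
  `|gap n f| <= 2 * c.
Proof.
move=> mf fc; have /andP[p0 p1] := p01 n.
have c0 : 0 <= c by rewrite (le_trans _ (fc point)).
rewrite normrM ger0_norm// (le_trans (ler_wpM2r _ p1))// mul1r.
rewrite (le_trans (ler_normB _ _))// (_ : 2 * c = c + c); last by ring.
by rewrite lerD// Rint_norm_cst.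
Qed.

Lemma gapD n f g c c' : measurable_fun setT f -> (forall x, `|f x| <= c) ->
  measurable_fun setT g -> (forall x, `|g x| <= c') ->
  gap n (fun x => f x + g x) = gap n f + gap n g.
Proof.
move=> mf fc mg gc; rewrite /gap.
have i1 (m : probability (R * R)%type R) := @bounded_integrable _ _ _ m f c mf fc.
have i2 (m : probability (R * R)%type R) := @bounded_integrable _ _ _ m g c' mg gc.
by rewrite (RintegralD measurableT (i1 (nu n)) (i2 (nu n)))
  (RintegralD measurableT (i1 (nu' n)) (i2 (nu' n))); ring.
Qed.

Lemma gapZ n f c (a : R) : measurable_fun setT f -> (forall x, `|f x| <= c) ->
  gap n (fun x => a * f x) = a * gap n f.
Proof.
move=> mf fc; rewrite /gap.
have i1 (m : probability (R * R)%type R) := @bounded_integrable _ _ _ m f c mf fc.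
by rewrite (RintegralZl _ measurableT (i1 (nu n))) (RintegralZl _ measurableT (i1 (nu' n))); ring.
Qed.

Lemma negligible_gap_ext f g : f =1 g -> negligible_gap f -> negligible_gap g.
Proof. by move=> /funext ->. Qed.

Lemma negligible_gapZ (a : R) f : negligible_gap f -> negligible_gap (fun x => a * f x).
Proof.
move=> [mf [c fc] f0]; split; first exact: measurable_funM.
  by exists (`|a| * c) => x; rewrite normrM ler_wpM2l.
rewrite (_ : gap ^~ _ = fun n => a * gap n f); first exact: cvg0Zl.
by apply/funext => n; rewrite (gapZ _ _ mf fc).
Qed.

Lemma negligible_gap_one_sub f : negligible_gap f -> negligible_gap (fun x => 1 - f x).
Proof.
move=> [mf [c fc] f0]; split; first exact: measurable_funB.
  by exists (1 + c) => x; rewrite (le_trans (ler_normB _ _))// normr1 lerD2l.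
rewrite (_ : gap ^~ _ = fun n => -1 * gap n f); first exact: cvg0Zl.
apply/funext => n; rewrite /gap.
have i1 (m : probability (R * R)%type R) := @bounded_integrable _ _ _ m f c mf fc.
rewrite (RintegralB measurableT (integrable_real_cst (nu n) 1) (i1 (nu n))).
rewrite (RintegralB measurableT (integrable_real_cst (nu' n) 1) (i1 (nu' n))).
by rewrite !Rint_cst; ring.
Qed.

Lemma measurable_swapped d (Y : measurableType d) d' (S : measurableType d') (F : Y -> S -> R) :
  measurable_fun setT (fun z : Y * S => F z.1 z.2) ->
  measurable_fun setT (fun z : S * Y => F z.2 z.1).
Proof.
move=> mF.
have := measurableT_comp mF (@measurable_swap _ _ S Y).
by [].
Qed.

(** The class of test functions with a negligible gap is closed under averaging
    of its parameters. *)
Lemma negligible_gap_mix d (Y : measurableType d) (m : probability Y R)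
    (F : Y -> R * R -> R) (c : R) :
  measurable_fun setT (fun z : Y * (R * R) => F z.1 z.2) ->
  (forall y x, `|F y x| <= c) -> (forall y, negligible_gap (F y)) ->
  negligible_gap (fun x => \int[m]_y F y x).
Proof.
move=> mF Fc Fgood.
have mF' := measurable_swapped mF.
have mFy y : measurable_fun setT (F y) by have [] := Fgood y.
have mFx x : measurable_fun setT (F ^~ x).
  exact: (measurableT_comp mF (pair2_measurable x)).
split.
- exact: (@measurable_Rintegral_snd _ _ _ _ R m (fun x y => F y x) c mF').
- by exists c => x; apply: Rint_norm_cst.
have mI (q : probability (R * R)%type R) :
    measurable_fun setT (fun y => \int[q]_x F y x).
  exact: (@measurable_Rintegral_snd _ _ _ _ R q F c mF).
have bI (q : probability (R * R)%type R) y : `|\int[q]_x F y x| <= c.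
  exact: Rint_norm_cst.
have iI (q : probability (R * R)%type R) := @bounded_integrable _ _ _ m _ c (mI q) (bI q).
have gapE n : gap n (fun x => \int[m]_y F y x) = \int[m]_y gap n (F y).
  rewrite /gap RintegralZl//; last exact: integrable_realB.
  rewrite RintegralB//; congr (_ * (_ - _)).
    by rewrite (@Rintegral_Fubini _ _ _ _ _ m (nu n) F c).
  by rewrite (@Rintegral_Fubini _ _ _ _ _ m (nu' n) F c).
rewrite (_ : gap ^~ _ = fun n => \int[m]_y gap n (F y)); last first.
  by apply/funext => n; rewrite gapE.
rewrite -[X in _ --> X](Rint_cst m 0).
apply: (@Rint_dominated_cvg _ _ _ m _ (fun=> 0) (fun=> 2 * c)) => //.
- by move=> n; apply: measurable_funM => //; exact: measurable_funB.
- by move=> y; have [] := Fgood y.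
- exact: integrable_real_cst.
- by move=> n y; exact: gap_norm_le.
Qed.

Hypothesis trig : forall s t phi : R,
  gap ^~ (fun x => cos (s * x.1 + t * x.2 + phi)) @ \oo --> 0.

Lemma measurable_pdf2 d (T : measurableType d) (s : R) (f g : T -> R) : s != 0 ->
  measurable_fun setT f -> measurable_fun setT g ->
  measurable_fun setT (fun w => normal_pdf (f w) s (g w)).
Proof.
move=> s0 mf mg.
rewrite (_ : (fun _ => _) = fun w => normal_peak s * expR (- (g w - f w) ^+ 2 / (s ^+ 2 *+ 2))).
  apply: measurable_funM => //; apply: measurableT_comp => //; apply: measurable_funM => //.
  apply: measurableT_comp => //; apply: measurable_funX; exact: measurable_funB.
by apply/funext => w; rewrite normal_pdfE.
Qed.

Lemma measurable_fst_R : measurable_fun setT (fun x : R * R => x.1).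
Proof. exact: measurable_fst. Qed.

Lemma measurable_snd_R : measurable_fun setT (fun x : R * R => x.2).
Proof. exact: measurable_snd. Qed.

(** A Gaussian bump is an average of cosines. *)
Lemma negligible_gap_bump (s y1 y2 : R) : 0 < s ->
  negligible_gap (fun x => normal_pdf x.1 s y1 * normal_pdf x.2 s y2).
Proof.
move=> s0; pose b := s ^- 2; have b0 : 0 <= b by rewrite invr_ge0 sqr_ge0.
pose N := gauss_law (0 : R) b.
pose e (u : R) := expR (- (u ^+ 2 * b) / 2).
have pdfE x y : normal_pdf x s y = normal_peak s * e (x - y).
  rewrite normal_pdfE ?gt_eqF// /normal_fun /e; congr (_ * expR _).
  by rewrite /b; field; rewrite gt_eqF.
have e01 u : 0 <= e u <= 1.
  by rewrite expR_ge0 expR_le1 mulNr oppr_le0 divr_ge0// mulr_ge0// sqr_ge0.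
have me d (T : measurableType d) (f : T -> R) : measurable_fun setT f ->
    measurable_fun setT (fun w => e (f w)).
  move=> mf; rewrite (_ : (fun _ => _) = fun w => expR ((- b / 2) * f w ^+ 2)).
    by apply: measurableT_comp => //; apply: measurable_funM => //; exact: measurable_funX.
  by apply/funext => w; rewrite /e; congr expR; ring.
have inner (sg : R) : negligible_gap (fun x => e (x.2 - y2) * cos ((x.1 - y1) * sg + 0)).
  apply: (@negligible_gap_ext (fun x => \int[N]_t cos ((x.2 - y2) * t + (x.1 - y1) * sg))).
    by move=> x; rewrite gauss_law_cos// addr0.
  apply: (@negligible_gap_mix _ R N (fun t x => cos ((x.2 - y2) * t + (x.1 - y1) * sg)) 1).
  - apply: (measurableT_comp (@measurable_cos R)); apply: measurable_funD.
      apply: measurable_funM; last exact: measurable_fst.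
      apply: measurable_funB => //; exact: measurableT_comp measurable_snd_R measurable_snd.
    apply: measurable_funM => //; apply: measurable_funB => //.
    exact: measurableT_comp measurable_fst_R measurable_snd.
  - by move=> t x; exact: cos_max.
  - move=> t; split; last 2 first.
    + by exists 1 => x; exact: cos_max.
    + have := trig sg t (- (y2 * t) - y1 * sg); apply: cvg_trans.
      apply: near_eq_cvg; apply: nearW => n; rewrite /gap.
      by congr (_ * (_ - _)); apply: eq_Rintegral => x _; congr cos; ring.
    apply: (measurableT_comp (@measurable_cos R)); apply: measurable_funD.
      by apply: measurable_funM => //; apply: measurable_funB => //; exact: measurable_snd_R.
    by apply: measurable_funM => //; apply: measurable_funB => //; exact: measurable_fst_R.
apply: (@negligible_gap_ext (fun x => normal_peak s ^+ 2 *
  \int[N]_sg (e (x.2 - y2) * cos ((x.1 - y1) * sg + 0)))).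
  move=> x; rewrite !pdfE RintegralZl//; last first.
    apply: (@bounded_integrable _ R R N _ 1); first exact: measurable_affine_cos.
    by move=> sg; exact: cos_max.
  by rewrite gauss_law_cos// cos0 /e; ring.
apply: negligible_gapZ.
apply: (@negligible_gap_mix _ R N (fun sg x => e (x.2 - y2) * cos ((x.1 - y1) * sg + 0)) 1) => //.
- apply: measurable_funM.
    apply: me; apply: measurable_funB => //.
    exact: measurableT_comp measurable_snd_R measurable_snd.
  apply: (measurableT_comp (@measurable_cos R)); apply: measurable_funD => //.
  apply: measurable_funM; last exact: measurable_fst.
  apply: measurable_funB => //; exact: measurableT_comp measurable_fst_R measurable_snd.
- move=> t x; rewrite normrM mulr_ile1 ?cos_max//.
  by have /andP[h1 h2] := e01 (x.2 - y2); rewrite ger0_norm.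
Qed.

End levy.

Section levy.
Variable R : realType.
Variables (p : nat -> R) (nu nu' : nat -> probability (R * R)%type R).
Hypothesis p01 : forall n, 0 <= p n <= 1.
Implicit Types f g : R * R -> R.
Hypothesis trig : forall s t phi : R,
  gap p nu nu' ^~ (fun x => cos (s * x.1 + t * x.2 + phi)) @ \oo --> 0.

Definition mollify (b : R) g (x : R * R) : R :=
  \int[gauss_law x.1 b]_y1 \int[gauss_law x.2 b]_y2 g (y1, y2).

Section mollify.
Variables (g : R * R -> R) (K c b : R).
Hypotheses (b0 : 0 < b) (mg : measurable_fun setT g) (gc : forall x, `|g x| <= c).
Hypothesis gK : forall x, K < `|x.1| \/ K < `|x.2| -> g x = 0.

Let s := Num.sqrt b.
Let s0 : 0 < s. Proof. by rewrite sqrtr_gt0. Qed.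
Let q (y : R) := normal_pdf (0 : R) 1 y.
Let c0 : 0 <= c. Proof. by rewrite (le_trans _ (gc point)). Qed.

Let q_gt0 y : 0 < q y.
Proof.
by rewrite /q normal_pdfE ?oner_eq0// mulr_gt0 ?expR_gt0// normal_peak_gt0 ?oner_eq0.
Qed.

Let q_ge y : `|y| <= K -> q K <= q y.
Proof.
move=> yK; rewrite /q !normal_pdfE ?oner_eq0// ler_wpM2l ?normal_peak_ge0//.
rewrite /normal_fun !subr0 ler_expR ler_wpM2r ?invr_ge0 ?mulrn_wge0 ?sqr_ge0//.
by rewrite lerN2 (sqr_normE y) !expr2 ler_pM.
Qed.

Let w (y1 y2 : R) := g (y1, y2) / q y1 / q y2.

Let w_le y1 y2 : `|w y1 y2| <= c / q K / q K.
Proof.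
rewrite /w; have [y1K|y1K] := ltP K `|y1|.
  by rewrite gK; [rewrite !mul0r normr0 !divr_ge0// ltW|left].
have [y2K|y2K] := ltP K `|y2|.
  by rewrite gK; [rewrite !mul0r normr0 !divr_ge0// ltW|right].
have h y : `|y| <= K -> `|(q y)^-1| <= (q K)^-1.
  by move=> yK; rewrite gtr0_norm ?invr_gt0// lef_pV2 ?posrE// q_ge.
by rewrite !normrM !ler_pM ?h.
Qed.

Let measurable_slice y1 : measurable_fun setT (fun y2 => g (y1, y2)).
Proof. exact: (measurableT_comp mg (pair1_measurable y1)). Qed.

Let mq d (T : measurableType d) (f : T -> R) : measurable_fun setT f ->
  measurable_fun setT (fun z => (q (f z))^-1).
Proof.
move=> mf; apply: ge0_measurable_inv => [z|]; first exact: normal_pdf_ge0.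
by apply: measurable_pdf2 => //; exact: oner_neq0.
Qed.

Let measurable_w d (T : measurableType d) (f1 f2 : T -> R) :
  measurable_fun setT f1 -> measurable_fun setT f2 ->
  measurable_fun setT (fun z => w (f1 z) (f2 z)).
Proof.
move=> m1 m2; apply: measurable_funM; last exact: mq.
apply: measurable_funM; last exact: mq.
by apply: (measurableT_comp mg); exact: measurable_fun_pair.
Qed.

Let pdf_le (x y : R) : `|normal_pdf x s y| <= normal_peak s.
Proof. by rewrite ger0_norm ?normal_pdf_ge0// normal_pdf_ub// gt_eqF. Qed.

Let measurable_bump d (T : measurableType d) (x : T -> R * R) (f1 f2 : T -> R) :
  measurable_fun setT x -> measurable_fun setT f1 -> measurable_fun setT f2 ->
  measurable_fun setT (fun z => normal_pdf (x z).1 s (f1 z) * normal_pdf (x z).2 s (f2 z)).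
Proof.
move=> mx m1 m2.
have mx1 : measurable_fun setT (fun z => (x z).1) by exact: (measurableT_comp (@measurable_fst_R R) mx).
have mx2 : measurable_fun setT (fun z => (x z).2) by exact: (measurableT_comp (@measurable_snd_R R) mx).
by apply: measurable_funM; apply: measurable_pdf2; rewrite ?gt_eqF.
Qed.

Let B : R := c / q K / q K * (normal_peak s * normal_peak s).

Let F (y1 y2 : R) (x : R * R) :=
  w y1 y2 * (normal_pdf x.1 s y1 * normal_pdf x.2 s y2).

Let F_le y1 y2 x : `|F y1 y2 x| <= B.
Proof. by rewrite normrM ler_pM// normrM ler_pM. Qed.

Let N1 := gauss_law (0 : R) 1.

Let mollifyE x : mollify b g x = \int[N1]_y1 \int[N1]_y2 F y1 y2 x.
Proof.
have sl1 y1 y2 : `|g (y1, y2)| <= c by exact: gc.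
have mG : measurable_fun setT (fun y1 => \int[gauss_law x.2 b]_y2 g (y1, y2)).
  apply: (@measurable_Rintegral_snd _ _ R R R (gauss_law x.2 b) (fun y1 y2 => g (y1, y2)) c) => //.
  by rewrite (_ : (fun _ => _) = g)//; apply/funext => -[].
have Gc y1 : `|\int[gauss_law x.2 b]_y2 g (y1, y2)| <= c.
  by apply: Rint_norm_cst => // y2; exact: gc.
rewrite /mollify (@gauss_law_change _ x.1 b _ K c b0 mG Gc); last first.
  move=> y1 y1K; rewrite -(Rint_cst (gauss_law x.2 b) 0); apply: eq_Rintegral => y2 _.
  by rewrite gK//; left.
apply: eq_Rintegral => y1 _.
rewrite (@gauss_law_change _ x.2 b _ K c b0 (measurable_slice y1) (sl1 y1)); last first.
  by move=> y2 y2K; rewrite gK//; right.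
rewrite mulrAC -mulrA mulrC -RintegralZl//; last first.
  apply: (@bounded_integrable _ R R N1 _ (c / q K * normal_peak s)).
    apply: measurable_funM; last by apply: measurable_pdf2; rewrite ?gt_eqF.
    by apply: measurable_funM => //; exact: mq.
  move=> y2; rewrite normrM ler_pM//.
  have [y2K|y2K] := ltP K `|y2|.
    by rewrite gK; [rewrite !mul0r normr0 !divr_ge0// ltW|right].
  by rewrite normrM ler_pM// gtr0_norm ?invr_gt0// lef_pV2 ?posrE// q_ge.
apply: eq_Rintegral => y2 _; rewrite /F /w /q; field.
by rewrite !gt_eqF ?(q_gt0 _).
Qed.

Lemma negligible_gap_mollify : negligible_gap p nu nu' (mollify b g).
Proof.
apply: (@negligible_gap_ext _ p nu nu' (fun x => \int[N1]_y1 \int[N1]_y2 F y1 y2 x)).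
  by move=> x; rewrite mollifyE.
have mF3 : measurable_fun setT (fun z : (R * (R * R)) * R => F z.1.1 z.2 z.1.2).
  apply: measurable_funM.
    by apply: measurable_w => /=; [exact: (measurableT_comp measurable_fst measurable_fst)|exact: measurable_snd].
  apply: measurable_bump; [exact: measurableT_comp measurable_snd measurable_fst|
    exact: measurableT_comp measurable_fst measurable_fst|exact: measurable_snd].
apply: (@negligible_gap_mix R p nu nu' p01 _ R N1 (fun y1 x => \int[N1]_y2 F y1 y2 x) B).
- exact: (@measurable_Rintegral_snd _ _ (R * (R * R))%type R R
    N1 (fun z y2 => F z.1 y2 z.2) B mF3).
- move=> y1 x; apply: Rint_norm_cst => //.
  apply: measurable_funM; first exact: measurable_w.
  exact: (@measurable_bump _ _ (cst x)).
move=> y1; apply: (@negligible_gap_mix R p nu nu' p01 _ R N1 (fun y2 x => F y1 y2 x) B).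
- apply: measurable_funM.
    by apply: measurable_w => //; exact: measurable_fst.
  by apply: measurable_bump.
- by move=> y2 x; exact: F_le.
- move=> y2; apply: negligible_gapZ; exact: negligible_gap_bump.
Qed.

(** Chebyshev's inequality in each coordinate. *)
Lemma mollify_dist (r e : R) : 0 < r -> 0 <= e ->
  (forall x y : R * R, `|x.1 - y.1| < r -> `|x.2 - y.2| < r -> `|g x - g y| <= e) ->
  forall x, `|mollify b g x - g x| <= e + 4 * c * (b / r ^+ 2).
Proof.
move=> r0 e0 gu x.
pose h (z y : R) : R := Num.min ((y - z) ^+ 2 / r ^+ 2) 1.
have h0 z y : 0 <= h z y by rewrite le_min ler01 divr_ge0 ?sqr_ge0.
have h1 z y : `|h z y| <= 1 by rewrite ger0_norm// ge_min lexx orbT.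
have mh z : measurable_fun setT (h z).
  apply: measurable_minr => //; apply: measurable_funM => //.
  by apply: measurable_funX; exact: measurable_funB.
have h_far z y : r <= `|z - y| -> h z y = 1.
  move=> zy; apply/min_idPr; rewrite ler_pdivlMr ?exprn_gt0// mul1r.
  by rewrite (sqr_normE (y - z)) distrC !expr2 ler_pM// ltW.
have pw y1 y2 : `|g (y1, y2) - g x| <= e + 2 * c * (h x.1 y1 + h x.2 y2).
  have far : 1 <= h x.1 y1 + h x.2 y2 -> `|g (y1, y2) - g x| <= e + 2 * c * (h x.1 y1 + h x.2 y2).
    move=> H; apply: (@le_trans _ _ (e + 2 * c * 1)); last first.
      by rewrite lerD2l ler_wpM2l// mulr_ge0.
    rewrite (le_trans (ler_normB _ _))// (le_trans (lerD (gc _) (gc _)))//; lra.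
  have [y1r|y1r] := leP r `|x.1 - y1|.
    by apply: far; rewrite h_far// lerDl.
  have [y2r|y2r] := leP r `|x.2 - y2|.
    by apply: far; rewrite (h_far x.2)// lerDr.
  rewrite distrC (le_trans (gu x (y1, y2) y1r y2r))// lerDl mulr_ge0 ?addr_ge0//.
  by rewrite mulr_ge0.
have spread z : \int[gauss_law z b]_y h z y <= b / r ^+ 2 by exact: gauss_law_spread.
have ih z z' : (gauss_law z' b).-integrable setT (EFin \o h z).
  exact: (@bounded_integrable _ _ _ _ _ 1).
have islice y1 : (gauss_law x.2 b).-integrable setT (EFin \o (fun y2 => g (y1, y2))).
  exact: (@bounded_integrable _ _ _ _ _ c).
have mG : measurable_fun setT (fun y1 => \int[gauss_law x.2 b]_y2 g (y1, y2)).
  apply: (@measurable_Rintegral_snd _ _ R R R (gauss_law x.2 b) (fun y1 y2 => g (y1, y2)) c) => //.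
  by rewrite (_ : (fun _ => _) = g)//; apply/funext => -[].
have Gc y1 : `|\int[gauss_law x.2 b]_y2 g (y1, y2)| <= c.
  by apply: Rint_norm_cst => // y2; exact: gc.
have iG : (gauss_law x.1 b).-integrable setT (EFin \o (fun y1 => \int[gauss_law x.2 b]_y2 g (y1, y2))).
  exact: (@bounded_integrable _ _ _ _ _ c).
have inner y1 : `|\int[gauss_law x.2 b]_y2 g (y1, y2) - g x| <=
    (e + 2 * c * (b / r ^+ 2)) + 2 * c * h x.1 y1.
  rewrite -[g x](Rint_cst (gauss_law x.2 b)) -(RintegralB measurableT (islice y1) (integrable_real_cst _ _)).
  apply: (@le_trans _ _ (\int[gauss_law x.2 b]_y2 ((e + 2 * c * h x.1 y1) + 2 * c * h x.2 y2))).
    apply: Rint_norm_le.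
    - by apply: integrable_realB => //; exact: integrable_real_cst.
    - apply: integrable_realD; first exact: integrable_real_cst.
      exact: (integrable_realZ (2 * c) (ih x.2 x.2)).
    - by move=> y2; rewrite (le_trans (pw y1 y2))//; lra.
  rewrite RintegralD//; last 2 first.
  - exact: integrable_real_cst.
  - exact: (integrable_realZ (2 * c) (ih x.2 x.2)).
  rewrite Rint_cst RintegralZl//; last exact: ih.
  have : 2 * c * \int[gauss_law x.2 b]_x0 h x.2 x0 <= 2 * c * (b / r ^+ 2).
    by rewrite ler_wpM2l ?mulr_ge0.
  lra.
have -> : mollify b g x - g x =
    \int[gauss_law x.1 b]_y1 (\int[gauss_law x.2 b]_y2 g (y1, y2) - g x).
  by rewrite (RintegralB measurableT iG (integrable_real_cst _ _)) Rint_cst.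
apply: (@le_trans _ _ (\int[gauss_law x.1 b]_y1 ((e + 2 * c * (b / r ^+ 2)) + 2 * c * h x.1 y1))).
  apply: Rint_norm_le => //.
  - by apply: integrable_realB => //; exact: integrable_real_cst.
  - apply: integrable_realD; first exact: integrable_real_cst.
    exact: (integrable_realZ (2 * c) (ih x.1 x.1)).
rewrite RintegralD//; last 2 first.
- exact: integrable_real_cst.
- exact: (integrable_realZ (2 * c) (ih x.1 x.1)).
rewrite Rint_cst RintegralZl//; last exact: ih.
have : 2 * c * \int[gauss_law x.1 b]_x0 h x.1 x0 <= 2 * c * (b / r ^+ 2).
  by rewrite ler_wpM2l ?mulr_ge0.
lra.
Qed.

End mollify.

End levy.

Section cutoff.
Variable R : realType.

Definition clamp (u : R) : R := Num.max 0 (Num.min 1 u).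

Lemma clamp_ge0 u : 0 <= clamp u. Proof. by rewrite le_max lexx. Qed.

Lemma clamp_le1 u : clamp u <= 1.
Proof. by rewrite ge_max ler01 ge_min lexx. Qed.

Lemma clamp1 u : 1 <= u -> clamp u = 1.
Proof. by move=> u1; rewrite /clamp (min_idPl u1); apply/max_idPr. Qed.

Lemma clamp0 u : u <= 0 -> clamp u = 0.
Proof. by move=> u0; apply/max_idPl; rewrite ge_min u0 orbT. Qed.

Definition cutoff (K : R) (x : R * R) := clamp (2 - `|x.1| / K) * clamp (2 - `|x.2| / K).

Lemma continuous_cutoff K : continuous (cutoff K).
Proof.
have cc (h : R * R -> R) : continuous h -> continuous (fun x => clamp (2 - `|h x| / K)).
  move=> ch x.
  have c1 : {for x, continuous (fun x => 2 - `|h x| / K : R^o)}.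
    apply: (@cvgB _ R^o); first exact: cvg_cst.
    by apply: (@cvgM R); [apply: (@cvg_norm _ R^o); exact: ch|exact: cvg_cst].
  have c2 : {for x, continuous (fun x => Num.min 1 (2 - `|h x| / K) : R^o)}.
    exact: (@continuous_min R _ (fun=> 1) _ x (cvg_cst _) c1).
  exact: (@continuous_max R _ (fun=> 0) _ x (cvg_cst _) c2).
move=> x; apply: cvgM; apply: cc => z.
  exact: (@cvg_fst _ _ (nbhs z.1) (nbhs z.2)).
exact: (@cvg_snd _ _ (nbhs z.1) (nbhs z.2)).
Qed.

Lemma cutoff_ge0 K x : 0 <= cutoff K x.
Proof. by rewrite mulr_ge0 ?clamp_ge0. Qed.

Lemma cutoff_le1 K x : cutoff K x <= 1.
Proof. by rewrite mulr_ile1 ?clamp_ge0 ?clamp_le1. Qed.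

Lemma cutoff_far (K : R) x : 0 < K -> 2 * K < `|x.1| \/ 2 * K < `|x.2| -> cutoff K x = 0.
Proof.
move=> K0 [h|h]; rewrite /cutoff.
  by rewrite clamp0 ?mul0r// subr_le0 ler_pdivlMr// ltW.
by rewrite [X in _ * X]clamp0 ?mulr0// subr_le0 ler_pdivlMr// ltW.
Qed.

Lemma cutoff_near (K : R) x : 0 < K -> `|x.1| <= K -> `|x.2| <= K -> cutoff K x = 1.
Proof.
move=> K0 h1 h2.
have h (u : R) : `|u| <= K -> clamp (2 - `|u| / K) = 1.
  move=> uK; apply: clamp1; have : `|u| / K <= 1 by rewrite ler_pdivrMr// mul1r.
  lra.
by rewrite /cutoff !h// mulr1.
Qed.

(** One minus a Gaussian bump at the origin, normalized there: it detects the
    mass far from the origin, and its gap is negligible. *)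
Definition escape (K : R) (x : R * R) : R :=
  1 - (normal_peak K ^- 2) * (normal_pdf x.1 K 0 * normal_pdf x.2 K 0).

Lemma escapeE (K : R) x : 0 < K ->
  escape K x = 1 - expR (- (x.1 ^+ 2 / (K ^+ 2 *+ 2) + x.2 ^+ 2 / (K ^+ 2 *+ 2))).
Proof.
move=> K0; have p0 : normal_peak K != 0 by rewrite gt_eqF// normal_peak_gt0// gt_eqF.
rewrite /escape !normal_pdfE ?gt_eqF// /normal_fun opprD expRD !sub0r !sqrrN !mulNr.
by congr (1 - _); field.
Qed.

Lemma escape_ge0 (K : R) x : 0 < K -> 0 <= escape K x.
Proof.
move=> K0; rewrite escapeE// subr_ge0 expR_le1 oppr_le0 addr_ge0// divr_ge0 ?sqr_ge0//;
  by rewrite mulrn_wge0 ?sqr_ge0.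
Qed.

Lemma escape_le1 (K : R) x : 0 < K -> escape K x <= 1.
Proof. by move=> K0; rewrite escapeE// gerBl expR_ge0. Qed.

Lemma cutoff_escape (K : R) x : 0 < K -> 1 - cutoff K x <= 3 * escape K x.
Proof.
move=> K0; have e0 := escape_ge0 x K0.
have K20 : 0 < K ^+ 2 *+ 2 by rewrite pmulrn_lgt0// exprn_gt0.
have far (a b : R) : K < `|a| -> 1 / 3 <= 1 - expR (- (a ^+ 2 / (K ^+ 2 *+ 2) + b ^+ 2 / (K ^+ 2 *+ 2))).
  move=> aK; set z := a ^+ 2 / (K ^+ 2 *+ 2) + b ^+ 2 / (K ^+ 2 *+ 2).
  have z1 : 1 / 2 <= z.
    have : 1 / 2 <= a ^+ 2 / (K ^+ 2 *+ 2).
      rewrite ler_pdivlMr// (_ : 1 / 2 * _ = K ^+ 2); last by rewrite -mulr_natr; field.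
      by rewrite (sqr_normE a) !expr2 ler_pM// ltW.
    have : 0 <= b ^+ 2 / (K ^+ 2 *+ 2) by rewrite divr_ge0 ?sqr_ge0// ltW.
    by rewrite /z; lra.
  have h1 := expR_ge1Dx z; have h2 : expR z * expR (- z) = 1 by rewrite -expRD subrr expR0.
  have h3 := expR_gt0 (- z).
  by nra.
have [x1|x1] := leP `|x.1| K; last first.
  have := far _ x.2 x1; rewrite -escapeE//; have := cutoff_ge0 K x; lra.
have [x2|x2] := leP `|x.2| K; last first.
  have := far _ x.1 x2; rewrite (addrC (x.2 ^+ 2 / _)) -escapeE//; have := cutoff_ge0 K x; lra.
by rewrite cutoff_near// subrr mulr_ge0.
Qed.

Lemma escape_cvg0 x : escape n.+1%:R x @[n --> \oo] --> 0.
Proof.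
apply: (@squeeze0 _ _ (fun n => ((x.1 ^+ 2 + x.2 ^+ 2) / 2) * harmonic n)); last first.
  by apply: cvg0Zl; exact: cvg_harmonic.
apply: nearW => n; rewrite ger0_norm ?escape_ge0// escapeE//.
have := expR_ge1Dx (- (x.1 ^+ 2 / (n.+1%:R ^+ 2 *+ 2) + x.2 ^+ 2 / (n.+1%:R ^+ 2 *+ 2))).
have -> : x.1 ^+ 2 / (n.+1%:R ^+ 2 *+ 2) + x.2 ^+ 2 / (n.+1%:R ^+ 2 *+ 2) =
    (x.1 ^+ 2 + x.2 ^+ 2) / 2 * n.+1%:R^-1 * n.+1%:R^-1 by field.
have : (x.1 ^+ 2 + x.2 ^+ 2) / 2 * n.+1%:R^-1 * n.+1%:R^-1 <= (x.1 ^+ 2 + x.2 ^+ 2) / 2 * n.+1%:R^-1.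
  rewrite ler_piMr// ?mulr_ge0 ?addr_ge0 ?sqr_ge0//.
  by rewrite invf_le1// ler1n.
rewrite /harmonic/=.
by move: (_ / n.+1%:R / n.+1%:R) => u; move: (_ / n.+1%:R) => v; lra.
Qed.

Lemma measurable_escape (K : R) : 0 < K -> measurable_fun setT (escape K).
Proof.
move=> K0; apply: measurable_funB => //; apply: measurable_funM => //.
by apply: measurable_funM; apply: measurable_pdf2; rewrite ?gt_eqF.
Qed.

End cutoff.

Section levy.
Variable R : realType.
Variables (p : nat -> R) (nu nu' : nat -> probability (R * R)%type R).
Variable mu : probability (R * R)%type R.
Hypothesis p01 : forall n, 0 <= p n <= 1.
Hypothesis dominated : forall n (g : R * R -> R), measurable_fun setT g ->
  (forall x, 0 <= g x <= 1) -> p n * \int[nu' n]_x g x <= \int[mu]_x g x.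
Hypothesis trig : forall s t phi : R,
  gap p nu nu' ^~ (fun x => cos (s * x.1 + t * x.2 + phi)) @ \oo --> 0.

(** Cosines yield Gaussian bumps, and bumps yield mollified functions of compact
    support. The domination of the second sequence makes it tight, and the bump
    at the origin transfers the tightness to the first one. *)
Theorem levy_continuity (f : R * R -> R) (c : R) : continuous f ->
  (forall x, `|f x| <= c) -> gap p nu nu' ^~ f @ \oo --> 0.
Proof.
move=> cf fc.
have c0 : 0 <= c by rewrite (le_trans _ (fc point)).
have mf : measurable_fun setT f by exact: continuous_measurable_borel.
have tau_cvg : \int[mu]_x escape n.+1%:R x @[n --> \oo] --> 0.
  rewrite -[X in _ --> X](Rint_cst mu 0).
  apply: (@Rint_dominated_cvg _ _ _ mu _ _ (fun=> 1)) => //.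
  - by move=> n; exact: measurable_escape.
  - by move=> x; exact: escape_cvg0.
  - exact: integrable_real_cst.
  - by move=> n x; rewrite ger0_norm ?escape_ge0// escape_le1.
apply: cvg0_eps => e e0.
have c60 : 0 < 6 * c + 1 by rewrite ltr_wpDl// mulr_ge0.
have [k ek] : exists k : nat, 6 * c * \int[mu]_x escape k.+1%:R x <= e / 2.
  have /cvgrPdist_lt/(_ (e / 2 / (6 * c + 1))) := tau_cvg.
  move=> /(_ (divr_gt0 (divr_gt0 e0 (ltr0n _ 2)) c60)) [k _ /(_ k (leqnn k))] /=.
  rewrite sub0r normrN => /(le_lt_trans (ler_norm _)); rewrite ltr_pdivlMr// => h.
  exists k; have : 0 <= \int[mu]_x escape k.+1%:R x.
    by apply: Rintegral_ge0 => x _; exact: escape_ge0.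
  by move: h; set I := Rintegral _ _ _; nra.
pose K : R := k.+1%:R; have K0 : 0 < K by [].
pose tau := escape K; pose chi := cutoff K.
pose g x := f x * chi x.
have mtau : measurable_fun setT tau by exact: measurable_escape.
have mchi : measurable_fun setT chi.
  by apply: continuous_measurable_borel; exact: continuous_cutoff.
have cg : continuous g.
  by move=> x; apply: cvgM; [exact: cf|exact: continuous_cutoff].
have mg : measurable_fun setT g by exact: measurable_funM.
have gc x : `|g x| <= c.
  by rewrite normrM -[leRHS]mulr1 ler_pM// ger0_norm ?cutoff_ge0 ?cutoff_le1.
have gK (x : R * R) : 2 * K < `|x.1| \/ 2 * K < `|x.2| -> g x = 0.
  by move=> xK; rewrite /g /chi cutoff_far// mulr0.
pose eta := e / 16; have eta0 : 0 < eta by rewrite divr_gt0.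
have [r r0 unif] := uniform_continuity_box (2 * K) cg eta0.
have gunif x y : `|x.1 - y.1| < r -> `|x.2 - y.2| < r -> `|g x - g y| <= eta.
  have out (z : R * R) : ~~ ((`|z.1| <= 2 * K) && (`|z.2| <= 2 * K)) -> g z = 0.
    by rewrite negb_and -!ltNge => /orP h; exact: gK.
  have [/andP[x1 x2]|xo] := boolP ((`|x.1| <= 2 * K) && (`|x.2| <= 2 * K)).
    by move=> h1 h2; apply: ltW; exact: unif.
  have [/andP[y1 y2]|yo] := boolP ((`|y.1| <= 2 * K) && (`|y.2| <= 2 * K)).
    by move=> h1 h2; rewrite distrC; apply: ltW; apply: unif; rewrite // distrC.
  by move=> _ _; rewrite (out _ xo) (out _ yo) subrr normr0 ltW.
pose b := eta * r ^+ 2 / (4 * c + 1).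
have c40 : 0 < 4 * c + 1 by rewrite ltr_wpDl// mulr_ge0.
have b0 : 0 < b by rewrite divr_gt0// mulr_gt0// exprn_gt0.
pose ge := mollify b g.
have gedist x : `|ge x - g x| <= 2 * eta.
  apply: le_trans (mollify_dist b0 mg gc r0 (ltW eta0) gunif x) _.
  rewrite (_ : 2 * eta = eta + eta); last by ring.
  rewrite lerD2l /b (_ : _ * _ = eta * (4 * c / (4 * c + 1))); last first.
    by field; rewrite !gt_eqF// exprn_gt0.
  by rewrite ler_piMr ?(ltW eta0)// ler_pdivrMr// mul1r lerDl.
have [mge [cge gec] ge0] := negligible_gap_mollify p01 trig b0 mg gc gK.
have [mt [ct tc] t0] : negligible_gap p nu nu' tau.
  apply: negligible_gap_one_sub; apply: negligible_gapZ.
  exact: negligible_gap_bump.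
exists (fun n => `|gap p nu nu' n ge| + 3 * c * `|gap p nu nu' n tau|).
  by apply: cvg0D; [apply/norm_cvg0P|apply: cvg0Zl; apply/norm_cvg0P].
apply: nearW => n; have /andP[p0 p1] := p01 n.
pose d1 x := g x - ge x; pose d2 x := f x - g x.
have md1 : measurable_fun setT d1 by exact: measurable_funB.
have md2 : measurable_fun setT d2 by exact: measurable_funB.
have d1c x : `|d1 x| <= 2 * eta by rewrite distrC.
have d2c x : `|d2 x| <= 3 * c * tau x.
  rewrite /d2 /g -[f x in X in `|X - _|]mulr1 -mulrBr normrM (mulrC 3) -mulrA ler_pM//.
  by rewrite ger0_norm ?subr_ge0 ?cutoff_le1// cutoff_escape.
have tau01 x : 0 <= tau x <= 1 by rewrite escape_ge0// escape_le1.
have d2c' x : `|d2 x| <= 3 * c.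
  by rewrite (le_trans (d2c x))// ler_piMr ?mulr_ge0//; have /andP[] := tau01 x.
have -> : gap p nu nu' n f = gap p nu nu' n ge + gap p nu nu' n d1 + gap p nu nu' n d2.
  rewrite -(gapD p nu nu' n mge gec md1 d1c).
  have m12 : measurable_fun setT (fun x => ge x + d1 x) by exact: measurable_funD.
  rewrite -(@gapD R p nu nu' n _ _ (cge + 2 * eta) _ m12 _ md2 d2c'); last first.
    by move=> x; rewrite (le_trans (ler_normD _ _))// lerD.
  by rewrite /gap; congr (_ * (_ - _)); apply: eq_Rintegral => x _; rewrite /d1 /d2; ring.
have b1 : `|gap p nu nu' n d1| <= e / 4.
  rewrite (le_trans (gap_norm_le nu nu' p01 n md1 d1c))// /eta; lra.
have itau (q : probability (R * R)%type R) : q.-integrable setT (EFin \o tau).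
  by apply: (@bounded_integrable _ _ _ _ _ 1) => // x; have /andP[? ?] := tau01 x; rewrite ger0_norm.
have b2 : `|gap p nu nu' n d2| <= 3 * c * `|gap p nu nu' n tau| + e / 2.
  have bd (q : probability (R * R)%type R) : `|\int[q]_x d2 x| <= 3 * c * \int[q]_x tau x.
    apply: (@le_trans _ _ (\int[q]_x (3 * c * tau x))).
      apply: Rint_norm_le => //; last exact: (integrable_realZ (3 * c) (itau q)).
      exact: (@bounded_integrable _ _ _ _ _ (3 * c)).
    by rewrite RintegralZl//; exact: itau.
  rewrite normrM ger0_norm//.
  apply: (@le_trans _ _ (p n * (3 * c * \int[nu n]_x tau x + 3 * c * \int[nu' n]_x tau x))).
    by rewrite ler_wpM2l// (le_trans (ler_normB _ _))// lerD.
  rewrite (_ : _ * _ = 3 * c * gap p nu nu' n tau + 6 * c * (p n * \int[nu' n]_x tau x)); last first.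
    by rewrite /gap; ring.
  rewrite lerD//; first by rewrite ler_wpM2l ?mulr_ge0// ler_norm.
  by apply: le_trans ek; rewrite ler_wpM2l ?mulr_ge0// dominated.
rewrite (le_trans (ler_normD _ _))//.
have := ler_normD (gap p nu nu' n ge) (gap p nu nu' n d1); lra.
Qed.

End levy.

(** * Integrals against kernels *)
Section conditional_probability.
Context d (T : measurableType d) (R : realType) (P : probability T R).
Variables (H : set T) (mH : measurable H).

Lemma cond_probE (A : set T) : measurable A ->
  fine (P H) * fine (cond_prob P mH A) = fine (P (A `&` H)).
Proof.
move=> mA; rewrite /cond_prob /= /mnormalize/= /mrestr setTI.
have PHfin : P H \is a fin_num by exact: fin_num_measure.
have [PH0|PH0] /= := eqVneq (P H) 0%E.
  rewrite [P H]PH0 mul0r (_ : P (A `&` H) = 0%E)//.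
  apply/eqP; rewrite -measure_le0 -PH0; apply: le_measure; rewrite ?inE//.
  exact: measurableI.
rewrite ifF; last by apply/negP => /eqP; move: PHfin => /[swap] ->.
rewrite fineM//=; last by apply: fin_num_measure; exact: measurableI.
by rewrite mulrCA divff ?mulr1// fine_eq0.
Qed.

Lemma Rintegral_cond_prob (f : T -> R) (c : R) :
  measurable_fun setT f -> (forall w, `|f w| <= c) ->
  fine (P H) * \int[cond_prob P mH]_w f w = \int[P]_w (\1_H w * f w).
Proof.
move=> mf fc; apply/eqP; rewrite -subr_eq0; apply/eqP; move: f c mf fc.
have iPf (f : T -> R) (c : R) : measurable_fun setT f -> (forall w, `|f w| <= c) ->
    P.-integrable setT (EFin \o (fun w => \1_H w * f w)).
  move=> mf fc; apply: (integrable_boundedM _ (norm_indic_le1 R H)).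
    exact: measurable_indic.
  exact: (@bounded_integrable _ _ _ _ _ c).
have icf (f : T -> R) (c : R) : measurable_fun setT f -> (forall w, `|f w| <= c) ->
    (cond_prob P mH).-integrable setT (EFin \o f).
  by move=> mf fc; exact: (@bounded_integrable _ _ _ _ _ c).
have P0 : 0 <= fine (P H) by rewrite fine_ge0.
have P1 : fine (P H) <= 1.
  by rewrite -(Rint_indic P mH) -(Rint_cst P 1); apply: le_Rint => [||w];
    [exact: integrable_real_indic|exact: integrable_real_cst|
     exact: le_trans (ler_norm _) (norm_indic_le1 R H w)].
apply: (@bounded_functional_eq0 _ T R
  (fun f => fine (P H) * \int[cond_prob P mH]_w f w - \int[P]_w (\1_H w * f w)) 2).
- move=> f A a c mf fc mA.
  have mI : measurable_fun setT (\1_A : T -> R) by exact: measurable_indic.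
  have i1 := icf _ _ mI (norm_indic_le1 R A).
  have i2 := iPf _ _ mI (norm_indic_le1 R A).
  rewrite RintegralD//; last 2 first.
  - exact: icf fc.
  - exact: integrable_realZ.
  rewrite RintegralZl//.
  rewrite (_ : \int[P]_w _ = \int[P]_w (\1_H w * f w) + a * \int[P]_w (\1_H w * \1_A w)).
    by ring.
  rewrite -RintegralZl// -RintegralD//; last 2 first.
  - exact: iPf fc.
  - exact: integrable_realZ.
  by apply: eq_Rintegral => w _; ring.
- move=> f c mf fc; have c0 : 0 <= c by rewrite (le_trans _ (fc point)).
  rewrite (le_trans (ler_normB _ _))// (_ : 2 * c = 1 * c + c); last by ring.
  rewrite lerD//.
    by rewrite normrM ler_pM// ?Rint_norm_cst// ger0_norm.
  apply: Rint_norm_cst; first by apply: measurable_funM => //; exact: measurable_indic.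
  by move=> w; rewrite normrM -[leRHS]mul1r ler_pM ?norm_indic_le1.
- move=> A mA; rewrite Rint_indic// cond_probE//.
  rewrite -Rint_indic; last exact: measurableI.
  apply/eqP; rewrite subr_eq0; apply/eqP; apply: eq_Rintegral => w _.
  by rewrite indicI/= mulrC.
Qed.

End conditional_probability.

Section kernel_integrals.
Context d d' (T : measurableType d) (S : measurableType d') (R : realType).
Variable N : R.-pker T ~> S.

Lemma measurable_Rintegral_kernel (f : S -> R) (c : R) :
  measurable_fun setT f -> (forall x, `|f x| <= c) ->
  measurable_fun setT (fun w => \int[N w]_x f x).
Proof.
move=> mf fc.
have ige (w : T) : (N w).-integrable setT (EFin \o f).
  exact: (@bounded_integrable _ _ _ (kernel_law N w) _ c).
have ic (w : T) : (N w).-integrable setT (EFin \o (fun=> c)).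
  exact: (integrable_real_cst (kernel_law N w)).
rewrite (_ : (fun _ => _) = fun w => fine (\int[N w]_x (f x + c)%:E)%E - c).
  apply: measurable_funB => //; apply: measurableT_comp => //.
  apply: (@measurable_fun_integral_kernel _ _ _ _ _ N (measurable_kernel N)) => //.
  - by move=> x; rewrite lee_fin; have := fc x; rewrite ler_norml; lra.
  - by apply/measurable_EFinP; exact: measurable_funD.
apply/funext => w.
rewrite -[X in _ = X - c]/(\int[N w]_x (f x + c)) RintegralD//.
by rewrite [X in _ + X - c](Rint_cst (kernel_law N w)) addrK.
Qed.

Lemma Rintegral_kernel_norm_le (f : S -> R) (c : R) w :
  measurable_fun setT f -> (forall x, `|f x| <= c) -> `|\int[N w]_x f x| <= c.
Proof. by move=> mf fc; exact: (@Rint_norm_cst _ _ _ (kernel_law N w)). Qed.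

Lemma Rintegral_kernel_mean (P : probability T R) (f : S -> R) (c : R) :
  measurable_fun setT f -> (forall x, `|f x| <= c) ->
  \int[kernel_mean P N]_x f x = \int[P]_w \int[N w]_x f x.
Proof.
move=> mf fc; apply/eqP; rewrite -subr_eq0; apply/eqP; move: f c mf fc.
have iN (f : S -> R) (c : R) w : measurable_fun setT f -> (forall x, `|f x| <= c) ->
    (N w).-integrable setT (EFin \o f).
  by move=> mf fc; exact: (@bounded_integrable _ _ _ (kernel_law N w) _ c).
have iP (f : S -> R) (c : R) : measurable_fun setT f -> (forall x, `|f x| <= c) ->
    P.-integrable setT (EFin \o (fun w => \int[N w]_x f x)).
  move=> mf fc; apply: (@bounded_integrable _ _ _ _ _ c).
    exact: measurable_Rintegral_kernel fc.
  by move=> w; exact: Rintegral_kernel_norm_le.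
have iM (f : S -> R) (c : R) : measurable_fun setT f -> (forall x, `|f x| <= c) ->
    (kernel_mean P N).-integrable setT (EFin \o f).
  by move=> mf fc; exact: (@bounded_integrable _ _ _ _ _ c).
apply: (@bounded_functional_eq0 _ S R
  (fun f => \int[kernel_mean P N]_x f x - \int[P]_w \int[N w]_x f x) 2).
- move=> f A a c mf fc mA.
  have mI : measurable_fun setT (\1_A : S -> R) by exact: measurable_indic.
  have i1 := iM _ _ mI (norm_indic_le1 R A).
  have i2 := iP _ _ mI (norm_indic_le1 R A).
  have i3 w := iN _ _ w mI (norm_indic_le1 R A).
  rewrite RintegralD//; last 2 first.
  - exact: iM fc.
  - exact: integrable_realZ.
  rewrite RintegralZl//.
  rewrite (_ : \int[P]_w _ = \int[P]_w \int[N w]_x f x + a * \int[P]_w \int[N w]_x \1_A x).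
    by rewrite mulrBr opprD addrACA.
  rewrite -RintegralZl// -RintegralD//; last 2 first.
  - exact: iP fc.
  - exact: integrable_realZ.
  apply: eq_Rintegral => w _; rewrite RintegralD//; last 2 first.
  - exact: iN fc.
  - exact: (@integrable_realZ _ _ _ (kernel_law N w) a _ (i3 w)).
  by rewrite RintegralZl.
- move=> f c mf fc.
  rewrite (le_trans (ler_normB _ _))// (_ : 2 * c = c + c); last by ring.
  apply: lerD; first exact: Rint_norm_cst.
  apply: Rint_norm_cst => [|w]; first exact: measurable_Rintegral_kernel fc.
  exact: Rintegral_kernel_norm_le.
- move=> A mA; rewrite Rint_indic//.
  apply/eqP; rewrite subr_eq0; apply/eqP.
  rewrite /kernel_mean /=; congr fine; apply: eq_integral => w _.
  rewrite [X in X%:E](Rint_indic (kernel_law N w) mA) fineK//.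
  exact: (fin_num_measure (kernel_law N w)).
Qed.

End kernel_integrals.

Lemma Rintegral_kernel_prod d d1 d2 (T : measurableType d) (S1 : measurableType d1)
    (S2 : measurableType d2) (R : realType) (M : R.-pker T ~> S1) (N : R.-pker T ~> S2)
    (F : S1 * S2 -> R) (c : R) w :
  measurable_fun setT F -> (forall x, `|F x| <= c) ->
  \int[kernel_prod M N w]_x F x = \int[M w]_x \int[N w]_y F (x, y).
Proof.
move=> mF Fc.
have mF' : measurable_fun setT (fun z : S1 * S2 => (fun x y => F (x, y)) z.1 z.2).
  by rewrite (_ : (fun _ => _) = F)//; apply/funext => -[].
have Fc' x y : `|F (x, y)| <= c by exact: Fc.
have := bounded_integrable_prod (kernel_law M w) (kernel_law N w) mF' Fc' => i.
rewrite /Rintegral; congr fine.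
rewrite (_ : (fun x : S1 * S2 => (F x)%:E) = (fun z => (F (z.1, z.2))%:E)); last first.
  by apply/funext => -[].
rewrite [LHS](_ : _ = \int[kernel_law M w \x kernel_law N w]_z (F (z.1, z.2))%:E)%E//.
rewrite -(integral12_prod_meas1 i); apply: eq_integral => x _.
apply/esym; apply: (@Rint_EFin _ _ _ (kernel_law N w)).
apply: (@bounded_integrable _ _ _ (kernel_law N w) _ c) => //.
exact: (measurableT_comp mF (pair1_measurable x)).
Qed.

Section kernel_convergence.
Context d (T : measurableType d) (R : realType) (P : probability T R).

Lemma Rintegral_kdirac d' (S : measurableType d') (Y : T -> S) (mY : measurable_fun setT Y)
    (f : S -> R) w : measurable_fun setT f ->
  \int[kdirac mY w]_x f x = f (Y w).
Proof.
move=> mf; rewrite /Rintegral integral_dirac//; last exact/measurable_EFinP.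
by rewrite diracT mul1e.
Qed.

Lemma measurable_cos2 (s t phi : R) :
  measurable_fun [set: R * R] (fun x : R * R => cos (s * x.1 + t * x.2 + phi)).
Proof.
apply: (measurableT_comp (@measurable_cos R)); apply: measurable_funD => //.
by apply: measurable_funD; apply: measurable_funM.
Qed.

(** The laws compared are the means of $M_n$ and of $N$ given $A_n$; weighted by
    the probability of $A_n$, the latter are dominated by the mean of $N$. *)
Lemma kernel_pair_cvg (A : nat -> set T) (M : nat -> R.-pker T ~> (R * R)%type)
    (N : R.-pker T ~> (R * R)%type) : (forall n, measurable (A n)) ->
  (forall s t phi : R, \int[P]_w (\1_(A n) w *
      (\int[M n w]_x cos (s * x.1 + t * x.2 + phi) -
       \int[N w]_x cos (s * x.1 + t * x.2 + phi))) @[n --> \oo] --> 0) ->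
  forall (f : R * R -> R) (c : R), continuous f -> (forall x, `|f x| <= c) ->
  \int[P]_w (\1_(A n) w * (\int[M n w]_x f x - \int[N w]_x f x)) @[n --> \oo] --> 0.
Proof.
move=> mA trig f c cf fc.
pose p n := fine (P (A n)).
pose nu n : probability (R * R)%type R := kernel_mean (cond_prob P (mA n)) (M n).
pose nu' n : probability (R * R)%type R := kernel_mean (cond_prob P (mA n)) N.
have halfE n (K : R.-pker T ~> (R * R)%type) (g : R * R -> R) (c' : R) :
    measurable_fun setT g -> (forall x, `|g x| <= c') ->
    p n * \int[kernel_mean (cond_prob P (mA n)) K]_x g x =
    \int[P]_w (\1_(A n) w * \int[K w]_x g x).
  move=> mg gc; rewrite (Rintegral_kernel_mean _ _ mg gc).
  apply: Rintegral_cond_prob; first exact: measurable_Rintegral_kernel gc.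
  by move=> w; exact: Rintegral_kernel_norm_le.
have iA n (K : R.-pker T ~> (R * R)%type) (g : R * R -> R) (c' : R) :
    measurable_fun setT g -> (forall x, `|g x| <= c') ->
    P.-integrable setT (EFin \o (fun w => \1_(A n) w * \int[K w]_x g x)).
  move=> mg gc; apply: (integrable_boundedM _ (norm_indic_le1 R (A n))).
    exact: measurable_indic.
  apply: (@bounded_integrable _ _ _ _ _ c'); first exact: measurable_Rintegral_kernel gc.
  by move=> w; exact: Rintegral_kernel_norm_le.
have gapE n (g : R * R -> R) (c' : R) : measurable_fun setT g -> (forall x, `|g x| <= c') ->
    gap p nu nu' n g = \int[P]_w (\1_(A n) w * (\int[M n w]_x g x - \int[N w]_x g x)).
  move=> mg gc; rewrite /gap mulrBr (halfE n _ _ _ mg gc) (halfE n _ _ _ mg gc).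
  rewrite -RintegralB//; [|exact: iA gc..].
  by apply: eq_Rintegral => w _; rewrite mulrBr.
have mf : measurable_fun setT f by exact: continuous_measurable_borel.
have P01 n : 0 <= p n <= 1.
  rewrite fine_ge0//= /p -(Rint_indic P (mA n)) -(Rint_cst P 1).
  apply: le_Rint => [||w]; [exact: integrable_real_indic|exact: integrable_real_cst|].
  exact: le_trans (ler_norm _) (norm_indic_le1 R (A n) w).
have := @levy_continuity R p nu nu' (kernel_mean P N) P01 _ _ f c cf fc.
rewrite (_ : gap p nu nu' ^~ f = fun n =>
    \int[P]_w (\1_(A n) w * (\int[M n w]_x f x - \int[N w]_x f x))); last first.
  by apply/funext => n; exact: gapE.
apply.
- move=> n g mg g01.
  have gc x : `|g x| <= 1 by have /andP[g0 g1] := g01 x; rewrite ger0_norm.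
  rewrite (halfE n N g 1 mg gc) (Rintegral_kernel_mean _ _ mg gc).
  apply: le_Rint.
  + exact: iA gc.
  + apply: (@bounded_integrable _ _ _ _ _ 1); first exact: measurable_Rintegral_kernel gc.
    by move=> w; exact: Rintegral_kernel_norm_le.
  + move=> w; have : 0 <= \int[N w]_x g x.
      by apply: Rintegral_ge0 => x _; have /andP[] := g01 x.
    by move=> I0; rewrite ler_piMl// (le_trans (ler_norm _) (norm_indic_le1 R (A n) w)).
- move=> s t phi.
  rewrite (_ : gap p nu nu' ^~ _ = fun n => \int[P]_w (\1_(A n) w *
      (\int[M n w]_x cos (s * x.1 + t * x.2 + phi) -
       \int[N w]_x cos (s * x.1 + t * x.2 + phi)))); first exact: trig.
  apply/funext => n; apply: (gapE _ _ 1); first exact: measurable_cos2.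
  by move=> x; exact: cos_max.
Qed.

Let zero : {mfun T >-> R} := cst 0.

Let Rintegral_prod_dirac (N : R.-pker T ~> R) (F : R * R -> R) (c : R) w :
  measurable_fun setT F -> (forall x, `|F x| <= c) ->
  \int[kernel_prod N (gauss_kernel zero) w]_x F x = \int[N w]_x F (x, 0).
Proof.
move=> mF Fc; rewrite (Rintegral_kernel_prod _ _ _ mF Fc); apply: eq_Rintegral => x _.
apply: (@Rintegral_gauss_law0 _ _ _ c) => //.
exact: (measurableT_comp mF (pair1_measurable x)).
Qed.

(** The real case is the plane case with a second coordinate equal to zero. *)
Lemma kernel_cvg (A : nat -> set T) (M : nat -> R.-pker T ~> R)
    (N : R.-pker T ~> R) : (forall n, measurable (A n)) ->
  (forall s phi : R, \int[P]_w (\1_(A n) w *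
      (\int[M n w]_x cos (s * x + phi) - \int[N w]_x cos (s * x + phi))) @[n --> \oo] --> 0) ->
  forall (f : R -> R) (c : R), continuous f -> (forall x, `|f x| <= c) ->
  \int[P]_w (\1_(A n) w * (\int[M n w]_x f x - \int[N w]_x f x)) @[n --> \oo] --> 0.
Proof.
move=> mA trig f c cf fc.
have cF : continuous (fun x : R * R => f x.1).
  move=> x; apply: (@continuous_comp _ _ _ fst f); last exact: cf.
  exact: (@cvg_fst _ _ (nbhs x.1) (nbhs x.2)).
have mF : measurable_fun setT (fun x : R * R => f x.1) by exact: continuous_measurable_borel.
have := @kernel_pair_cvg A (fun n => kernel_prod (M n) (gauss_kernel zero))
  (kernel_prod N (gauss_kernel zero)) mA _ _ c cF (fun x => fc x.1).
have E (F : R * R -> R) (c' : R) n : measurable_fun setT F -> (forall x, `|F x| <= c') ->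
   \int[P]_w (\1_(A n) w * (\int[kernel_prod (M n) (gauss_kernel zero) w]_x F x -
      \int[kernel_prod N (gauss_kernel zero) w]_x F x)) =
   \int[P]_w (\1_(A n) w * (\int[M n w]_x F (x, 0) - \int[N w]_x F (x, 0))).
  by move=> mF' Fc; apply: eq_Rintegral => w _; rewrite !(Rintegral_prod_dirac _ _ mF' Fc).
rewrite (_ : (fun n => _) = fun n => \int[P]_w (\1_(A n) w *
    (\int[M n w]_x f x - \int[N w]_x f x))); last first.
  by apply/funext => n; exact: (E _ c).
apply=> s t phi.
rewrite (_ : (fun n => _) = fun n => \int[P]_w (\1_(A n) w *
      (\int[M n w]_x cos (s * x + phi) - \int[N w]_x cos (s * x + phi)))); first exact: trig.
apply/funext => n; rewrite (E _ 1); [|exact: measurable_cos2|by move=> x; exact: cos_max].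
apply: eq_Rintegral => w _; congr (_ * (_ - _)); apply: eq_Rintegral => x _ /=;
  by rewrite mulr0 addr0.
Qed.

Lemma gauss_kernel_cos (L : {mfun T >-> R}) w (s phi : R) : 0 <= L w ->
  \int[gauss_kernel L w]_x cos (s * x + phi) = expR (- (s ^+ 2 * L w) / 2) * cos phi.
Proof. by move=> L0; exact: gauss_law_cos. Qed.

Lemma gauss_kernel_prod_cos (U V : {mfun T >-> R}) w (s t phi : R) :
  0 <= U w -> 0 <= V w ->
  \int[kernel_prod (gauss_kernel U) (gauss_kernel V) w]_x cos (s * x.1 + t * x.2 + phi) =
  expR (- (s ^+ 2 * U w + t ^+ 2 * V w) / 2) * cos phi.
Proof.
move=> U0 V0; rewrite (@Rintegral_kernel_prod _ _ _ _ _ _ _ _ _ _ 1); last 2 first.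
- exact: measurable_cos2.
- by move=> x; exact: cos_max.
transitivity (\int[gauss_kernel U w]_x (expR (- (t ^+ 2 * V w) / 2) * cos (s * x + phi))).
  apply: eq_Rintegral => x _ /=.
  rewrite -(gauss_kernel_cos t (s * x + phi) V0); apply: eq_Rintegral => y _.
  by congr cos; ring.
rewrite RintegralZl//; last first.
  apply: (@bounded_integrable _ _ _ (kernel_law (gauss_kernel U) w) _ 1).
    exact: measurable_affine_cos.
  by move=> x; exact: cos_max.
rewrite (gauss_kernel_cos s phi U0) mulrA -expRD; congr (expR _ * _); ring.
Qed.

End kernel_convergence.

(** * Scaling and concatenation of arrays *)
Section array_operations.
Context d (T : measurableType d) (R : realType) (P : probability T R).
Variable G : nat -> set (set T).
Hypothesis hG : forall n, sub_sigma_field (G n).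

Let measurable_sumsq m N y L : clt_array P G m N y L -> forall n,
  measurable_fun setT (fun w => \sum_(m n <= k < N n) y n k w ^+ 2).
Proof.
move=> arr n; apply: measurable_sum_nat => k kN; apply: measurable_funX.
exact: gmeasurable_measurable (hG _) (clt_meas arr kN).
Qed.

Lemma clt_array_scale (s : R) m N y L : clt_array P G m N y L ->
  clt_array P G m N (fun n k w => s * y n k w) (fun w => s ^+ 2 * L w).
Proof.
move=> arr; have mS := measurable_sumsq arr.
have [mN my iy [u yu u0] [B [iB B0 yB EB]] mL L0 qv] := arr; split => //.
- by move=> n k kN; apply: measurable_funM => //; exact: my.
- by move=> n k kN; apply: integrable_realZ; exact: iy.
- exists (fun n k => `|s| * u n k).
    move=> n k z kN mz z1.
    have izy : P.-integrable setT (EFin \o (fun w => z w * y n k w)).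
      apply: (integrable_boundedM _ z1 (iy n k kN)).
      exact: gmeasurable_measurable (hG _) mz.
    rewrite (_ : \int[P]_w _ = s * \int[P]_w (z w * y n k w)).
      by rewrite normrM ler_wpM2l// yu.
    by rewrite -RintegralZl//; apply: eq_Rintegral => w _; ring.
  rewrite (_ : (fun n => _) = fun n => `|s| * \sum_(m n <= k < N n) u n k).
    exact: cvg0Zl.
  by apply/funext => n; rewrite mulr_sumr.
- exists (fun n w => `|s| * B n w); split.
  + by move=> n; exact: integrable_realZ.
  + by move=> n w; rewrite mulr_ge0.
  + by move=> n k w kN; rewrite normrM ler_wpM2l// yB.
  + rewrite (_ : (fun n => _) = fun n => `|s| * \int[P]_w B n w); first exact: cvg0Zl.
    by apply/funext => n; rewrite RintegralZl.
- exact: measurable_funM.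
- by move=> w; rewrite mulr_ge0 ?sqr_ge0.
pose c := s ^+ 2 + 1; have c1 : 1 <= c by rewrite lerDr sqr_ge0.
apply: (@squeeze0 _ _ _ _ (cvg0Zl c qv)); apply: nearW => n.
rewrite ger0_norm ?pdist_ge0// -RintegralZl//; last first.
  by apply: integrable_min1; exact: measurable_funB.
have sumE w : \sum_(m n <= k < N n) (s * y n k w) ^+ 2 =
    s ^+ 2 * \sum_(m n <= k < N n) y n k w ^+ 2.
  by rewrite mulr_sumr; apply: eq_bigr => k _; rewrite exprMn.
apply: le_Rint.
- apply: integrable_min1; apply: measurable_funB; last exact: measurable_funM.
  rewrite (_ : (fun _ => _) = fun w => s ^+ 2 * \sum_(m n <= k < N n) y n k w ^+ 2).
    exact: measurable_funM.
  by apply/funext.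
- by apply: integrable_realZ; apply: integrable_min1; exact: measurable_funB.
move=> w; rewrite sumE -mulrBr normrM ger0_norm ?sqr_ge0//.
set D := `|_ - _|; have D0 : 0 <= D by exact: normr_ge0.
have s20 := sqr_ge0 s.
have [D1|D1] := leP D 1.
  by rewrite ge_min; apply/orP; left; rewrite ler_wpM2r// lerDl.
by rewrite mulr1 ge_min c1 orbT.
Qed.

Lemma clt_array_cat m r N y y' L L' : clt_array P G m r y L -> clt_array P G r N y' L' ->
  clt_array P G m N (fun n k => if (k < r n)%N then y n k else y' n k)
    (fun w => L w + L' w).
Proof.
move=> arr arr'; have mS := measurable_sumsq arr; have mS' := measurable_sumsq arr'.
have [mr my iy [u yu u0] [B [iB B0 yB EB]] mL L0 qv] := arr.
have [rN my' iy' [u' yu' u0'] [B' [iB' B0' yB' EB']] mL' L0' qv'] := arr'.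
have lo n k : (m n <= k < N n)%N -> (k < r n)%N -> (m n <= k < r n)%N.
  by move=> /andP[-> _] ->.
have hi n k : (m n <= k < N n)%N -> (k < r n)%N = false -> (r n <= k < N n)%N.
  by move=> /andP[_ ->] /negbT; rewrite -leqNgt => ->.
have split_sum (V : zmodType) n (F F' : nat -> V) :
    \sum_(m n <= k < N n) (if (k < r n)%N then F k else F' k) =
    \sum_(m n <= k < r n) F k + \sum_(r n <= k < N n) F' k.
  rewrite (big_cat_nat (mr n) (rN n))/=; congr (_ + _); rewrite big_nat [RHS]big_nat;
    apply: eq_bigr => k /andP[h1 h2]; first by rewrite h2.
  by rewrite ltnNge h1.
split.
- by move=> n; exact: leq_trans (mr n) (rN n).
- by move=> n k kN; case: ifP => kr; [exact: my (lo _ _ kN kr)|exact: my' (hi _ _ kN kr)].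
- by move=> n k kN; case: ifP => kr; [exact: iy (lo _ _ kN kr)|exact: iy' (hi _ _ kN kr)].
- exists (fun n k => if (k < r n)%N then u n k else u' n k).
    move=> n k z kN; case: ifP => kr; [exact: yu (lo _ _ kN kr)|exact: yu' (hi _ _ kN kr)].
  rewrite (_ : (fun n => _) = fun n => \sum_(m n <= k < r n) u n k + \sum_(r n <= k < N n) u' n k).
    exact: cvg0D.
  by apply/funext => n; exact: split_sum.
- exists (fun n w => B n w + B' n w); split.
  + by move=> n; exact: integrable_realD.
  + by move=> n w; rewrite addr_ge0.
  + move=> n k w kN; case: ifP => kr.
      by rewrite (le_trans (yB _ _ _ (lo _ _ kN kr)))// lerDl.
    by rewrite (le_trans (yB' _ _ _ (hi _ _ kN kr)))// lerDr.
  + rewrite (_ : (fun n => _) = fun n => \int[P]_w B n w + \int[P]_w B' n w); first exact: cvg0D.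
    by apply/funext => n; rewrite RintegralD.
- exact: measurable_funD.
- by move=> w; rewrite addr_ge0.
have sumE n w : \sum_(m n <= k < N n) ((if (k < r n)%N then y n k else y' n k) w) ^+ 2 =
    \sum_(m n <= k < r n) y n k w ^+ 2 + \sum_(r n <= k < N n) y' n k w ^+ 2.
  by rewrite -split_sum; apply: eq_bigr => k _; case: ifP.
apply: (@squeeze0 _ _ _ _ (cvg0D qv qv')); apply: nearW => n.
rewrite ger0_norm ?pdist_ge0// -RintegralD//; last 2 first.
- by apply: integrable_min1; exact: measurable_funB.
- by apply: integrable_min1; exact: measurable_funB.
apply: le_Rint.
- apply: integrable_min1; apply: measurable_funB; last exact: measurable_funD.
  rewrite (_ : (fun _ => _) = fun w => \sum_(m n <= k < r n) y n k w ^+ 2 +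
      \sum_(r n <= k < N n) y' n k w ^+ 2); first exact: measurable_funD.
  by apply/funext.
- by apply: integrable_realD; apply: integrable_min1; exact: measurable_funB.
move=> w; rewrite sumE.
set a := \sum_(_ <= _ < _) _; set b := \sum_(_ <= _ < _) _.
by rewrite (_ : a + b - (L w + L' w) = (a - L w) + (b - L' w)); [exact: min1_normD|ring].
Qed.

Lemma clt_array_sum_cat m r N (y y' : nat -> nat -> T -> R) n w : (m n <= r n)%N -> (r n <= N n)%N ->
  \sum_(m n <= k < N n) (if (k < r n)%N then y n k else y' n k) w =
  \sum_(m n <= k < r n) y n k w + \sum_(r n <= k < N n) y' n k w.
Proof.
move=> mr rN; rewrite (big_cat_nat mr rN)/=; congr (_ + _); rewrite big_nat [RHS]big_nat;
  apply: eq_bigr => k /andP[h1 h2]; first by rewrite h2.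
by rewrite ltnNge h1.
Qed.

End array_operations.

(** * Bounds for the drift and the jumps *)
Section rate_of_the_drift.
Context (R : realType).
Implicit Types (delta : nat -> R) (k n : nat).

Let sqrtS k : Num.sqrt k.+1%:R ^+ 2 = Num.sqrt k%:R ^+ 2 + 1 :> R.
Proof. by rewrite !sqr_sqrtr// -natr1. Qed.

Let sqrt_ge1 k : (1 <= k)%N -> 1 <= Num.sqrt k%:R :> R.
Proof. by move=> k1; rewrite -[X in X <= _]sqrtr1 ler_wsqrtr// ler1n. Qed.

Let sqrtS_le k : (1 <= k)%N ->
  Num.sqrt k%:R <= Num.sqrt (k.+1%:R : R) <= 2 * Num.sqrt k%:R.
Proof.
move=> k1; have := sqrtS k; have := sqrt_ge1 k1.
have := sqrtr_ge0 (k.+1%:R : R); set s := Num.sqrt k%:R; set t := Num.sqrt _.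
by move=> *; apply/andP; split; nra.
Qed.

(** This bound and the next one compare $\sum k^{-1/2}$ and $\sum k^{-3/2}$ with
    telescoping sums. *)
Lemma invsqrt_le k : (1 <= k)%N ->
  (Num.sqrt k%:R)^-1 <= 4 * (Num.sqrt k.+1%:R - Num.sqrt k%:R) :> R.
Proof.
move=> k1; have := sqrtS k; have := sqrt_ge1 k1; have := sqrtS_le k1.
set s := Num.sqrt k%:R; set t := Num.sqrt _ => /andP[st ts] s1 ts2.
rewrite -[leLHS]mul1r ler_pdivrMr; last lra.
nra.
Qed.

Lemma inv_sqrt_cube_le k : (1 <= k)%N ->
  (k%:R * Num.sqrt k%:R)^-1 <= 4 * ((Num.sqrt k%:R)^-1 - (Num.sqrt k.+1%:R)^-1) :> R.
Proof.
move=> k1; rewrite -[X in (X * _)^-1]sqr_sqrtr//.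
have := sqrtS k; have := sqrt_ge1 k1; have := sqrtS_le k1.
set s := Num.sqrt k%:R; set t := Num.sqrt _ => /andP[st ts] s1 ts2.
have s0 : s != 0 by rewrite gt_eqF//; lra.
have t0 : t != 0 by rewrite gt_eqF//; lra.
have -> : 4 * (s^-1 - t^-1) = 4 * (t - s) * s ^+ 2 / t * (s ^+ 2 * s)^-1.
  by field; rewrite s0 t0.
have s_gt0 : 0 < s by lra.
rewrite -[leLHS]mul1r ler_pM2r ?invr_gt0 ?mulr_gt0 ?exprn_gt0//.
rewrite ler_pdivlMr; last lra.
nra.
Qed.

Lemma invsqrtn_cvg0 : (Num.sqrt n%:R)^-1 @[n --> \oo] --> (0 : R).
Proof.
apply/gtr0_cvgV0; first by near=> n; rewrite sqrtr_gt0 ltr0n; near: n; exists 1%N.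
apply/cvgryPge => A; near=> n.
rewrite (le_trans (ler_norm _))// -sqrtr_sqr ler_wsqrtr//.
by near: n; exact: nbhs_infty_ger.
Unshelve. all: by end_near. Qed.

Variable delta : nat -> R.
Hypothesis delta0 : forall k, 0 <= delta k.
Hypothesis delta_rate : forall e : R, 0 < e -> exists k0, forall k, (k0 <= k)%N -> (1 <= k)%N ->
  delta k <= e * (k%:R * Num.sqrt k%:R)^-1.

Lemma mean_drift_cvg0 :
  \sum_(0 <= k < n) (Num.sqrt n%:R)^-1 * (k.+1%:R * delta k) @[n --> \oo] --> (0 : R).
Proof.
apply: cvg0_eps => e e0.
have [k0 hk0] := delta_rate (divr_gt0 e0 (ltr0n R 8)).
pose k1 := k0.+1.
pose K := \sum_(0 <= k < k1) (k.+1%:R * delta k).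
exists (fun n => K * (Num.sqrt n%:R)^-1).
  by apply: cvg0Zl; exact: invsqrtn_cvg0.
near=> n; have nk : (k1 <= n)%N by near: n; exact: nbhs_infty_ge.
have n1 : (1 <= n)%N by exact: leq_trans nk.
have s0 : 0 < Num.sqrt n%:R :> R by rewrite sqrtr_gt0 ltr0n.
rewrite ger0_norm; last by apply: sumr_ge0 => k _; rewrite !mulr_ge0 ?invr_ge0.
rewrite -mulr_sumr (big_cat_nat (leq0n _) nk)/= -/K mulrDr [_ * K]mulrC lerD2l.
rewrite mulrC ler_pdivrMr//.
apply: (@le_trans _ _ (\sum_(k1 <= k < n) e * (Num.sqrt k.+1%:R - Num.sqrt k%:R))); last first.
  rewrite -mulr_sumr telescope_sumr// ler_wpM2l ?(ltW e0)//.
  by rewrite lerBlDr lerDl sqrtr_ge0.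
rewrite big_nat [leRHS]big_nat; apply: ler_sum => k /andP[kk _].
have k1' : (1 <= k)%N by exact: leq_trans kk.
apply: (@le_trans _ _ (e / 4 * (Num.sqrt k%:R)^-1)); last first.
  have := invsqrt_le k1'; nra.
have kR : 1 <= k%:R :> R by rewrite ler1n.
have sk0 : 0 < Num.sqrt k%:R :> R by rewrite sqrtr_gt0 ltr0n.
apply: (@le_trans _ _ (2 * k%:R * (e / 8 * (k%:R * Num.sqrt k%:R)^-1))).
  apply: ler_pM => //; first by rewrite -natr1; lra.
  by apply: hk0 => //; exact: leq_trans (leqnSn _) kk.
rewrite le_eqVlt; apply/orP; left; apply/eqP; field.
by rewrite !gt_eqF//; lra.
Unshelve. all: by end_near. Qed.

Lemma limit_drift_cvg0 (N : nat -> nat) : (forall n, (n <= N n)%N) ->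
  \sum_(n <= k < N n) Num.sqrt n%:R * delta k @[n --> \oo] --> (0 : R).
Proof.
move=> nN; apply: cvg0_eps => e e0.
have [k0 hk0] := delta_rate (divr_gt0 e0 (ltr0n R 4)).
exists (fun=> 0); first exact: cvg_cst.
near=> n; have nk : (k0 <= n)%N by near: n; exact: nbhs_infty_ge.
have n1 : (1 <= n)%N by near: n; exact: nbhs_infty_ge.
have s0 : 0 < Num.sqrt n%:R :> R by rewrite sqrtr_gt0 ltr0n.
rewrite add0r ger0_norm; last by apply: sumr_ge0 => k _; rewrite mulr_ge0.
rewrite -mulr_sumr -ler_pdivlMl//.
apply: (@le_trans _ _ (\sum_(n <= k < N n) e * ((- (Num.sqrt k.+1%:R)^-1) - (- (Num.sqrt k%:R)^-1)))).
  rewrite big_nat [leRHS]big_nat; apply: ler_sum => k /andP[kk _].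
  have k1 : (1 <= k)%N by exact: leq_trans kk.
  apply: (le_trans (hk0 k (leq_trans nk kk) k1)).
  have := inv_sqrt_cube_le k1; nra.
rewrite -mulr_sumr telescope_sumr// mulrC ler_wpM2r ?(ltW e0)//.
by rewrite opprK addrC gerBl invr_ge0.
Unshelve. all: by end_near. Qed.

End rate_of_the_drift.

Section extended_limits.
Context (R : realType).

Lemma cvg0_near_le (u : nat -> \bar R) (e : R) : u @ \oo --> 0%E -> 0 < e ->
  \forall n \near \oo, (u n <= e%:E)%E.
Proof.
move=> /fine_cvgP[uf u0] e0.
move/cvgrPdist_lt : u0 => /(_ _ e0) u0.
near=> n; have uf' : u n \is a fin_num by near: n.
rewrite -(fineK uf') lee_fin.
have : `|0 - fine (u n)| < e by near: n.
by rewrite sub0r normrN => /ltW; apply: le_trans; exact: ler_norm.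
Unshelve. all: by end_near. Qed.

Lemma cvg0_of_EFin_near (u : nat -> \bar R) (v : nat -> R) :
  (\forall n \near \oo, 0 <= v n /\ ((v n)%:E <= u n)%E) ->
  u @ \oo --> 0%E -> v @ \oo --> 0.
Proof.
move=> vu u0; apply: cvg0_eps => e e0; exists (fun=> 0); first exact: cvg_cst.
have := cvg0_near_le u0 e0; move: vu; apply: filterS2 => n [v0 vu] ue.
by rewrite add0r ger0_norm// -lee_fin (le_trans vu).
Qed.

End extended_limits.

Section expectation_bounds.
Context d (T : measurableType d) (R : realType) (P : probability T R).
Implicit Types f : T -> R.

(** Young's inequality $2 |x| \le a + x^2 / a$ instead of Cauchy-Schwarz. *)
Lemma Rint_norm_le_L2 f (a : R) : measurable_fun setT f -> 0 < a ->
  ('E_P[fun w => (f w ^+ 2)%R] <= (a ^+ 2)%:E)%E -> \int[P]_w `|f w| <= a.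
Proof.
move=> mf a0; rewrite expectation.unlock => fa.
have if2 : P.-integrable setT (EFin \o (fun w => f w ^+ 2)).
  apply/integrableP; split; first by apply/measurable_EFinP; exact: measurable_funX.
  under eq_integral do rewrite /= ger0_norm ?sqr_ge0//.
  exact: le_lt_trans fa (ltry _).
have fa' : \int[P]_w (f w ^+ 2) <= a ^+ 2.
  by rewrite -lee_fin Rint_EFin.
have h w : `|f w| <= a / 2 + (a * 2)^-1 * f w ^+ 2.
  rewrite -[f w ^+ 2]real_normK ?num_real//; set x := `|f w|.
  rewrite -subr_ge0 (_ : _ - _ = (a * 2)^-1 * (x - a) ^+ 2); last first.
    by field; rewrite gt_eqF.
  by rewrite mulr_ge0 ?sqr_ge0// invr_ge0 mulr_ge0// ltW.
have i2 : P.-integrable setT (EFin \o (fun w => (a * 2)^-1 * f w ^+ 2)).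
  exact: integrable_realZ.
have i3 := integrable_real_cst P (a / 2).
apply: (@le_trans _ _ (\int[P]_w (a / 2 + (a * 2)^-1 * f w ^+ 2))).
  apply: le_Rint => //; last exact: integrable_realD.
  apply: (@dominated_integrable _ _ _ _ _ (fun w => a / 2 + (a * 2)^-1 * f w ^+ 2)).
  - exact: measurableT_comp.
  - by move=> w; rewrite normr_id.
  - exact: integrable_realD.
rewrite RintegralD// Rint_cst RintegralZl//.
have aE : a = a / 2 + (a * 2)^-1 * a ^+ 2 by field; rewrite gt_eqF.
rewrite [leRHS]aE.
by rewrite lerD2l ler_wpM2l// invr_ge0 mulr_ge0// ltW.
Qed.

Lemma min1_le_sum (a x y c : R) : 0 <= x -> 0 <= y -> 0 <= c ->
  `|a| <= 2 * x + y + 2 * c ->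
  Num.min `|a| 1 <= 2 * Num.min x 1 + Num.min y 1 + 2 * Num.min c 1.
Proof. by rewrite /Num.min; do 4 case: ifPn; rewrite -?leNgt; lra. Qed.

Lemma integrable_bigmax (I : Type) (r : seq I) (F : I -> T -> R) :
  (forall i, P.-integrable setT (EFin \o F i)) ->
  P.-integrable setT (EFin \o (fun w => \big[Num.max/0]_(i <- r) F i w)).
Proof.
move=> iF.
have mm : measurable_fun setT (fun w => \big[Num.max/0]_(i <- r) F i w).
  elim: r => [|i r ih]; first by under eq_fun do rewrite big_nil; exact: measurable_cst.
  under eq_fun do rewrite big_cons.
  apply: measurable_maxr => //; exact: measurable_of_integrable (iF i).
apply: (@dominated_integrable _ _ _ _ _ (fun w => \sum_(i <- r) `|F i w|)) => //; last first.
  by apply: integrable_real_sum => i _; exact: integrable_real_norm.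
move=> w; rewrite ger0_norm ?bigmax_ge_id//.
elim: r {mm} => [|i r ih]; first by rewrite !big_nil.
rewrite !big_cons ge_max; apply/andP; split.
  by rewrite (le_trans (ler_norm _))// lerDl sumr_ge0.
by rewrite (le_trans ih)// lerDr.
Qed.

(** The maximum is at most $b + \sum_k (|Y_k| - b)^+$, for $b$ a small multiple of
    $\sqrt n$. *)
Lemma max_normalized_cvg0 (Y : nat -> T -> R) :
  (forall k, P.-integrable setT (EFin \o Y k)) ->
  (forall e : R, 0 < e -> exists b0 : R, forall b k, b0 <= b -> 0 < b ->
     \int[P]_w excess b (Y k) w <= e / b) ->
  (Num.sqrt n%:R)^-1 * \int[P]_w (\big[Num.max/0]_(k <- iota 0 n) `|Y k w|) @[n --> \oo] --> 0.
Proof.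
move=> iY Yui; apply: cvg0_eps => e e0; exists (fun=> 0); first exact: cvg_cst.
set a := e / 2; have a0 : 0 < a by rewrite /a divr_gt0.
have [b0 hb0] := Yui (a ^+ 2) (exprn_gt0 2 a0).
near=> n.
have n1 : (1 <= n)%N by near: n; exact: nbhs_infty_ge.
set s := Num.sqrt n%:R; have s0 : 0 < s by rewrite sqrtr_gt0 ltr0n.
have b0s : b0 <= a * s.
  rewrite -ler_pdivrMl//; rewrite /s (le_trans (ler_norm _))//.
  rewrite -sqrtr_sqr ler_wsqrtr//; near: n; exact: nbhs_infty_ger.
have as0 : 0 < a * s by rewrite mulr_gt0.
have imax := integrable_bigmax (iota 0 n) (fun k => integrable_real_norm (iY k)).
rewrite add0r ger0_norm; last first.
  rewrite mulr_ge0 ?invr_ge0 ?(ltW s0)//; apply: Rintegral_ge0 => w _.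
  exact: bigmax_ge_id.
have iex k : P.-integrable setT (EFin \o excess (a * s) (Y k)).
  by apply: integrable_excess => //; exact: ltW.
have isum : P.-integrable setT (EFin \o (fun w => \sum_(k <- iota 0 n) excess (a * s) (Y k) w)).
  by apply: integrable_real_sum.
have ias := integrable_real_cst P (a * s).
apply: (@le_trans _ _ (s^-1 * \int[P]_w (a * s + \sum_(k <- iota 0 n) excess (a * s) (Y k) w))).
  rewrite ler_wpM2l ?invr_ge0 ?(ltW s0)//; apply: le_Rint => //.
    exact: integrable_realD.
  move=> w; elim: (iota 0 n) => [|k r ih].
    by rewrite !big_nil addr0 ltW.
  rewrite !big_cons ge_max; apply/andP; split; last first.
    by rewrite (le_trans ih)// lerD2l lerDr excess_ge0.
  rewrite addrA (@le_trans _ _ (a * s + excess (a * s) (Y k) w))//; last first.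
    by rewrite lerDl sumr_ge0// => j _; exact: excess_ge0.
  by rewrite -lerBlDl /excess le_max lexx.
rewrite RintegralD// Rint_cst Rintegral_sum//.
apply: (@le_trans _ _ (s^-1 * (a * s + \sum_(k <- iota 0 n) a ^+ 2 / (a * s)))).
  rewrite ler_wpM2l ?invr_ge0 ?(ltW s0)// lerD2l; apply: ler_sum => k _.
  exact: hb0.
rewrite big_const_seq count_predT size_iota iter_addr_0 -[X in _ + X]mulr_natr.
have -> : n%:R = s ^+ 2 by rewrite /s sqr_sqrtr.
rewrite (_ : e = a + a); last by rewrite /a; field.
rewrite le_eqVlt; apply/orP; left; apply/eqP; field.
by rewrite !gt_eqF.
Unshelve. all: by end_near. Qed.

End expectation_bounds.

(** * The arrays of the two statistics *)
Section arrays.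
Context (R : realType) (d : measure_display) (T : measurableType d)
  (P : probability T R) (G : nat -> set (set T)).
Variables X Z W : nat -> {RV P >-> R}.
Hypothesis hG : forall n, sub_sigma_field (G n).
Hypothesis hGmono : forall m n, (m <= n)%N -> G m `<=` G n.
Hypothesis hXint : forall n, (1 <= n)%N -> P.-integrable setT (EFin \o X n).
Hypothesis hZ : forall n, is_cond_exp P (G n) (X n.+1) (Z n).
Hypothesis hW : forall n, is_cond_exp P (G n) (Z n.+1) (W n).
Hypothesis hrate : ((n%:R ^+ 3)%:E * 'E_P[fun w => ((W n w - Z n w) ^+ 2)%R])%E
               @[n --> \oo] --> 0%E.

Let iZ n : P.-integrable setT (EFin \o Z n).
Proof. exact: cond_exp_integrable (hZ n). Qed.

Let iW n : P.-integrable setT (EFin \o W n).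
Proof. exact: cond_exp_integrable (hW n). Qed.

Let delta k : R := \int[P]_w `|W k w - Z k w|.

Let delta_ge0 k : 0 <= delta k.
Proof. exact: Rintegral_ge0. Qed.

(** The mean square bound $o(k^{-3})$ gives $\delta_k = o(k^{-3/2})$. *)
Let delta_rate (e : R) : 0 < e -> exists k0, forall k, (k0 <= k)%N -> (1 <= k)%N ->
  delta k <= e * (k%:R * Num.sqrt k%:R)^-1.
Proof.
move=> e0; have [k0 _ hk0] := cvg0_near_le hrate (exprn_gt0 2 e0).
exists k0 => k kk k1; have kR : 0 < k%:R :> R by rewrite ltr0n.
have s0 : 0 < Num.sqrt k%:R :> R by rewrite sqrtr_gt0.
have a0 : 0 < e * (k%:R * Num.sqrt k%:R)^-1 by rewrite mulr_gt0// invr_gt0 mulr_gt0.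
apply: Rint_norm_le_L2 => //; first exact: measurable_funB.
have := hk0 k kk; rewrite /= -lee_pdivlMl ?exprn_gt0// => /le_trans; apply.
suff -> : (e * (k%:R * Num.sqrt k%:R)^-1) ^+ 2 = (k%:R ^+ 3)^-1 * e ^+ 2 by rewrite EFinM.
by rewrite exprMn exprVn exprMn sqr_sqrtr ?ler0n// -exprSr mulrC.
Qed.

(** Against a variable of the past $Z_{k+1}$ may be replaced by its conditional
    expectation $W_k$. *)
Let drift_le k z : gmeasurable (G k) z -> (forall w, `|z w| <= 1) ->
  `|\int[P]_w (z w * (Z k w - Z k.+1 w))| <= delta k.
Proof.
move=> mz z1; have mzT := gmeasurable_measurable (hG k) mz.
have izb (f : T -> R) : P.-integrable setT (EFin \o f) ->
    P.-integrable setT (EFin \o (fun w => z w * f w)).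
  by move=> i; exact: (integrable_boundedM _ z1).
have -> : \int[P]_w (z w * (Z k w - Z k.+1 w)) = \int[P]_w (z w * (Z k w - W k w)).
  have e (f g : T -> R) : P.-integrable setT (EFin \o f) ->
      P.-integrable setT (EFin \o g) -> \int[P]_w (z w * (f w - g w)) =
      \int[P]_w (z w * f w) - \int[P]_w (z w * g w).
    move=> i1 i2; rewrite -RintegralB//; [|exact: izb..].
    by apply: eq_Rintegral => w _; rewrite mulrBr.
  by rewrite !e// (cond_exp_bounded (hG k) (iZ k.+1) (hW k) mz z1).
apply: Rint_norm_le.
- by apply: izb; exact: integrable_realB.
- by apply: integrable_real_norm; exact: integrable_realB.
move=> w; rewrite normrM distrC -[leRHS]mul1r ler_wpM2r//.
Qed.

Let gZ k n : (k <= n)%N -> gmeasurable (G n) (Z k).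
Proof.
move=> kn; apply: (gmeasurable_mono (hG k)) => //; first exact: hGmono.
exact: cond_exp_gmeasurable (hZ k).
Qed.

Section mean_array.
Variable U : {RV P >-> R}.
Hypothesis hU : forall w, 0 <= U w.
Hypothesis hXadapted : forall n, (1 <= n)%N -> g_sigma_algebra_preimage (X n) `<=` G n.
Hypothesis hXui : uniformly_integrable P (fun n w => (X n.+1 w) ^+ 2).

Definition mean_array n k w : R :=
  (Num.sqrt n%:R)^-1 * (X k.+1 w - Z k w + k.+1%:R * (Z k w - Z k.+1 w)).

(** Each summand is $X_{k+1} + k Z_k - (k+1) Z_{k+1}$. *)
Lemma mean_array_sum n w : \sum_(0 <= k < n) mean_array n k w = C_stat X Z n w.
Proof.
rewrite -mulr_sumr /C_stat /sample_mean.
have -> : \sum_(0 <= k < n) (X k.+1 w - Z k w + k.+1%:R * (Z k w - Z k.+1 w)) =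
    \sum_(1 <= k < n.+1) X k w - n%:R * Z n w.
  elim: n => [|n ih]; first by rewrite !big_geq// mul0r subr0.
  rewrite big_nat_recr//= ih [in RHS]big_nat_recr//=.
  by rewrite -(natr1 (R := R)); ring.
have [->|n0] := eqVneq n 0%N; first by rewrite sqrtr0 invr0 !mul0r.
have nE : n%:R = Num.sqrt n%:R ^+ 2 :> R by rewrite sqr_sqrtr.
have s0 : Num.sqrt n%:R != 0 :> R by rewrite gt_eqF// sqrtr_gt0 ltr0n lt0n.
set s := Num.sqrt n%:R in nE s0 *; rewrite [in RHS]nE [in LHS]nE.
by field.
Qed.

(** Where $|X|$ exceeds $b$ it is at most $X^2 / b$. *)
Let excess_X (e : R) : 0 < e -> exists b0 : R, forall b k, b0 <= b -> 0 < b ->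
  \int[P]_w excess b (X k.+1) w <= e / b.
Proof.
move=> e0.
have /fine_cvgP[uf u0] := hXui.
move/cvgrPdist_lt : u0 => /(_ _ e0) u0.
have [A [_ hA]] := filterI uf u0.
exists (Num.max 1 (A + 1)) => b k; rewrite ge_max => /andP[b1 bA] b0.
have [|{}uf {}u0] := hA (b ^+ 2); first by nra.
set Y := X k.+1; set A' := [set w | b ^+ 2 < `|Y w ^+ 2|].
have mY : measurable_fun setT Y by [].
have mA' : measurable A'.
  rewrite (_ : A' = (fun w => `|Y w ^+ 2|) @^-1` `]b ^+ 2, +oo[%classic); last first.
    by apply/seteqP; split => w; rewrite /= in_itv/= andbT.
  rewrite -[X in measurable X]setTI; apply: measurableT_comp => //; exact: measurable_funX.
pose g w := \1_A' w * Y w ^+ 2.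
have mg : measurable_fun setT g.
  by apply: measurable_funM; [exact: measurable_indic|exact: measurable_funX].
have g0 w : 0 <= g w by rewrite mulr_ge0 ?sqr_ge0// indicE.
have ge : (\int[P]_w (g w)%:E <= e%:E)%E.
  have -> : (\int[P]_w (g w)%:E = \int[P]_(w in A') `|(Y w ^+ 2)%:E|)%E.
    rewrite [RHS]integral_mkcond; apply: eq_integral => w _.
    rewrite patchE /g indicE; case: ifPn => _; rewrite ?mul0r// mul1r.
    by rewrite /= ger0_norm ?sqr_ge0.
  apply: (@le_trans _ _ (ereal_sup (range (fun i => (\int[P]_(w in [set w | (b ^+ 2 < `|X i.+1 w ^+ 2|)%R])
    `|(X i.+1 w ^+ 2)%:E|)%E)))).
    by apply: ereal_sup_ubound; exists k.
  rewrite -(fineK uf) lee_fin.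
  by move: u0; rewrite sub0r normrN => /ltW; apply: le_trans; exact: ler_norm.
have ig : P.-integrable setT (EFin \o g).
  apply/integrableP; split; first exact/measurable_EFinP.
  under eq_integral do rewrite /= ger0_norm//.
  exact: le_lt_trans ge (ltry _).
have iY : P.-integrable setT (EFin \o Y) by exact: hXint.
apply: (@le_trans _ _ (\int[P]_w (b^-1 * g w))).
  apply: le_Rint; [exact: integrable_excess (ltW b0) iY|exact: integrable_realZ|].
  move=> w; rewrite /excess ge_max mulr_ge0 ?invr_ge0 ?(ltW b0)// andbT.
  rewrite ler_pdivlMl// /g indicE.
  have -> : Y w ^+ 2 = `|Y w| ^+ 2 by rewrite real_normK ?num_real.
  have y0 := normr_ge0 (Y w); have [_|] := boolP (w \in A').
    by rewrite mul1r; nra.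
  rewrite notin_setE /A'/= normrX => /negP; rewrite -leNgt mul0r => yb.
  have : `|Y w| <= b by rewrite -ler_sqr ?nnegrE// ltW.
  by nra.
by rewrite RintegralZl// mulrC ler_pM2r ?invr_gt0// -lee_fin Rint_EFin.
Qed.

(** A jump has three parts. The maximum of the $|X_k|$ is of order smaller than
    $\sqrt n$ by uniform integrability, that of the $|Z_k|$ because $Z_k$ is a
    conditional expectation of $X_{k+1}$, and the third one by hypothesis. *)
Lemma mean_array_clt : cond_a P Z -> cond_b P X Z U ->
  clt_array P G (fun=> 0%N) id mean_array U.
Proof.
move=> ha hb.
have my n k : gmeasurable (G k.+1) (mean_array n k).
  apply: measurable_funM => //; apply: measurable_funD.
    apply: measurable_funB; last exact: gZ.
    by apply: gmeasurableP => //; exact: hXadapted.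
  by apply: measurable_funM => //; apply: measurable_funB; exact: gZ.
split => //.
- move=> n k _; apply: integrable_realZ; apply: integrable_realD.
    by apply: integrable_realB => //; exact: hXint.
  by apply: integrable_realZ; exact: integrable_realB.
- exists (fun n k => (Num.sqrt n%:R)^-1 * (k.+1%:R * delta k)); last first.
    exact: (mean_drift_cvg0 delta_ge0 delta_rate).
  move=> n k z _ mz z1; have mzT := gmeasurable_measurable (hG k) mz.
  have izb (f : T -> R) : P.-integrable setT (EFin \o f) ->
      P.-integrable setT (EFin \o (fun w => z w * f w)).
    by move=> i; exact: (integrable_boundedM _ z1).
  have iX := hXint (ltn0Sn k).
  have i1 := izb _ iX; have i2 := izb _ (iZ k).
  have i3 := izb _ (integrable_realB (iZ k) (iZ k.+1)).
  rewrite (_ : \int[P]_w _ = (Num.sqrt n%:R)^-1 * (k.+1%:R *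
      \int[P]_w (z w * (Z k w - Z k.+1 w)))).
    by rewrite !normrM ger0_norm ?invr_ge0// ger0_norm// !ler_wpM2l ?invr_ge0// drift_le.
  have -> : \int[P]_w (z w * mean_array n k w) = \int[P]_w ((Num.sqrt n%:R)^-1 *
      (z w * X k.+1 w - z w * Z k w + k.+1%:R * (z w * (Z k w - Z k.+1 w)))).
    by apply: eq_Rintegral => w _; rewrite /mean_array; ring.
  have i4 := integrable_realB i1 i2; have i5 := integrable_realZ k.+1%:R i3.
  rewrite RintegralZl//; last exact: integrable_realD.
  rewrite RintegralD// RintegralB// RintegralZl//.
  by rewrite (cond_exp_bounded (hG k) iX (hZ k) mz z1) subrr add0r.
- pose M3 n w := \big[Num.max/0]_(k <- iota 0 n) (k.+1%:R * `|Z k w - Z k.+1 w|).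
  pose M1 n w := \big[Num.max/0]_(k <- iota 0 n) `|X k.+1 w|.
  pose M2 n w := \big[Num.max/0]_(k <- iota 0 n) `|Z k w|.
  have i1 n : P.-integrable setT (EFin \o M1 n).
    by apply: integrable_bigmax => k; apply: integrable_real_norm; exact: hXint.
  have i2 n : P.-integrable setT (EFin \o M2 n).
    by apply: integrable_bigmax => k; exact: integrable_real_norm.
  have i3 n : P.-integrable setT (EFin \o M3 n).
    apply: integrable_bigmax => k; apply: integrable_realZ.
    by apply: integrable_real_norm; exact: integrable_realB.
  have i12 n := integrable_realD (i1 n) (i2 n).
  exists (fun n w => (Num.sqrt n%:R)^-1 * (M1 n w + M2 n w + M3 n w)); split.
  + by move=> n; apply: integrable_realZ; exact: integrable_realD.
  + by move=> n w; rewrite mulr_ge0 ?invr_ge0// !addr_ge0// bigmax_ge_id.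
  + move=> n k w /= kn; rewrite normrM ger0_norm ?invr_ge0// ler_wpM2l ?invr_ge0//.
    have kI : k \in iota 0 n by rewrite mem_iota.
    have h1 : `|X k.+1 w| <= M1 n w by exact: (le_bigmax_seq 0 k xpredT (fun k => `|X k.+1 w|) kI).
    have h2 : `|Z k w| <= M2 n w by exact: (le_bigmax_seq 0 k xpredT (fun k => `|Z k w|) kI).
    have h3 : k.+1%:R * `|Z k w - Z k.+1 w| <= M3 n w.
      exact: (le_bigmax_seq 0 k xpredT (fun k => k.+1%:R * `|Z k w - Z k.+1 w|) kI).
    rewrite (le_trans (ler_normD _ _))// lerD//; last by rewrite normrM ger0_norm.
    by rewrite (le_trans (ler_normB _ _))// lerD.
  + rewrite (_ : (fun n => _) = fun n => (Num.sqrt n%:R)^-1 * (\int[P]_w M1 n w) +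
        (Num.sqrt n%:R)^-1 * (\int[P]_w M2 n w) + (Num.sqrt n%:R)^-1 * (\int[P]_w M3 n w)); last first.
      apply/funext => n; rewrite RintegralZl//; last exact: integrable_realD.
      by rewrite RintegralD// RintegralD// !mulrDr.
    apply: cvg0D; first apply: cvg0D.
    * by apply: max_normalized_cvg0 => // k; exact: hXint.
    * apply: max_normalized_cvg0 => // e /excess_X[b0 hb0]; exists b0 => b k bb b_gt0.
      apply: le_trans (hb0 b k bb b_gt0).
      by apply: (cond_exp_excess (hG k) (ltW b_gt0) (hXint (ltn0Sn k)) (hZ k)).
    * apply: (cvg0_of_EFin_near _ ha); apply: nearW => n; split.
        rewrite mulr_ge0 ?invr_ge0//; apply: Rintegral_ge0 => w _; exact: bigmax_ge_id.
      rewrite EFinM Rint_EFin// expectation.unlock; apply: lee_wpmul2l.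
        by rewrite lee_fin invr_ge0.
      rewrite le_eqVlt; apply/orP; left; apply/eqP; apply: eq_integral => w _.
      by rewrite big_add1 /index_iota subn0.
- have mb n : measurable_fun setT (fun w => n%:R^-1 * \sum_(1 <= k < n.+1)
       (X k w - Z k.-1 w + k%:R * (Z k.-1 w - Z k w)) ^+ 2).
    apply: measurable_funM => //; apply: measurable_sum => k.
    apply: measurable_funX; apply: measurable_funD; first exact: measurable_funB.
    by apply: measurable_funM => //; exact: measurable_funB.
  have := cvg_in_prob_pdist mb _ hb => /(_ (@measurable_funPT _ _ _ _ U)).
  apply: cvg_trans; apply: near_eq_cvg; apply: nearW => n.
  apply: eq_Rintegral => w _; congr (Num.min `|_ - _| 1).
  rewrite big_add1 mulr_sumr; apply: eq_bigr => k _.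
  by rewrite /mean_array exprMn exprVn sqr_sqrtr.
Qed.

End mean_array.

Section limit_array.
Variables Zlim V : {RV P >-> R}.
Hypothesis hV : forall w, 0 <= V w.
Hypothesis hZL1 : 'E_P[fun w => (`|Z n w - Zlim w|)%R]%E @[n --> \oo] --> 0%E.

Definition limit_array n k w : R := Num.sqrt n%:R * (Z k w - Z k.+1 w).

Let integrable_Zlim : P.-integrable setT (EFin \o Zlim).
Proof.
have [n _ hn] := cvg0_near_le hZL1 ltr01.
have {hn} := hn n (leqnn n); rewrite /= expectation.unlock => hn.
have id : P.-integrable setT (EFin \o (fun w => Z n w - Zlim w)).
  apply/integrableP; split; first by apply/measurable_EFinP; exact: measurable_funB.
  exact: le_lt_trans hn (ltry _).
have := integrable_realB (iZ n) id; apply: eq_integrable => // w _ /=.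
by rewrite opprB addrC subrK.
Qed.

(** The rows are made so long that $Z_{N_n}$ may replace the limit, and that
    $n / N_n$ vanishes, as the quadratic variation requires. *)
Let slow_limit : exists N : nat -> nat, forall n, [/\ (n <= N n)%N, (n * n.+1 <= N n)%N &
  Num.sqrt n%:R * \int[P]_w `|Z (N n) w - Zlim w| <= n.+1%:R^-1].
Proof.
have h n : exists m, [/\ (n <= m)%N, (n * n.+1 <= m)%N &
    Num.sqrt n%:R * \int[P]_w `|Z m w - Zlim w| <= n.+1%:R^-1].
  have e0 : 0 < (Num.sqrt n%:R + 1)^-1 * n.+1%:R^-1 :> R.
    by rewrite mulr_gt0 ?invr_gt0 ?ltr0n// ltr_wpDl.
  have [m0 _ hm] := cvg0_near_le hZL1 e0.
  exists (maxn m0 (n * n.+1 + n)); split.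
  - by rewrite leq_max leq_addl orbT.
  - by rewrite leq_max leq_addr orbT.
  have := hm _ (leq_maxl m0 (n * n.+1 + n)); set m := maxn _ _.
  have im : P.-integrable setT (EFin \o (fun w => `|Z m w - Zlim w|)).
    by apply: integrable_real_norm; exact: integrable_realB.
  rewrite /= expectation.unlock -Rint_EFin// lee_fin ler_pdivlMl; last by rewrite ltr_wpDl.
  apply: le_trans; rewrite ler_wpM2r ?lerDl//.
  exact: Rintegral_ge0.
by have [N hN] := choice h; exists N.
Qed.

Lemma limit_array_sum N n w : (n <= N)%N ->
  \sum_(n <= k < N) limit_array n k w = Num.sqrt n%:R * (Z n w - Z N w).
Proof.
move=> nN; rewrite -mulr_sumr; congr (_ * _).
rewrite -[LHS]opprK -sumrN; under eq_bigr do rewrite opprB.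
by rewrite telescope_sumr// opprB.
Qed.

(** The quadratic variation of a row is a difference of two tails of the
    series of squares, and the second tail is of order $1/N$. *)
Let row_qvar_le n N w (A : nat -> \bar R) : (n <= N)%N -> (n * n.+1 <= N)%N ->
  (forall m, A m = m%:R%:E * \sum_(m <= k <oo) ((Z k.-1 w - Z k w) ^+ 2)%:E)%E ->
  Num.min `|\sum_(n <= k < N) limit_array n k w ^+ 2 - V w| 1 <=
    2 * tdist (A n.+1) (V w) + tdist (A N.+1) (V w) + 2 * Num.min `|V w / n.+1%:R| 1.
Proof.
move=> nN nnN hA.
pose f k : \bar R := ((Z k.-1 w - Z k w) ^+ 2)%:E.
pose S m : \bar R := (\sum_(m <= k <oo) f k)%E.
have f0 k : (0 <= f k)%E by rewrite lee_fin sqr_ge0.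
have S0 m : (0 <= S m)%E by apply: nneseries_ge0.
pose q := \sum_(n <= k < N) (Z k w - Z k.+1 w) ^+ 2.
have q0 : 0 <= q by apply: sumr_ge0 => k _; exact: sqr_ge0.
have SE : S n.+1 = (q%:E + S N.+1)%E.
  rewrite /S (@nneseries_split _ f n.+1 (N - n)%N)//.
  rewrite addSn subnKC//; congr (_ + _)%E.
  by rewrite big_add1 sumEFin.
have -> : \sum_(n <= k < N) limit_array n k w ^+ 2 = n%:R * q.
  by rewrite mulr_sumr; apply: eq_bigr => k _; rewrite exprMn sqr_sqrtr.
have e1 m := tdist_ge0 (A m) (V w).
have m0 : 0 <= Num.min `|V w / n.+1%:R| 1 by rewrite le_min normr_ge0 ler01.
have AE m : A m = (m%:R%:E * S m)%E by rewrite hA.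
have [sfin|] := boolP (S N.+1 \is a fin_num); last first.
  rewrite fin_numE negb_and !negbK => /orP[/eqP S1|/eqP S1].
    by have := S0 N.+1; rewrite S1.
  have -> : tdist (A n.+1) (V w) = 1.
    rewrite /tdist AE SE S1 addey// mulry gtr0_sg ?ltr0n// mul1e.
    by rewrite min_r//= leey.
  have := norm_min1 (n%:R * q - V w); rewrite ger0_norm ?le_min ?normr_ge0 ?ler01//.
  have := e1 N.+1; lra.
move: SE (S0 N.+1) (S0 n.+1) (AE n.+1) (AE N.+1); rewrite -(fineK sfin).
set s' := fine _ => -> ; rewrite -EFinD -!EFinM !lee_fin => s0 s1 -> ->.
rewrite !tdist_EFin.
set v := V w; have v0 : 0 <= v by exact: hV.
have nR : 0 <= n%:R :> R by [].
have NR : n%:R * n.+1%:R <= N.+1%:R :> R by rewrite -natrM ler_nat leqW.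
rewrite [`|v / _|]ger0_norm ?divr_ge0//.
have nS : 1 <= n.+1%:R :> R by rewrite ler1n.
set c := v / n.+1%:R; have c0 : 0 <= c by rewrite divr_ge0.
have cv : c * n.+1%:R = v by rewrite divfK// gt_eqF// ltr0n.
set x := `|n.+1%:R * _ - v|; set y := `|N.+1%:R * _ - v|.
have x0 : 0 <= x by exact: normr_ge0.
have y0 : 0 <= y by exact: normr_ge0.
have := ler_norm (n.+1%:R * (q + s') - v); rewrite -/x => xa.
have xa' := ler_norm (- (n.+1%:R * (q + s') - v)); rewrite normrN -/x in xa'.
have := ler_norm (N.+1%:R * s' - v); rewrite -/y => yb.
have h1 : q + s' <= x + c.
  rewrite -(ler_pM2r (lt_le_trans ltr01 nS)) [leRHS]mulrDl cv.
  have : x <= x * n.+1%:R by rewrite ler_peMr.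
  lra.
have h2 : n%:R * s' <= y + c.
  rewrite -(ler_pM2r (lt_le_trans ltr01 nS)) [leRHS]mulrDl cv.
  have : y <= y * n.+1%:R by rewrite ler_peMr.
  have : n%:R * s' * n.+1%:R <= N.+1%:R * s' by rewrite mulrAC ler_wpM2r.
  lra.
have ns0 : 0 <= n%:R * s' by rewrite mulr_ge0.
have h : `|n%:R * q - v| <= 2 * x + y + 2 * c.
  by rewrite ler_norml; apply/andP; split; nra.
exact: min1_le_sum.
Qed.

Theorem limit_array_clt : cond_c P Z -> cond_d P Z V -> exists N,
  [/\ clt_array P G id N limit_array V, forall n, (n <= N n)%N,
    forall n, P.-integrable setT (EFin \o D_stat Z Zlim n) &
    \int[P]_w `|D_stat Z Zlim n w - \sum_(n <= k < N n) limit_array n k w| @[n --> \oo] --> 0].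
Proof.
move=> hc hd; have [N hN] := slow_limit.
have nN n : (n <= N n)%N by have [] := hN n.
exists N; split => //; last first.
- apply: (@squeeze0 _ _ (fun n => n.+1%:R^-1)); last exact: cvg_harmonic.
  apply: nearW => n; rewrite ger0_norm; last exact: Rintegral_ge0.
  have [_ _] := hN n; apply: le_trans; rewrite -RintegralZl//; last first.
    by apply: integrable_real_norm; exact: integrable_realB.
  rewrite le_eqVlt; apply/orP; left; apply/eqP; apply: eq_Rintegral => w _.
  rewrite limit_array_sum// /D_stat -mulrBr normrM ger0_norm//.
  by congr (_ * `|_|); ring.
- by move=> n; apply: integrable_realZ; exact: integrable_realB.
have ml n k : gmeasurable (G k.+1) (limit_array n k).
  by apply: measurable_funM => //; apply: measurable_funB; exact: gZ.
split => //.
- by move=> n k _; apply: integrable_realZ; exact: integrable_realB.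
- exists (fun n k => Num.sqrt n%:R * delta k); last first.
    exact: (limit_drift_cvg0 delta_ge0 delta_rate nN).
  move=> n k z _ mz z1; have mzT := gmeasurable_measurable (hG k) mz.
  have i1 : P.-integrable setT (EFin \o (fun w => z w * (Z k w - Z k.+1 w))).
    by apply: (integrable_boundedM _ z1) => //; exact: integrable_realB.
  rewrite (_ : \int[P]_w _ = Num.sqrt n%:R * \int[P]_w (z w * (Z k w - Z k.+1 w))).
    by rewrite normrM ger0_norm// ler_wpM2l// drift_le.
  by rewrite -RintegralZl//; apply: eq_Rintegral => w _; rewrite /limit_array; ring.
- pose M n w := \big[Num.max/0]_(k <- index_iota n (N n)) `|Z k w - Z k.+1 w|.
  have iM n : P.-integrable setT (EFin \o M n).
    by apply: integrable_bigmax => k; apply: integrable_real_norm; exact: integrable_realB.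
  have M0 n w : 0 <= M n w by exact: bigmax_ge_id.
  exists (fun n w => Num.sqrt n%:R * M n w); split.
  + by move=> n; exact: integrable_realZ.
  + by move=> n w; rewrite mulr_ge0.
  + move=> n k w kn; rewrite normrM ger0_norm// ler_wpM2l//.
    have kI : k \in index_iota n (N n) by rewrite mem_index_iota.
    exact: (le_bigmax_seq 0 k xpredT (fun k => `|Z k w - Z k.+1 w|) kI).
  + under eq_fun do rewrite RintegralZl//.
    apply: (cvg0_of_EFin_near _ hc); apply: nearW => n; split.
      by rewrite mulr_ge0//; exact: Rintegral_ge0.
    rewrite EFinM Rint_EFin//; apply: lee_wpmul2l; first by rewrite lee_fin.
    have msup := measurable_fun_esups (D := setT) (f := fun k w => (`|Z k.-1 w - Z k w|%R)%:E) _ n.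
    apply: ge0_le_integral => //.
    * by move=> w _; rewrite lee_fin.
    * by apply/measurable_EFinP; exact: measurable_of_integrable (iM n).
    * apply: msup => k; apply/measurable_EFinP; apply: measurableT_comp => //.
      exact: measurable_funB.
    * move=> w _; rewrite /M.
      have hk k : k \in index_iota n (N n) -> ((`|Z k w - Z k.+1 w|)%:E <=
          esups (fun k => (`|Z k.-1 w - Z k w|%R)%:E) n)%E.
        rewrite mem_index_iota => /andP[nk _]; apply: ereal_sup_ubound.
        by exists k.+1 => //=; exact: leqW.
      have h0 : (0 <= esups (fun k => (`|Z k.-1 w - Z k w|%R)%:E) n)%E.
        apply: (@le_trans _ _ (`|Z n.-1 w - Z n w|%:E)); first by rewrite lee_fin.
        by apply: ereal_sup_ubound; exists n => /=.
      elim: (index_iota n (N n)) hk => [|k r ih] hk; first by rewrite big_nil.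
      rewrite big_cons EFin_max ge_max hk ?mem_head//=.
      by apply: ih => j jr; apply: hk; rewrite inE jr orbT.
- pose A m w := (m%:R%:E * \sum_(m <= k <oo) ((Z k.-1 w - Z k w) ^+ 2)%:E)%E.
  have mA m : measurable_fun setT (A m).
    apply: measurable_funeM; under eq_fun do rewrite eseries_cond.
    apply: ge0_emeasurable_sum => [k w _ _|k _]; first by rewrite lee_fin sqr_ge0.
    by apply/measurable_EFinP; apply: measurable_funX; exact: measurable_funB.
  have mV : measurable_fun setT V by [].
  have A0 := cvg_in_prob_tdist mA mV hd.
  have iA m : P.-integrable setT (EFin \o (fun w => tdist (A m w) (V w))).
    apply: (@bounded_integrable _ _ _ _ _ 1); first exact: measurable_tdist.
    by move=> w; rewrite ger0_norm ?tdist_ge0 ?tdist_le1.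
  have mV' n : measurable_fun setT (fun w => V w / n.+1%:R).
    by apply: measurable_funM.
  have iV n := integrable_min1 P (mV' n).
  apply: (@squeeze0 _ _ (fun n => 2 * (\int[P]_w tdist (A n.+1 w) (V w)) +
      \int[P]_w tdist (A (N n).+1 w) (V w) + 2 * \int[P]_w Num.min `|V w / n.+1%:R| 1)).
    apply: nearW => n; rewrite ger0_norm ?pdist_ge0//.
    have i1 := integrable_realZ 2 (iA n.+1); have i2 := integrable_realZ 2 (iV n).
    rewrite -!RintegralZl// -!RintegralD//; last exact: integrable_realD.
    apply: le_Rint.
    * apply: integrable_min1; apply: measurable_funB => //.
      apply: measurable_sum => k; apply: measurable_funX.
      exact: gmeasurable_measurable (hG _) (ml n k).
    * by apply: integrable_realD => //; exact: integrable_realD.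
    * by move=> w; have [h1 h2 _] := hN n; exact: (row_qvar_le (A := A^~ w)).
  have Soo : n.+1 @[n --> \oo] --> \oo.
    by apply/cvgnyPge => m; near=> n; apply: leqW; near: n; exact: nbhs_infty_ge.
  have Noo : (N n).+1 @[n --> \oo] --> \oo.
    apply/cvgnyPge => m; near=> n; rewrite (leq_trans _ (leqW (nN n)))//.
    by near: n; exact: nbhs_infty_ge.
  apply: cvg0D; first apply: cvg0D.
  + by apply: cvg0Zl; exact: (cvg_comp _ _ Soo A0).
  + exact: (cvg_comp _ _ Noo A0).
  + apply: cvg0Zl; rewrite -[X in _ --> X](Rint_cst P 0).
    apply: (@Rint_dominated_cvg _ _ _ _ _ (fun=> 0) (fun=> 1)) => //.
    * by move=> n; exact: measurable_min1.
    * move=> w; apply: (@squeeze0 _ _ (fun n => `|V w| * n.+1%:R^-1)).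
        apply: nearW => n; rewrite ger0_norm ?le_min ?normr_ge0 ?ler01//.
        by rewrite ge_min normrM normfV (ger0_norm (ler0n _ _)) lexx.
      by apply: cvg0Zl; exact: cvg_harmonic.
    * exact: integrable_real_cst.
    * by move=> n w; exact: norm_min1.
Unshelve. all: by end_near. Qed.

End limit_array.
End arrays.

(** * From trigonometric limits to stable convergence *)
Section from_trigonometric_limits.
Context d (T : measurableType d) (R : realType) (P : probability T R).

(** Multiplication by the probability of $H$ turns the integrals against the
    conditional laws into integrals against $P$. *)
Lemma stable_cvg_of_integrals d' (S : borelType d') (Y : nat -> {RV P >-> S})
    (N : R.-pker T ~> S) :
  (forall (H : set T) (f : S -> R) (c : R), measurable H -> continuous f ->
     (forall x, `|f x| <= c) ->
     \int[P]_w (\1_H w * (f (Y n w) - \int[N w]_x f x)) @[n --> \oo] --> 0) ->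
  stable_cvg P Y N.
Proof.
move=> lim H mH PH0 f cf [c0 [_ fc0]].
pose c := c0 + 1; have fc x : `|f x| <= c by apply: fc0 => //; rewrite ltrDl.
have mf : measurable_fun setT f by exact: continuous_measurable_borel.
have PHfin : P H \is a fin_num by exact: fin_num_measure.
have p0 : 0 < fine (P H) by rewrite fine_gt0// PH0 ltey_eq PHfin.
have mfY n : measurable_fun setT (f \o Y n) by exact: measurableT_comp.
have mN : measurable_fun setT (fun w => \int[N w]_x f x) by exact: measurable_Rintegral_kernel fc.
have Nc w : `|\int[N w]_x f x| <= c by exact: Rintegral_kernel_norm_le.
have i1 := integrable_boundedM (measurable_indic (R := R) mH) (norm_indic_le1 R H).
have iN : P.-integrable setT (EFin \o (fun w => \int[N w]_x f x)).
  exact: bounded_integrable Nc.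
have iY n : P.-integrable setT (EFin \o (f \o Y n)).
  by apply: (@bounded_integrable _ _ _ _ _ c) => // w; exact: fc.
apply/cvgrPdist_lt => e e0.
move/cvgrPdist_lt : (lim H f c mH cf fc) => /(_ _ (mulr_gt0 p0 e0)).
apply: filterS => n; rewrite sub0r normrN => h.
rewrite -(ltr_pM2l p0) -[X in X * `|_|]gtr0_norm// -normrM mulrBr distrC.
rewrite (Rintegral_distribution _ mf fc) (Rintegral_kernel_mean _ _ mf fc).
rewrite (Rintegral_cond_prob P mH (f := f \o Y n) (mfY n) (fun w => fc (Y n w))).
rewrite (Rintegral_cond_prob P mH mN Nc) -RintegralB//; [|exact: i1..].
rewrite (_ : \int[P]_w _ = \int[P]_w (\1_H w * (f (Y n w) - \int[N w]_x f x)))//.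
by apply: eq_Rintegral => w _; rewrite mulrBr.
Qed.

Lemma Rint_cos_replace (A : nat -> set T) (a b : nat -> T -> R) (g : T -> R) :
  (forall n, measurable (A n)) ->
  (forall n, measurable_fun setT (a n)) -> (forall n, measurable_fun setT (b n)) ->
  measurable_fun setT g -> (forall w, `|g w| <= 1) ->
  (forall n, P.-integrable setT (EFin \o (fun w => b n w - a n w))) ->
  \int[P]_w `|b n w - a n w| @[n --> \oo] --> 0 ->
  \int[P]_w (\1_(A n) w * (cos (a n w) - g w)) @[n --> \oo] --> 0 ->
  \int[P]_w (\1_(A n) w * (cos (b n w) - g w)) @[n --> \oo] --> 0.
Proof.
move=> mA ma mb mg g1 iab ab0 lim.
have ic (f : T -> R) n : measurable_fun setT f ->
    P.-integrable setT (EFin \o (fun w => \1_(A n) w * (cos (f w) - g w))).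
  move=> mf; apply: (@bounded_integrable _ _ _ _ _ 2).
    apply: measurable_funM; first exact: measurable_indic.
    by apply: measurable_funB => //; exact: measurableT_comp (@measurable_cos R) _.
  move=> w; rewrite normrM -[leRHS]mul1r ler_pM ?norm_indic_le1//.
  rewrite (le_trans (ler_normB _ _))// (_ : 2 = 1 + 1)// lerD// ?cos_max//.
rewrite (_ : (fun n => _) = fun n => (\int[P]_w (\1_(A n) w * (cos (b n w) - g w)) -
   \int[P]_w (\1_(A n) w * (cos (a n w) - g w))) + \int[P]_w (\1_(A n) w * (cos (a n w) - g w))).
  apply: cvg0D => //; apply: squeeze0 ab0; apply: nearW => n.
  rewrite -RintegralB//; [|exact: ic..].
  apply: Rint_norm_le.
  - by apply: integrable_realB; exact: ic.
  - exact: integrable_real_norm.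
  - move=> w; rewrite -mulrBr normrM opprB addrA subrK.
    rewrite -[leRHS]mul1r ler_pM ?norm_indic_le1//; exact: norm_cosB_le.
by apply/funext => n; rewrite subrK.
Qed.

Lemma cvg_cos_kernel (A : nat -> set T) (Y : nat -> {RV P >-> R}) (N : R.-pker T ~> R) :
  (forall n, measurable (A n)) ->
  (forall s phi : R, \int[P]_w (\1_(A n) w *
      (cos (s * Y n w + phi) - \int[N w]_x cos (s * x + phi))) @[n --> \oo] --> 0) ->
  forall (f : R -> R) (c : R), continuous f -> (forall x, `|f x| <= c) ->
  \int[P]_w (\1_(A n) w * (f (Y n w) - \int[N w]_x f x)) @[n --> \oo] --> 0.
Proof.
move=> mA trig f c cf fc.
have E (g : R -> R) n : measurable_fun setT g ->
    \int[P]_w (\1_(A n) w * (\int[kdirac (measurable_funPT (Y n)) w]_x g x - \int[N w]_x g x)) =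
    \int[P]_w (\1_(A n) w * (g (Y n w) - \int[N w]_x g x)).
  move=> mg; apply: eq_Rintegral => w _; rewrite Rintegral_kdirac//.
have mf : measurable_fun setT f by exact: continuous_measurable_borel.
have := @kernel_cvg _ T R P A (fun n => kdirac (measurable_funPT (Y n))) N mA _ f c cf fc.
under eq_fun do rewrite E//.
apply => s phi; under eq_fun do rewrite (E _ _ (measurable_affine_cos s phi)).
exact: trig.
Qed.

Lemma cvg_cos_kernel_pair (A : nat -> set T) (Y : nat -> {RV P >-> (R * R)%type})
    (N : R.-pker T ~> (R * R)%type) :
  (forall n, measurable (A n)) ->
  (forall s t phi : R, \int[P]_w (\1_(A n) w *
      (cos (s * (Y n w).1 + t * (Y n w).2 + phi) -
       \int[N w]_x cos (s * x.1 + t * x.2 + phi))) @[n --> \oo] --> 0) ->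
  forall (f : R * R -> R) (c : R), continuous f -> (forall x, `|f x| <= c) ->
  \int[P]_w (\1_(A n) w * (f (Y n w) - \int[N w]_x f x)) @[n --> \oo] --> 0.
Proof.
move=> mA trig f c cf fc.
have E (g : R * R -> R) n : measurable_fun setT g ->
    \int[P]_w (\1_(A n) w * (\int[kdirac (measurable_funPT (Y n)) w]_x g x - \int[N w]_x g x)) =
    \int[P]_w (\1_(A n) w * (g (Y n w) - \int[N w]_x g x)).
  move=> mg; apply: eq_Rintegral => w _; rewrite Rintegral_kdirac//.
have mf : measurable_fun setT f by exact: continuous_measurable_borel.
have := @kernel_pair_cvg _ T R P A (fun n => kdirac (measurable_funPT (Y n))) N mA _ f c cf fc.
under eq_fun do rewrite E//.
apply => s t phi; under eq_fun do rewrite (E _ _ (measurable_cos2 s t phi)).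
exact: trig.
Qed.

(** Gaussian laws depend continuously on the variance, whence convergence in
    $L^1$ of the integrals when the variances converge in probability. *)
Lemma gauss_kernel_L1_cvg (Vq : nat -> {mfun T >-> R}) (V : {mfun T >-> R}) (f : R -> R) (c : R) :
  (forall q w, 0 <= Vq q w) -> (forall w, 0 <= V w) ->
  (forall s, pdist P (fun w => s ^+ 2 * Vq q w) (fun w => s ^+ 2 * V w) @[q --> \oo] --> 0) ->
  continuous f -> (forall x, `|f x| <= c) ->
  \int[P]_w `|\int[gauss_kernel (Vq q) w]_x f x - \int[gauss_kernel V w]_x f x| @[q --> \oo] --> 0.
Proof.
move=> Vq0 V0 hV cf fc.
have mf : measurable_fun setT f by exact: continuous_measurable_borel.
have mL (L : {mfun T >-> R}) : measurable_fun setT (fun w => \int[gauss_kernel L w]_x f x).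
  exact: measurable_Rintegral_kernel fc.
have Lc (L : {mfun T >-> R}) w : `|\int[gauss_kernel L w]_x f x| <= c.
  exact: Rintegral_kernel_norm_le.
have [g gE] : exists g : nat -> T -> R, forall q w, \int[gauss_kernel (Vq q) w]_x f x = g q w.
  by eexists.
have [h hE] : exists h : T -> R, forall w, \int[gauss_kernel V w]_x f x = h w by eexists.
have mg q : measurable_fun setT (g q) by rewrite -(funext (gE q)).
have mh : measurable_fun setT h by rewrite -(funext hE).
have gc q w : `|g q w| <= c by rewrite -gE.
have hc w : `|h w| <= c by rewrite -hE.
have lim (A : nat -> set T) : (forall n, measurable (A n)) ->
    \int[P]_w (\1_(A n) w * (g n w - h w)) @[n --> \oo] --> 0.
  move=> mA.
  suff trig s phi : \int[P]_w (\1_(A n) w * (\int[gauss_kernel (Vq n) w]_x cos (s * x + phi) -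
      \int[gauss_kernel V w]_x cos (s * x + phi))) @[n --> \oo] --> 0.
    apply: cvg_trans (kernel_cvg (M := fun n => gauss_kernel (Vq n)) mA trig cf fc).
    apply: near_eq_cvg; apply: nearW => n; apply: eq_Rintegral => w _.
    by rewrite -gE -hE.
  apply: squeeze0 (hV s); apply: nearW => n.
  have mexp (L : {mfun T >-> R}) : measurable_fun setT (fun w => expR (- (s ^+ 2 * L w) / 2) * cos phi).
    apply: measurable_funM => //; apply: measurableT_comp => //; apply: measurable_funM => //.
    by apply: measurableT_comp => //; exact: measurable_funM.
  rewrite (_ : \int[P]_w _ = \int[P]_w (\1_(A n) w * (expR (- (s ^+ 2 * Vq n w) / 2) * cos phi -
      expR (- (s ^+ 2 * V w) / 2) * cos phi))); last first.
    by apply: eq_Rintegral => w _; rewrite !gauss_kernel_cos.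
  have le1 w : `|\1_(A n) w * (expR (- (s ^+ 2 * Vq n w) / 2) * cos phi -
      expR (- (s ^+ 2 * V w) / 2) * cos phi)| <= Num.min `|s ^+ 2 * Vq n w - s ^+ 2 * V w| 1.
    rewrite -mulrBl !normrM -[leRHS]mul1r -[leRHS]mulr1 -mulrA.
    rewrite !ler_pM ?norm_indic_le1 ?cos_max ?mulr_ge0//.
    by rewrite exp_half_lipschitz// mulr_ge0// sqr_ge0.
  have im : P.-integrable setT (EFin \o (fun w => Num.min `|s ^+ 2 * Vq n w - s ^+ 2 * V w| 1)).
    by apply: integrable_min1; apply: measurable_funB; exact: measurable_funM.
  apply: Rint_norm_le => //; apply: dominated_integrable le1 im.
  by apply: measurable_funM; [exact: measurable_indic|exact: measurable_funB].
pose A q := [set w | h w < g q w].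
have mA q : measurable (A q).
  rewrite (_ : A q = (fun w => g q w - h w) @^-1` `]0, +oo[%classic); last first.
    by apply/seteqP; split => w; rewrite /= in_itv/= andbT subr_gt0.
  have md : measurable_fun setT (fun w => g q w - h w) by exact: measurable_funB (mg q) mh.
  rewrite -[X in measurable X]setTI; apply: md => //; exact: measurable_itv.
have := cvg0D (lim A mA) (cvg0Zl (-1) (lim (fun q => ~` A q) (fun q => measurableC (mA q)))).
apply: cvg_trans; apply: near_eq_cvg; apply: nearW => q.
have id : P.-integrable setT (EFin \o (fun w => g q w - h w)).
  by apply: integrable_realB; [exact: bounded_integrable (gc q)|exact: bounded_integrable hc].
have i1 (B : set T) : measurable B ->
    P.-integrable setT (EFin \o (fun w => \1_B w * (g q w - h w))).
  by move=> mB; apply: integrable_boundedM (norm_indic_le1 R B) id; exact: measurable_indic.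
have i2 := i1 _ (measurableC (mA q)).
rewrite -RintegralZl// -RintegralD//; [|exact: i1|exact: integrable_realZ].
apply: eq_Rintegral => w _; rewrite gE hE !indicE in_setC.
have [|] := boolP (w \in A q); rewrite ?inE ?notin_setE /A/= => hw.
  by rewrite mul1r mul0r mulr0 addr0 gtr0_norm ?subr_gt0.
rewrite mul1r mul0r add0r mulN1r ler0_norm// subr_le0 leNgt; exact/negP.
Qed.

End from_trigonometric_limits.

Section conditional_expectations_converge.
Context d (T : measurableType d) (R : realType) (P : probability T R).
Variable G : nat -> set (set T).
Hypothesis hG : forall n, sub_sigma_field (G n).
Hypothesis Gmono : forall m n, (m <= n)%N -> G m `<=` G n.

(** For large $n$ the approximation $g_q$ of $g$ is known at time $n$, and so is the
    event $E_n > g_q$. Testing against this event computes the $L^1$ distance of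
    $E_n$ and $g_q$. *)
Lemma cond_exp_cvg_in_prob (F E gq : nat -> T -> R) (g : T -> R) (r : nat -> nat) (c : R) :
  (forall n, measurable_fun setT (F n)) -> (forall n w, `|F n w| <= c) ->
  (forall n, is_cond_exp P (G n) (F n) (E n)) ->
  measurable_fun setT g -> (forall w, `|g w| <= c) ->
  (forall q, gmeasurable (G (r q)) (gq q)) -> (forall q w, `|gq q w| <= c) ->
  \int[P]_w `|gq q w - g w| @[q --> \oo] --> 0 ->
  (forall A : nat -> set T, (forall n, G n (A n)) ->
     \int[P]_w (\1_(A n) w * (F n w - g w)) @[n --> \oo] --> 0) ->
  cvg_in_prob P (fun n w => (E n w)%:E) g.
Proof.
move=> mF Fc FE mg gc mgq gqc gqg lim.
have iF n : P.-integrable setT (EFin \o F n) := bounded_integrable P (mF n) (Fc n).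
have ig : P.-integrable setT (EFin \o g) := bounded_integrable P mg gc.
have mgqT q : measurable_fun setT (gq q) := gmeasurable_measurable (hG _) (mgq q).
have igq q : P.-integrable setT (EFin \o gq q) := bounded_integrable P (mgqT q) (gqc q).
have iE n : P.-integrable setT (EFin \o E n) := cond_exp_integrable (FE n).
have mE n := cond_exp_gmeasurable (hG n) (FE n).
have mET n : measurable_fun setT (E n) := gmeasurable_measurable (hG _) (mE n).
have GT n : G n setT.
  by rewrite -(measurable_gE (hG n)); exact: measurableT.
apply: pdist_cvg_in_prob => //; apply: cvg0_eps => e e0.
move/cvgrPdist_lt : gqg => /(_ _ (divr_gt0 e0 (ltr0n R 4)))[q _ /(_ q (leqnn _))].
rewrite /= sub0r normrN ger0_norm; last exact: Rintegral_ge0.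
set D := \int[P]_w _ => Dq.
pose A n := if (r q <= n)%N then [set w | 0 < E n w - gq q w] else setT.
have GA n : G n (A n).
  rewrite /A; case: ifPn => // rn.
  rewrite (_ : [set w | _] = (fun w => E n w - gq q w) @^-1` `]0, +oo[%classic); last first.
    by apply/seteqP; split => w; rewrite /= in_itv/= andbT.
  have mEg : gmeasurable (G n) (fun w => E n w - gq q w).
    apply: measurable_funB; first exact: mE.
    by apply: (gmeasurable_mono (hG (r q))) => //; exact: Gmono.
  by apply: (gmeasurable_set (hG n) mEg); exact: measurable_itv.
pose I (B : nat -> set T) n := \int[P]_w (\1_(B n) w * (F n w - g w)).
exists (fun n => 2 * `|I A n| + `|I (fun=> setT) n|).
  apply: cvg0D; first apply: cvg0Zl.
    by rewrite -(normr0 R); apply: cvg_norm; exact: lim.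
  by rewrite -(normr0 R); apply: cvg_norm; exact: lim.
near=> n; have rn : (r q <= n)%N by near: n; exact: nbhs_infty_ge.
rewrite [leLHS]ger0_norm ?pdist_ge0//.
have i0 (B : set T) (f : T -> R) : G n B -> P.-integrable setT (EFin \o f) ->
    P.-integrable setT (EFin \o (fun w => \1_B w * f w)).
  move=> GB; apply: integrable_boundedM (norm_indic_le1 R B).
  by apply: measurable_indic; exact: (hG n).2.
(* On an event of the past $E_n$ integrates like $F_n$. *)
have key (B : nat -> set T) : G n (B n) ->
    `|\int[P]_w (\1_(B n) w * (E n w - gq q w))| <= `|I B n| + D.
  move=> GB.
  have -> : \int[P]_w (\1_(B n) w * (E n w - gq q w)) =
      I B n - \int[P]_w (\1_(B n) w * (gq q w - g w)).
    have dist (f h : T -> R) : P.-integrable setT (EFin \o f) ->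
        P.-integrable setT (EFin \o h) -> \int[P]_w (\1_(B n) w * (f w - h w)) =
        \int[P]_w (\1_(B n) w * f w) - \int[P]_w (\1_(B n) w * h w).
      move=> i1 i2; rewrite -RintegralB//; [|exact: i0..].
      by apply: eq_Rintegral => w _; rewrite mulrBr.
    rewrite /I !dist// (cond_exp_bounded (hG n) (iF n) (FE n) _ (norm_indic_le1 R (B n))).
      by ring.
    exact: gmeasurable_indic.
  rewrite (le_trans (ler_normB _ _))// lerD2l; apply: Rint_norm_le.
  - by apply: i0 => //; exact: integrable_realB.
  - by apply: integrable_real_norm; exact: integrable_realB.
  - by move=> w; rewrite normrM ler_piMl// norm_indic_le1.
have h1 := key A (GA n); have h2 := key (fun=> setT) (GT n).
have i1 : P.-integrable setT (EFin \o (fun w => E n w - gq q w)) by exact: integrable_realB.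
have i2 : P.-integrable setT (EFin \o (fun w => gq q w - g w)) by exact: integrable_realB.
have i3 := i0 _ _ (GA n) i1; have i4 := i0 _ _ (GT n) i1.
apply: (@le_trans _ _ (\int[P]_w (2 * (\1_(A n) w * (E n w - gq q w)) -
    \1_setT w * (E n w - gq q w) + `|gq q w - g w|))).
  apply: pdist_le => //.
    apply: integrable_realD; last exact: integrable_real_norm.
    by apply: integrable_realB => //; exact: integrable_realZ.
  move=> w; rewrite (_ : E n w - g w = (E n w - gq q w) + (gq q w - g w)); last by ring.
  rewrite (le_trans (ler_normD _ _))// lerD2r indicT indicE /A rn.
  have [|] := boolP (w \in [set w | 0 < E n w - gq q w]); rewrite ?inE ?notin_setE/=.
    by move=> hw; rewrite gtr0_norm//; lra.
  by move=> /negP; rewrite -leNgt => hw; rewrite ler0_norm//; lra.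
rewrite RintegralD//; last 2 first.
- by apply: integrable_realB => //; exact: integrable_realZ.
- exact: integrable_real_norm.
rewrite RintegralB//; last exact: integrable_realZ.
rewrite RintegralZl// -/D.
move: h1 h2; set a := \int[P]_w _; set b := \int[P]_w _.
have := ler_norm a; have := ler_norm (- b); rewrite normrN; lra.
Unshelve. all: by end_near. Qed.

End conditional_expectations_converge.

(** * Limits of the statistics *)
Section limits_of_the_statistics.
Context (R : realType) (d : measure_display) (T : measurableType d)
  (P : probability T R) (G : nat -> set (set T)).
Variables X Z : nat -> {RV P >-> R}.
Variables Zlim U V : {RV P >-> R}.
Hypothesis hG : forall n, sub_sigma_field (G n).
Hypothesis hGmono : forall m n, (m <= n)%N -> G m `<=` G n.
Hypothesis hU : forall w, 0 <= U w.
Hypothesis hV : forall w, 0 <= V w.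

Let C n : {RV P >-> R} := C_stat X Z n.
Let D n : {RV P >-> R} := D_stat Z Zlim n.

Let id_oo k : \forall n \near \oo, (k <= id n)%N.
Proof. exact: nbhs_infty_ge. Qed.

Section mean.
Variable y : nat -> nat -> T -> R.
Hypothesis yclt : clt_array P G (fun=> 0%N) id y U.
Hypothesis ysum : forall n w, \sum_(0 <= k < n) y n k w = C_stat X Z n w.

Lemma mean_stable_cvg : stable_cvg P C (gauss_kernel U).
Proof.
apply: stable_cvg_of_integrals => H f c mH cf fc.
apply: (cvg_cos_kernel (A := fun=> H) _ _ cf fc) => // s phi.
have := clt_array_stable hG hGmono phi (clt_array_scale hG s yclt) id_oo mH.
apply: cvg_trans; apply: near_eq_cvg; apply: nearW => n.
apply: eq_Rintegral => w _; rewrite (gauss_kernel_cos s phi (hU w)).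
have e : s * C n w = \sum_(0 <= k < n) s * y n k w by rewrite -mulr_sumr ysum.
by rewrite e.
Qed.

End mean.

Section limit.
Variables (N : nat -> nat) (x : nat -> nat -> T -> R).
Hypothesis xclt : clt_array P G id N x V.
Hypothesis nN : forall n, (n <= N n)%N.
Hypothesis iD : forall n, P.-integrable setT (EFin \o D n).
Hypothesis xsum : \int[P]_w `|D n w - \sum_(n <= k < N n) x n k w| @[n --> \oo] --> 0.

Let ix n : P.-integrable setT (EFin \o (fun w => \sum_(n <= k < N n) x n k w)).
Proof.
rewrite (_ : (fun w => _) = fun w => \sum_(n <= k < N n) (if (n <= k < N n)%N then x n k else cst 0) w).
  apply: integrable_real_sum => k _; case: ifPn => [kN|_]; last exact: integrable_real_cst.
  exact: (clt_int xclt kN).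
by apply/funext => w; rewrite big_nat [RHS]big_nat; apply: eq_bigr => k ->.
Qed.

Let mx n : measurable_fun setT (fun w => \sum_(n <= k < N n) x n k w).
Proof. exact: measurable_of_integrable (ix n). Qed.

Let tail_cvg0 (t : R) (a : nat -> T -> R) :
  \int[P]_w `|(a n w + t * D n w) - (a n w + t * \sum_(n <= k < N n) x n k w)| @[n --> \oo] --> 0.
Proof.
have := cvg0Zl `|t| xsum; apply: cvg_trans; apply: near_eq_cvg; apply: nearW => n.
rewrite -RintegralZl//; last first.
  by apply: integrable_real_norm; exact: integrable_realB.
by apply: eq_Rintegral => w _; rewrite -normrM; congr `|_|; ring.
Qed.

Let integrable_tail (t : R) (a : nat -> T -> R) n : P.-integrable setT
  (EFin \o (fun w => (a n w + t * D n w) - (a n w + t * \sum_(n <= k < N n) x n k w))).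
Proof.
rewrite (_ : (fun w => _) = fun w => t * (D n w - \sum_(n <= k < N n) x n k w)).
  by apply: integrable_realZ; exact: integrable_realB.
by apply/funext => w; ring.
Qed.

Let mexp (L : T -> R) (phi : R) : measurable_fun setT L ->
  measurable_fun setT (fun w => expR (- L w / 2) * cos phi).
Proof.
move=> mL; apply: measurable_funM => //; apply: measurableT_comp => //.
by apply: measurable_funM => //; exact: measurableT_comp.
Qed.

Let exp_le1 (L : T -> R) (phi : R) : (forall w, 0 <= L w) ->
  forall w, `|expR (- L w / 2) * cos phi| <= 1.
Proof.
move=> L0 w; rewrite normrM mulr_ile1// ?cos_max//.
by rewrite ger0_norm ?expR_ge0// expR_le1; have := L0 w; lra.
Qed.

(** The row of $D_n$ starts at time $n$, so that the event may vary with $n$. *)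
Lemma limit_conditional_cvg (A : nat -> set T) (f : R -> R) (c : R) :
  (forall n, G n (A n)) -> continuous f -> (forall x, `|f x| <= c) ->
  \int[P]_w (\1_(A n) w * (f (D n w) - \int[gauss_kernel V w]_x f x)) @[n --> \oo] --> 0.
Proof.
move=> GA cf fc; have mA n : measurable (A n) by exact: (hG n).2.
apply: (cvg_cos_kernel mA _ cf fc) => s phi.
have xs := clt_array_scale hG s xclt.
have := clt_array_conditional hG hGmono xs id_oo phi
  (fun n => gmeasurable_indic (R := R) (hG n) (GA n)) (fun n w => norm_indic_le1 R (A n) w).
set g := fun w => s ^+ 2 * V w => lim.
have mg : measurable_fun setT g by exact: measurable_funM.
have g0 w : 0 <= g w by rewrite mulr_ge0// sqr_ge0.
have : \int[P]_w (\1_(A n) w * (cos (phi + s * D n w) - expR (- g w / 2) * cos phi)) @[n --> \oo] --> 0.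
  have tail := tail_cvg0 s (fun _ _ => phi).
  apply: (Rint_cos_replace (a := fun n w => phi + s * \sum_(n <= k < N n) x n k w)
    (b := fun n w => phi + s * D n w)) => //.
  - by move=> n; apply: measurable_funD => //; exact: measurable_funM.
  - by move=> n; apply: measurable_funD => //; exact: measurable_funM.
  - exact: mexp.
  - exact: exp_le1.
  - exact: (integrable_tail s (fun _ _ => phi)).
  move: lim; apply: cvg_trans; apply: near_eq_cvg; apply: nearW => n.
  by apply: eq_Rintegral => w _; rewrite mulr_sumr (addrC phi).
apply: cvg_trans; apply: near_eq_cvg; apply: nearW => n.
by apply: eq_Rintegral => w _; rewrite (gauss_kernel_cos s phi (hV w)) (addrC phi).
Qed.

(** The kernel $\mathcal{N}(0, V)$ is approximated by the Gaussian kernels whose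
    variances are the quadratic variations of the rows, each of which is
    measurable for some member of the filtration. *)
Lemma limit_stable_strong_cvg : stable_strong_cvg P G D (gauss_kernel V).
Proof.
move=> f cf [c0 [_ fc0]] E hE.
pose c := c0 + 1; have fc z : `|f z| <= c by apply: fc0 => //; rewrite ltrDl.
have mf : measurable_fun setT f by exact: continuous_measurable_borel.
pose Q q w := \sum_(q <= k < N q) x q k w ^+ 2.
have gQ q : gmeasurable (G (N q)) (Q q).
  apply: measurable_sum_nat => k kN; apply: measurable_funX.
  apply: (gmeasurable_mono (hG k.+1)) => //; first by apply: hGmono; case/andP: kN.
  exact: (clt_meas xclt kN).
have mQ q : measurable_fun setT (Q q) by exact: gmeasurable_measurable (gQ q).
have Q0 q w : 0 <= Q q w by apply: sumr_ge0 => k _; exact: sqr_ge0.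
pose Vq q : {mfun T >-> R} := HB.pack (Q q) (isMeasurableFun.Build _ _ T R (Q q) (mQ q)).
pose Vg q : {mfun g_sigma_algebraType (G (N q)) >-> R} :=
  HB.pack (Q q : g_sigma_algebraType (G (N q)) -> R)
    (isMeasurableFun.Build _ _ (g_sigma_algebraType (G (N q))) R (Q q) (gQ q)).
have gqE q w : \int[gauss_kernel (Vq q) w]_z f z = \int[gauss_kernel (Vg q) w]_z f z by [].
have h1 := gauss_kernel_L1_cvg (Vq := Vq) Q0 hV _ cf fc.
apply: (cond_exp_cvg_in_prob hG hGmono (F := fun n => f \o D n)
  (gq := fun q w => \int[gauss_kernel (Vq q) w]_z f z) (r := N) (c := c)) => //.
- by move=> n; exact: measurableT_comp.
- by move=> n w; exact: fc.
- exact: measurable_Rintegral_kernel fc.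
- by move=> w; exact: Rintegral_kernel_norm_le.
- move=> q; rewrite /gmeasurable (funext (gqE q)).
  exact: (measurable_Rintegral_kernel (gauss_kernel (Vg q)) mf fc).
- by move=> q w; exact: Rintegral_kernel_norm_le.
- apply: h1 => s; have := clt_qvar (clt_array_scale hG s xclt).
  apply: cvg_trans; apply: near_eq_cvg; apply: nearW => q.
  apply: eq_Rintegral => w _; rewrite /= /Q mulr_sumr; congr (Num.min `|_ - _| 1).
  by apply: eq_bigr => k _; rewrite exprMn.
- by move=> A GA; exact: limit_conditional_cvg.
Qed.

Variable y : nat -> nat -> T -> R.
Hypothesis yclt : clt_array P G (fun=> 0%N) id y U.
Hypothesis ysum : forall n w, \sum_(0 <= k < n) y n k w = C_stat X Z n w.

(** The row of $D_n$ starts where the row of $C_n$ stops, so that the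
    concatenated rows form one array, whose limiting variance is the sum. *)
Lemma pair_stable_cvg :
  stable_cvg P (fun n => rv_pair (C_stat X Z n) (D_stat Z Zlim n) : {RV P >-> (R * R)%type})
    (kernel_prod (gauss_kernel U) (gauss_kernel V)).
Proof.
apply: stable_cvg_of_integrals => H f c mH cf fc.
apply: (cvg_cos_kernel_pair (A := fun=> H) _ _ cf fc) => // s t phi.
have arr := clt_array_cat hG (clt_array_scale hG s yclt) (clt_array_scale hG t xclt).
have Noo k : \forall n \near \oo, (k <= N n)%N.
  by apply: filterS (nbhs_infty_ge k) => n kn; exact: leq_trans kn (nN n).
have := clt_array_stable hG hGmono phi arr Noo mH.
set g := fun w => s ^+ 2 * U w + t ^+ 2 * V w => lim.
have mg : measurable_fun setT g by apply: measurable_funD; exact: measurable_funM.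
have g0 w : 0 <= g w by rewrite addr_ge0// mulr_ge0// sqr_ge0.
have mC n : measurable_fun setT (fun w => phi + s * C n w).
  by apply: measurable_funD => //; exact: measurable_funM.
have : \int[P]_w (\1_H w * (cos (phi + s * C n w + t * D n w) - expR (- g w / 2) * cos phi)) @[n --> \oo] --> 0.
  have tail := tail_cvg0 t (fun n w => phi + s * C n w).
  apply: (Rint_cos_replace (A := fun=> H)
    (a := fun n w => phi + s * C n w + t * \sum_(n <= k < N n) x n k w)
    (b := fun n w => phi + s * C n w + t * D n w)) => //.
  - by move=> n; apply: measurable_funD => //; exact: measurable_funM.
  - by move=> n; apply: measurable_funD => //; exact: measurable_funM.
  - exact: mexp.
  - exact: exp_le1.
  - exact: (integrable_tail t (fun n w => phi + s * C n w)).
  move: lim; apply: cvg_trans; apply: near_eq_cvg; apply: nearW => n.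
  apply: eq_Rintegral => w _.
  have e : \sum_(0 <= k < N n) (if (k < n)%N then fun w => s * y n k w else fun w => t * x n k w) w =
      s * C n w + t * \sum_(n <= k < N n) x n k w.
    rewrite (clt_array_sum_cat (m := fun=> 0%N) (r := id) (fun n k w => s * y n k w)
      (fun n k w => t * x n k w) w (leq0n n) (nN n)).
    by rewrite -!mulr_sumr ysum.
  by rewrite e -(addrA phi) (addrC phi).
apply: cvg_trans; apply: near_eq_cvg; apply: nearW => n.
apply: eq_Rintegral => w _; rewrite (gauss_kernel_prod_cos s t phi (hU w) (hV w)).
by rewrite /rv_pair /= -(addrA phi) (addrC phi).
Qed.

End limit.

End limits_of_the_statistics.

(* W n is a version of E(Z_{n+1} | G_n); X 0 is unused. *)
Theorem theorem2 (R : realType) (d : measure_display) (T : measurableType d)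
    (P : probability T R) (G : nat -> set (set T))
    (X Z W : nat -> {RV P >-> R}) (Zlim U V : {RV P >-> R})
    (hG : forall n, sub_sigma_field (G n))
    (hGmono : forall m n, (m <= n)%N -> G m `<=` G n)
    (hXint : forall n, (1 <= n)%N -> P.-integrable setT (EFin \o X n))
    (hZ : forall n, is_cond_exp P (G n) (X n.+1) (Z n))
    (hXadapted : forall n, (1 <= n)%N ->
       g_sigma_algebra_preimage (X n) `<=` G n)
    (hXui : uniformly_integrable P (fun n w => (X n.+1 w) ^+ 2))
    (hW : forall n, is_cond_exp P (G n) (Z n.+1) (W n))
    (hrate : ((n%:R ^+ 3)%:E * 'E_P[fun w => ((W n w - Z n w) ^+ 2)%R])%E
               @[n --> \oo] --> 0%E)
    (hZas : {ae P, forall w, Z n w @[n --> \oo] --> Zlim w})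
    (hZL1 : 'E_P[fun w => (`|Z n w - Zlim w|)%R]%E @[n --> \oo] --> 0%E)
    (hU : forall w, 0 <= U w) (hV : forall w, 0 <= V w) :
  [/\ cond_a P Z -> cond_b P X Z U ->
        stable_cvg P (fun n => C_stat X Z n : {RV P >-> R}) (gauss_kernel U),
      cond_c P Z -> cond_d P Z V ->
        stable_strong_cvg P G (fun n => D_stat Z Zlim n : {RV P >-> R})
          (gauss_kernel V) &
      cond_a P Z -> cond_b P X Z U -> cond_c P Z -> cond_d P Z V ->
        stable_cvg P
          (fun n => rv_pair (C_stat X Z n) (D_stat Z Zlim n) :
             {RV P >-> (R * R)%type})
          (kernel_prod (gauss_kernel U) (gauss_kernel V))].
Proof.
have meanE := mean_array_clt hG hGmono hXint hZ hW hrate hU hXadapted hXui.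
have limE := limit_array_clt hG hGmono hZ hW hrate hV hZL1.
split.
- by move=> ha hb; exact: (mean_stable_cvg hG hGmono hU (meanE ha hb) (mean_array_sum X Z)).
- move=> hc hd; have [N [xclt nN iD xsum]] := limE hc hd.
  exact: (limit_stable_strong_cvg hG hGmono hV xclt iD xsum).
- move=> ha hb hc hd; have [N [xclt nN iD xsum]] := limE hc hd.
  exact: (pair_stable_cvg hG hGmono hU hV xclt nN iD xsum (meanE ha hb) (mean_array_sum X Z)).
Qed.
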